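(* Let $f=(f_1,\dots,f_n)$ be an $n$-tuple of power series with the model property. Let $J\ne H^\infty(\mathbb B_f)$ be a WOT-closed two-sided ideal of the Hardy algebra $H^\infty(\mathbb B_f)$ and let $(B_1,\dots,B_n)$ be the corresponding universal model acting on $\mathcal N_{f,J}$. For each $j=1,2$, let $\mathcal K_j$ be a Hilbert space and $\mathcal E_j\subseteq\mathcal N_{f,J}\otimes\mathcal K_j$ be a (closed) co-invariant subspace under each operator $B_1\otimes I_{\mathcal K_j},\dots,B_n\otimes I_{\mathcal K_j}$ (that is, invariant under each $B_i^*\otimes I_{\mathcal K_j}$). If $X:\mathcal E_1\to\mathcal E_2$ is a bounded operator such that $$X[P_{\mathcal E_1}(B_i\otimes I_{\mathcal K_1})|_{\mathcal E_1}]=[P_{\mathcal E_2}(B_i\otimes I_{\mathcal K_2})|_{\mathcal E_2}]X,\qquad i=1,\dots,n,$$ then there exists an operator $G:\mathcal N_{f,J}\otimes\mathcal K_1\to\mathcal N_{f,J}\otimes\mathcal K_2$ with the following properties: (i) $G(B_i\otimes I_{\mathcal K_1})=(B_i\otimes I_{\mathcal K_2})G$ for $i=1,\dots,n$; (ii) $G^*\mathcal E_2\subseteq\mathcal E_1$, $G^*|_{\mathcal E_2}=X^*$, and $\|G\|=\|X\|$.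
   Context: Words and series. $\mathbb F_n^+$ is the free semigroup of words in the letters $1,\dots,n$, with empty word $\varnothing$; $|\alpha|$ is the length of $\alpha$. For an $n$-tuple $Y=(Y_1,\dots,Y_n)$ of elements of a unital algebra, $Y_\alpha:=Y_{i_1}\cdots Y_{i_k}$ if $\alpha=i_1\cdots i_k$, and $Y_\varnothing:=1$. Power series are formal power series $\psi=\sum_\alpha a_\alpha Z_\alpha$ with complex coefficients in noncommuting indeterminates $Z_1,\dots,Z_n$. For $Y\in B(\mathcal H)^n$ put $\psi(Y):=\sum_{k\ge0}\sum_{|\alpha|=k}a_\alpha Y_\alpha$ (series over $k$); $\mathcal C_\psi(\mathcal H)$ (resp. $\mathcal C_\psi^{SOT}(\mathcal H)$) is the set of $Y$ for which this converges in norm (resp. in the strong operator topology, SOT). $\mathcal C_\psi^{rad}(\mathcal H)$ is the set of $Y$ for which there is $\delta\in(0,1)$ with $rY\in\mathcal C_\psi(\mathcal H)$ for $r\in(\delta,1)$ and $\text{SOT-}\lim_{r\to1}\psi(rY)$ exists; then $\psi(Y)$ denotes this limit. For an $n$-tuple $f=(f_1,\dots,f_n)$ of power series these conditions are required for every $f_i$. $[B(\mathcal H)^n]_r:=\{X\in B(\mathcal H)^n:\|\sum_iX_iX_i^*\|^{1/2}<r\}$. A free holomorphic function on $[B(\mathcal H)^n]_\gamma$ is (the evaluation map of) a power series with $\limsup_k(\sum_{|\alpha|=k}|a_\alpha|^2)^{1/2k}\le1/\gamma$. Model property. $\mathbb H^2(f)$ denotes the Hilbert space with orthonormal basis $\{f_\alpha\}_{\alpha\in\mathbb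 F_n^+}$ ($f_\varnothing=1$), whose elements are the series $\sum_\alpha c_\alpha f_\alpha$, $\sum|c_\alpha|^2<\infty$. $f$ has the model property ($f\in\mathcal M$) if one of the following holds. ($\mathcal A$) $f$ is an $n$-tuple of noncommutative polynomials and there is an $n$-tuple $q$ of polynomials with $f\circ q=q\circ f=\mathrm{id}$. ($\mathcal S$) $f(0)=0$, each $f_i$ has nonzero radius of convergence, the matrix of linear coefficients of $f$ is invertible ($\det J_f(0)\ne0$; then elements of $\mathbb H^2(f)$ are formal power series), $Z_1,\dots,Z_n\in\mathbb H^2(f)$, each $M_{Z_i}\psi:=Z_i\psi$ is a bounded operator on $\mathbb H^2(f)$, and $M_{f_j}=f_j(M_{Z_1},\dots,M_{Z_n})$, where $M_{f_j}\psi:=f_j\psi$ and $(M_{Z_1},\dots,M_{Z_n})$ is in $\mathcal C_f^{SOT}(\mathbb H^2(f))$ or $\mathcal C_f^{rad}(\mathbb H^2(f))$. ($\mathcal F$) for some $\gamma>0$, $f$ is an $n$-tuple of free holomorphic functions on $[B(\mathcal H)^n]_\gamma$ ($\mathcal H$ infinite dimensional) with range in $[B(\mathcal H)^n]_1$, there is no nonzero free holomorphic $G$ on $[B(\mathcal H)^n]_1$ with $G\circ f=0$ (then $\mathbb H^2(f)=\{G\circ f: G=\sum c_\alpha Z_\alpha,\ \sum|c_\alpha|^2<\infty\}$), the coordinate functions lie in $\mathbb H^2(f)$, and the boundedness of $M_{Z_i}$ and $M_{f_j}=f_j(M_{Z_1},\dots,M_{Z_n})$ hold as in ($\mathcal S$).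 The universal model of the noncommutative domain $\mathbb B_f$ is $M_Z=(M_{Z_1},\dots,M_{Z_n})$. Universal model of a variety. $H^\infty(\mathbb B_f)$ is the WOT-closure (weak operator topology) in $B(\mathbb H^2(f))$ of all polynomials in $M_{Z_1},\dots,M_{Z_n}$ and the identity. For a WOT-closed two-sided ideal $J$ of it, $\mathcal N_{f,J}:=\mathbb H^2(f)\ominus\overline{J\mathbb H^2(f)}$ and the corresponding universal model is $(B_1,\dots,B_n)$ with $B_i:=P_{\mathcal N_{f,J}}M_{Z_i}|_{\mathcal N_{f,J}}$. $P_{\mathcal E}$ denotes the orthogonal projection onto $\mathcal E$. *)

(* Defs.v *)
From HB Require Import structures.
From mathcomp Require Import all_boot all_order all_algebra.
From mathcomp Require Import all_classical all_reals all_analysis.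
From mathcomp Require Import complex.

Set Implicit Arguments.
Unset Strict Implicit.
Unset Printing Implicit Defensive.

Import Order.TTheory GRing.Theory Num.Theory.
Import numFieldNormedType.Exports.

Local Open Scope classical_set_scope.
Local Open Scope ring_scope.

(** Complex Hilbert spaces.  The norm of a normed module over [R[i]] takes its
    values in [R[i]]; [hnorm] is its real version. *)

HB.mixin Record NormedModule_isHilbert (R : realType) H
    of CompleteNormedModule R[i] H := {
  inner : H -> H -> R[i];
  inner_linear : forall (a : R[i]) (x y z : H),
    inner (a *: x + y) z = a * inner x z + inner y z;
  inner_conj : forall x y : H, inner y x = (inner x y)^*;
  inner_norm : forall x : H, inner x x = `|x| ^+ 2
}.

#[short(type="hilbertType")]
HB.structure Definition Hilbert (R : realType) :=
  {H of CompleteNormedModule R[i] H & NormedModule_isHilbert R H}.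

Section HilbertTheory.
Context {R : realType} {H : hilbertType R}.
Implicit Types (x y z : H) (a : R[i]).

Lemma innerDl x y z : inner (x + y) z = inner x z + inner y z.
Proof. by rewrite -[x]scale1r inner_linear mul1r scale1r. Qed.

Lemma inner0l z : inner 0 z = 0.
Proof. by apply: (addrI (inner 0 z)); rewrite -innerDl !addr0. Qed.

Lemma innerZl a x z : inner (a *: x) z = a * inner x z.
Proof. by rewrite -[a *: x]addr0 inner_linear inner0l addr0. Qed.

Lemma innerNl x z : inner (- x) z = - inner x z.
Proof. by rewrite -scaleN1r innerZl mulN1r. Qed.

Lemma innerBl x y z : inner (x - y) z = inner x z - inner y z.
Proof. by rewrite innerDl innerNl. Qed.

Lemma innerBr x y z : inner z (x - y) = inner z x - inner z y.
Proof.
by rewrite (inner_conj x z) (inner_conj y z) -rmorphB -innerBl; exact: inner_conj.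
Qed.

Lemma innerZr a x z : inner z (a *: x) = a^* * inner z x.
Proof. by rewrite (inner_conj x z) -rmorphM -innerZl; exact: inner_conj. Qed.

Lemma cauchy_schwarz x y : `|inner x y| <= `|x| * `|y|.
Proof.
have [->|y0] := eqVneq y 0.
  by rewrite inner_conj inner0l conjC0 normr0 mulr_ge0.
have ny : 0 < `|y| by rewrite normr_gt0.
rewrite -(@ler_pXn2r _ 2) ?nnegrE ?mulr_ge0//.
have : 0 <= inner (`|y| ^+ 2 *: x - inner x y *: y)
                  (`|y| ^+ 2 *: x - inner x y *: y).
  by rewrite inner_norm exprn_ge0.
have pc : (`|y| ^+ 2)^* = `|y| ^+ 2 by rewrite conj_Creal// rpredX// normr_real.
rewrite !(innerBl, innerBr, innerZl, innerZr) !inner_norm pc (inner_conj x y).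
rewrite normCK exprMn.
set p := `|y| ^+ 2; set q := `|x| ^+ 2; set u := inner x y; set v := u^*.
have -> : p * (p * q) - v * (p * u) - u * (p * v - v * p) =
          p * (q * p - u * v).
  by rewrite [v * p]mulrC subrr mulr0 subr0 mulrBr [v * _]mulrCA [u * v]mulrC
             [q * p]mulrC.
by rewrite pmulr_rge0 ?subr_ge0// exprn_gt0.
Qed.

Lemma inner_continuousl y : continuous (fun x => inner x y : R[i]^o).
Proof.
move=> x; apply/cvgrPdist_lt => e e0.
have c0 : 0 < `|y| + 1 by rewrite ltr_wpDl.
have ec : 0 < e / (`|y| + 1) by rewrite divr_gt0.
have /cvgrPdist_lt/(_ _ ec) : z @[z --> x] --> x by exact: cvg_id.
apply: filterS => z.
rewrite -innerBl ltr_pdivlMr// => /(le_lt_trans _); apply.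
by rewrite (le_trans (cauchy_schwarz _ _))// ler_wpM2l// lerDl.
Qed.

End HilbertTheory.

Record closedSubspace (R : realType) (H : hilbertType R) := ClosedSubspace {
  subspace_set :> set H;
  subspace0 : subspace_set 0;
  subspaceP : forall (a : R[i]) (x y : H),
    subspace_set x -> subspace_set y -> subspace_set (a *: x + y);
  subspace_closed : closed subspace_set
}.

Definition subspace_pred (R : realType) (H : hilbertType R)
  (E : closedSubspace H) : pred H := fun x => `[< subspace_set E x >].

Definition subspace_type (R : realType) (H : hilbertType R)
  (E : closedSubspace H) : Type := {x : H | subspace_pred E x}.

Section SubspaceHilbert.
Context {R : realType} {H : hilbertType R} (E : closedSubspace H).
Local Notation U := (subspace_type E).

Fact subspace_submod : submod_closed (subspace_pred E).
Proof.
split; first by apply/asboolP; exact: subspace0.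
move=> a x y /asboolP Ex /asboolP Ey; apply/asboolP; exact: subspaceP.
Qed.

HB.instance Definition _ :=
  GRing.isSubmodClosed.Build R[i] H (subspace_pred E) subspace_submod.
HB.instance Definition _ := SubType.copy U {x : H | subspace_pred E x}.
HB.instance Definition _ := [Choice of U by <:].
HB.instance Definition _ := [SubChoice_isSubLmodule of U by <:].

Fact subspace_normD (x y : U) : `|val (x + y)| <= `|val x| + `|val y|.
Proof. by rewrite raddfD ler_normD. Qed.

Fact subspace_normZ (a : R[i]) (x : U) : `|val (a *: x)| = `|a| * `|val x|.
Proof. by rewrite linearZ normrZ. Qed.

Fact subspace_norm0 (x : U) : `|val x| = 0 -> x = 0.
Proof. by move=> /normr0_eq0 x0; apply: val_inj; rewrite raddf0. Qed.

HB.instance Definition _ := Lmodule_isNormed.Build R[i] U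
  subspace_normD subspace_normZ subspace_norm0.

Fact subspace_dist (x y : U) : `|x - y| = `|val x - val y|.
Proof. by rewrite -[LHS]/(`|val (x - y)|) raddfB. Qed.

Fact subspace_complete (F : set_system U) : ProperFilter F -> cauchy F -> cvg F.
Proof.
move=> FF /cauchy_ballP Fc.
have G_proper : ProperFilter (val @ F) by exact: fmap_proper_filter.
have /cauchy_cvg/cvg_ex[l Fl] : cauchy (val @ F : set_system H).
  apply/cauchy_ballP => e e0; have [[P Q] /= [FP FQ] PQ] := Fc e e0.
  exists (val @` P, val @` Q) => /=.
    by split; [apply: filterS FP|apply: filterS FQ] => x ?; exists x.
  move=> [_ _] /= [[x Px <-] [y Qy <-]]; have /= := PQ (x, y) (conj Px Qy).
  by rewrite -!ball_normE /ball_/= subspace_dist.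
have El : subspace_pred E l.
  apply/asboolP; apply: (@subspace_closed _ _ E).
  move=> A /Fl FA; have [x Ax] : exists x : U, A (val x) by exact: (@filter_ex _ F _ _ FA).
  by exists (val x); split => //; apply/asboolP; exact: (valP x).
apply/cvg_ex; exists (Sub l El : U); apply/cvgrPdist_lt => e e0.
by move: Fl => /cvgrPdist_lt/(_ _ e0); apply: filterS => x; rewrite subspace_dist.
Qed.

HB.instance Definition _ := Uniform_isComplete.Build U subspace_complete.

Definition subspace_inner (x y : U) : R[i] := inner (val x) (val y).

Fact subspace_inner_linear (a : R[i]) (x y z : U) :
  subspace_inner (a *: x + y) z = a * subspace_inner x z + subspace_inner y z.
Proof. by rewrite /subspace_inner linearP inner_linear. Qed.

Fact subspace_inner_conj (x y : U) :
  subspace_inner y x = (subspace_inner x y)^*.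
Proof. exact: inner_conj. Qed.

Fact subspace_inner_norm (x : U) : subspace_inner x x = `|x| ^+ 2.
Proof. exact: inner_norm. Qed.

HB.instance Definition _ := NormedModule_isHilbert.Build R U
  subspace_inner_linear subspace_inner_conj subspace_inner_norm.

End SubspaceHilbert.

Section Subspaces.
Context {R : realType} {H : hilbertType R}.

Definition linear_span (A : set H) : set H :=
  [set x | exists (m : nat) (c : 'I_m -> R[i]) (v : 'I_m -> H),
    (forall i, A (v i)) /\ x = \sum_i c i *: v i].

Definition infinite_dimensional : Prop :=
  forall (m : nat) (v : 'I_m -> H), linear_span (range v) != setT.

Definition orthonormal_basis (I : eqType) (e : I -> H) : Prop :=
  (forall a b, inner (e a) (e b) = (a == b)%:R) /\
  closure (linear_span (range e)) = setT.

Definition orthogonal_set (A : set H) : set H :=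
  [set x | forall y, A y -> inner x y = 0].

Fact orthogonal_set0 (A : set H) : orthogonal_set A 0.
Proof. by move=> y _; rewrite inner0l. Qed.

Fact orthogonal_setP (A : set H) (a : R[i]) (x y : H) :
  orthogonal_set A x -> orthogonal_set A y -> orthogonal_set A (a *: x + y).
Proof.
by move=> Ax Ay z Az; rewrite inner_linear Ax// Ay// mulr0 addr0.
Qed.

Fact orthogonal_set_closed (A : set H) : closed (orthogonal_set A).
Proof.
rewrite [X in closed X](_ : _ =
    \bigcap_(y in A) ((fun x => inner x y : R[i]^o) @^-1` [set 0])).
  apply: closed_bigI => y _; apply: preimage_closed => [x _|].
    exact: inner_continuousl.
  by apply: accessible_closed_set1; apply: hausdorff_accessible;
    exact: (@norm_hausdorff _ R[i]^o).
by [].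
Qed.

Definition orthocomplement (A : set H) : closedSubspace H :=
  ClosedSubspace (@orthogonal_set0 A) (@orthogonal_setP A)
    (@orthogonal_set_closed A).

(** In this file [xget] picks an object that is unique, and exists whenever the
    operators in question are bounded. *)
Definition proj (E : closedSubspace H) (x : H) : subspace_type E :=
  xget 0 [set y | forall z : subspace_type E, inner (x - val y) (val z) = 0].

End Subspaces.

Arguments infinite_dimensional {R} H.

Section Operators.
Context {R : realType}.
Implicit Types H K L T : hilbertType R.

Definition hnorm H (x : H) : R := complex.Re `|x|.

Definition bounded_linear H K (A : H -> K) : Prop :=
  (forall (a : R[i]) (x y : H), A (a *: x + y) = a *: A x + A y) /\
  exists M : R[i], forall x, `|A x| <= M * `|x|.

Definition opnorm H K (A : H -> K) : R :=
  sup [set hnorm (A x) | x in [set x | hnorm x <= 1]].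

Definition adjoint H K (A : H -> K) (y : K) : H :=
  xget 0 [set z | forall x, inner (A x) y = inner x z].

Definition compression H (E : closedSubspace H) (A : H -> H)
  (x : subspace_type E) : subspace_type E := proj E (A (val x)).

(** [T], with [t], is the Hilbert space tensor product of [H] and [K]; this
    determines [T] up to a unitary compatible with [t]. *)
Definition hilbert_tensor H K T (t : H -> K -> T) : Prop :=
  [/\ forall (a : R[i]) x y k, t (a *: x + y) k = a *: t x k + t y k,
      forall (a : R[i]) x k l, t x (a *: k + l) = a *: t x k + t x l,
      forall x y k l, inner (t x k) (t y l) = inner x y * inner k l &
      closure (linear_span [set t x k | x in setT & k in setT]) = setT].

(** The operator [A \otimes I_K] on the tensor product given by [t]. *)
Definition ampliation H K T (t : H -> K -> T) (A : H -> H) : T -> T :=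
  xget (fun=> 0)
    [set S | bounded_linear S /\ forall x k, S (t x k) = t (A x) k].

Definition wot_closure H (S : set (H -> H)) : set (H -> H) :=
  [set A | bounded_linear A /\
    forall (m : nat) (x y : 'I_m -> H) (eps : R[i]), 0 < eps ->
      exists2 B, S B & forall i, `|inner (A (x i) - B (x i)) (y i)| < eps].

End Operators.

Section PowerSeries.
Context {R : realType} {n : nat}.

Definition word := seq 'I_n.

(** Formal power series in noncommuting indeterminates, by coefficients. *)
Definition fps := word -> R[i].

Definition fone : fps := fun w => (w == [::])%:R.
Definition fvar (i : 'I_n) : fps := fun w => (w == [:: i])%:R.

Definition fmul (p q : fps) : fps :=
  fun w => \sum_(k < (size w).+1) p (take k w) * q (drop k w).

Definition fword (f : 'I_n -> fps) (w : word) : fps :=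
  foldr (fun i g => fmul (f i) g) fone w.

Definition polynomial (p : fps) : Prop := finite_set [set w | p w != 0].

(** [fsubst c f] is the series of the [c w *: fword f w], taken coefficientwise.
    The sums are finite when [c] is finitely supported, and when every [f i] has
    zero constant term; it is not used in any other situation. *)
Definition fsubst (c : word -> R[i]) (f : 'I_n -> fps) : fps :=
  fun v => \sum_(w \in [set: word]) c w * fword f w v.

(** Cauchy-Hadamard: the radius of convergence of [p] is at least [r]. *)
Definition radius_ge (r : R) (p : fps) : Prop :=
  (limn_esup (fun k => ((\sum_(w : k.-tuple 'I_n)
     complex.Re `|p (tval w)| ^+ 2) `^ (k.*2%:R)^-1)%:E) <= (r^-1)%:E)%E.

Section Evaluation.
Context {H : hilbertType R}.
Implicit Types (Y : 'I_n -> H -> H) (p : fps) (A : H -> H).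

Definition opword Y (w : word) : H -> H := foldr (fun i A => Y i \o A) id w.

Definition poly_eval p Y : H -> H :=
  fun x => \sum_(w \in [set: word]) p w *: opword Y w x.

Definition fps_psum p Y (m : nat) : H -> H :=
  fun x => \sum_(k < m) \sum_(w : k.-tuple 'I_n) p (tval w) *: opword Y w x.

Definition conv_norm p Y : Prop :=
  exists2 A, bounded_linear A &
    opnorm (fun x => fps_psum p Y m x - A x) @[m --> \oo] --> (0 : R).

Definition conv_sot p Y : Prop :=
  exists2 A, bounded_linear A &
    forall x, fps_psum p Y m x @[m --> \oo] --> A x.

(** The value of the series at [Y], both for norm and for SOT convergence. *)
Definition fps_eval p Y : H -> H :=
  fun x => lim (fps_psum p Y m x @[m --> \oo]).

Definition dilate (r : R) Y : 'I_n -> H -> H := fun i x => r%:C%C *: Y i x.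

Definition conv_rad p Y : Prop :=
  (exists delta : R, 0 < delta < 1 /\
    forall r, delta < r < 1 -> conv_norm p (dilate r Y)) /\
  exists2 A, bounded_linear A &
    forall x, fps_eval p (dilate r Y) x @[r --> (1 : R)^'-] --> A x.

Definition fps_eval_rad p Y : H -> H :=
  fun x => lim (fps_eval p (dilate r Y) x @[r --> (1 : R)^'-]).

(** [Y] belongs to [[B(H)^n]_r]. *)
Definition op_ball (r : R) Y : Prop :=
  (forall i, bounded_linear (Y i)) /\
  Num.sqrt (opnorm (fun x => \sum_i Y i (adjoint (Y i) x))) < r.

(** [H^\infty], when [Y] is the universal model of the domain. *)
Definition hardy Y : set (H -> H) :=
  wot_closure [set A | exists2 p, polynomial p & A = poly_eval p Y].

Definition wot_closed_ideal Y (J : set (H -> H)) : Prop :=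
  [/\ J `<=` hardy Y,
      J (fun=> 0),
      forall A B, J A -> J B -> J (fun x => A x + B x),
      forall A B, hardy Y A -> J B -> J (A \o B) /\ J (B \o A) &
      wot_closure J `<=` J].

Definition model_space (J : set (H -> H)) : closedSubspace H :=
  orthocomplement
    (closure (linear_span [set A x | A in J & x in [set: H]])).

End Evaluation.

Section ModelProperty.
Context (f : 'I_n -> fps) {Hf : hilbertType R} (e : word -> Hf).
Implicit Types (x y : Hf) (MZ : 'I_n -> Hf -> Hf).

(** [Hf] with the orthonormal basis [e] is the space of the series
    [\sum_w c w f_w] with square summable [c], where [e w] stands for [f_w]. *)
Definition coef x : word -> R[i] := fun w => inner x (e w).

(** [mulZ i x y] and [mulf j x y] say that [y] is the product of [x] with [Z_i]
    on the left, respectively with [f_j]. *)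
Definition multipliers (mulZ mulf : 'I_n -> Hf -> Hf -> Prop) MZ : Prop :=
  [/\ forall i, bounded_linear (MZ i),
      forall i x, mulZ i x (MZ i x) &
      ((forall j, conv_sot (f j) MZ) /\
       forall j x, mulf j x (fps_eval (f j) MZ x)) \/
      ((forall j, conv_rad (f j) MZ) /\
       forall j x, mulf j x (fps_eval_rad (f j) MZ x))].

(** Here [Hf] is the completion of the space of polynomials, of which the [f_w]
    form a linear basis, and [M_{Z_i}] extends the multiplication of polynomials
    by continuity. As [f_j] may have a constant term, an element of [Hf] need not
    define a formal power series. *)
Definition model_A MZ : Prop :=
  [/\ forall j, polynomial (f j),
      exists q : 'I_n -> fps, [/\ forall j, polynomial (q j),
        forall j, fsubst (f j) q = fvar j &
        forall j, fsubst (q j) f = fvar j],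
      forall i, bounded_linear (MZ i) &
      forall i x, polynomial (coef x) ->
        polynomial (coef (MZ i x)) /\
        fsubst (coef (MZ i x)) f = fmul (fvar i) (fsubst (coef x) f)].

Definition model_S MZ : Prop :=
  [/\ forall j, f j [::] = 0,
      forall j, exists2 r, 0 < r & radius_ge r (f j),
      \det (\matrix_(i, j) f i [:: j]) != 0,
      forall i, exists x, fsubst (coef x) f = fvar i &
      multipliers
        (fun i x y => fsubst (coef y) f = fmul (fvar i) (fsubst (coef x) f))
        (fun j x y => fsubst (coef y) f = fmul (f j) (fsubst (coef x) f)) MZ].

(** [comp_eval p Y] is [(p \circ f)(Y)] for [p] convergent on the unit ball. *)
Definition comp_eval (H : hilbertType R) (p : fps) (Y : 'I_n -> H -> H) : H -> H :=
  fps_eval p (fun j => fps_eval (f j) Y).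

Definition model_F (H : hilbertType R) MZ : Prop :=
  exists2 gamma : R, 0 < gamma &
  [/\ (forall j, radius_ge gamma (f j)) /\
      (forall Y : 'I_n -> H -> H, op_ball gamma Y ->
        op_ball 1 (fun j => fps_eval (f j) Y)),
      forall g : fps, radius_ge 1 g ->
        (forall Y : 'I_n -> H -> H, op_ball gamma Y ->
          comp_eval g Y = (fun=> 0)) ->
        g = (fun=> 0),
      forall i, exists x, forall Y : 'I_n -> H -> H, op_ball gamma Y ->
        comp_eval (coef x) Y = Y i &
      multipliers
        (fun i x y => forall Y : 'I_n -> H -> H, op_ball gamma Y ->
          comp_eval (coef y) Y = Y i \o comp_eval (coef x) Y)
        (fun j x y => forall Y : 'I_n -> H -> H, op_ball gamma Y ->
          comp_eval (coef y) Y = fps_eval (f j) Y \o comp_eval (coef x) Y) MZ].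

(** [f] has the model property and [MZ] is the universal model of its domain;
    [H] is the space on which free holomorphic functions are evaluated. *)
Definition universal_model (H : hilbertType R) MZ : Prop :=
  orthonormal_basis e /\ [\/ model_A MZ, model_S MZ | model_F H MZ].

End ModelProperty.

End PowerSeries.

Arguments word n : clear implicits.
Arguments fps R n : clear implicits.

(* Main.v *)
Require Import Defs.
From HB Require Import structures.
From mathcomp Require Import all_boot all_order all_algebra.
From mathcomp Require Import all_classical all_reals all_analysis.
From mathcomp Require Import complex ring lra.

Set Implicit Arguments.
Unset Strict Implicit.
Unset Printing Implicit Defensive.

Import Order.TTheory GRing.Theory Num.Theory.
Import numFieldNormedType.Exports.

Local Open Scope classical_set_scope.
Local Open Scope ring_scope.

(** In the orthonormal basis [f_w] the operators [M_{f_j} = f_j(M_Z)] are the left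
    creation operators [f_w |-> f_{jw}]. The model property enters only through two
    consequences ([universal_model_analytic]): each left creation operator is
    obtained from the [M_{Z_i}] by linear combinations, products and sequential
    strong limits, and each [M_{Z_i}], being a left multiplication, commutes with
    the right creation operators [f_w |-> f_{wj}].

    By the first consequence, a subspace of [Hf (x) K] that is co-invariant under
    the [M_{Z_i} (x) I] is co-invariant under the left creation operators, and the
    given operator [X] intertwines the compressions of these too. The sequential
    strong limits survive tensoring with [I] because they are bounded
    ([uniform_boundedness], [amp_sot]). Passing to adjoints, [X^*] becomes a
    bounded linear map, defined on a subspace of the square summable families
    indexed by words, that commutes with the backward shifts. Such a map extends to
    all families with the same bound and still commuting with the backward shifts
    ([shift_lifting]): a family [u] is the pair of its coefficient at the empty word
    and its backward shifts, so an extension to the vectors whose backward shifts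
    lie in the domain has prescribed backward shifts and only its coefficient at the
    empty word is to be chosen. That choice is Parrott's lemma, an instance of
    the extension of linear maps dominated by a nonnegative quadratic form
    ([dominated_extension]). Iterating, by Zorn's lemma, one reaches all finitely
    supported families, which are dense.

    The adjoint of the extension commutes with the left creation operators
    tensored with [I]. It then commutes with [A (x) I] for every [A] that commutes
    with the right creation operators: its matrix entries commute with the left
    creation operators, and the two commutants commute, by associativity of the
    product of formal power series ([commutants_commute], [slice_commutant]). This
    covers the [M_{Z_i}] and the whole Hardy algebra, in particular [J]; so the
    lifting maps [J Hf (x) K1] into [J Hf (x) K2], and its compression to the
    complements [N (x) K1] and [N (x) K2] is the required [G]. *)

Local Notation proj := Defs.proj.
Local Notation polynomial := Defs.polynomial.

(** * Norms, inner products and bounded operators *)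

Section RealNorm.
Context {R : realType}.
Implicit Types (H K : hilbertType R) (a : R[i]).

Definition modulus a : R := complex.Re `|a|.

Lemma modulusE a : `|a| = (modulus a)%:C%C.
Proof. by rewrite /modulus RRe_real// normr_real. Qed.

Lemma modulus_ge0 a : 0 <= modulus a.
Proof. by rewrite -ler0c -modulusE. Qed.

Lemma modulusD a b : modulus (a + b) <= modulus a + modulus b.
Proof. by rewrite -lecR rmorphD/= -!modulusE ler_normD. Qed.

Lemma modulus_real (r : R) : 0 <= r -> modulus r%:C%C = r.
Proof. by move=> r0; apply: complexI; rewrite -modulusE ger0_norm// ler0c. Qed.

Lemma modulus_eq0 a : (modulus a == 0) = (a == 0).
Proof. by rewrite -(inj_eq (@complexI R)) -modulusE normr_eq0. Qed.

Lemma hnormE H (x : H) : `|x| = (hnorm x)%:C%C.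
Proof. by rewrite /hnorm RRe_real// normr_real. Qed.

Lemma hnorm_ge0 H (x : H) : 0 <= hnorm x.
Proof. by rewrite -ler0c -hnormE. Qed.

Lemma hnorm0 H : hnorm (0 : H) = 0.
Proof. by apply: complexI; rewrite -hnormE normr0. Qed.

Lemma hnorm_eq0 H (x : H) : (hnorm x == 0) = (x == 0).
Proof. by rewrite -(inj_eq (@complexI R)) -hnormE normr_eq0. Qed.

Lemma hnormD H (x y : H) : hnorm (x + y) <= hnorm x + hnorm y.
Proof. by rewrite -lecR rmorphD/= -!hnormE ler_normD. Qed.

Lemma hnormN H (x : H) : hnorm (- x) = hnorm x.
Proof. by rewrite /hnorm normrN. Qed.

Lemma hdistC H (x y : H) : hnorm (x - y) = hnorm (y - x).
Proof. by rewrite -hnormN opprB. Qed.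

Lemma hnormB H (x y : H) : hnorm (x - y) <= hnorm x + hnorm y.
Proof. by rewrite -(hnormN y) hnormD. Qed.

Lemma hnormZ H a (x : H) : hnorm (a *: x) = modulus a * hnorm x.
Proof. by apply: complexI; rewrite rmorphM/= -!hnormE normrZ modulusE. Qed.

Lemma inner0r H (x : H) : inner x 0 = 0.
Proof. by rewrite inner_conj inner0l conjC0. Qed.

Lemma innerDr H (x y z : H) : inner z (x + y) = inner z x + inner z y.
Proof.
by rewrite (inner_conj x z) (inner_conj y z) -rmorphD -innerDl; exact: inner_conj.
Qed.

Lemma inner_suml H (I : Type) (s : seq I) (F : I -> H) z :
  inner (\sum_(i <- s) F i) z = \sum_(i <- s) inner (F i) z.
Proof.
elim: s => [|i s IH]; first by rewrite !big_nil inner0l.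
by rewrite !big_cons innerDl IH.
Qed.

Lemma inner_sumr H (I : Type) (s : seq I) (F : I -> H) z :
  inner z (\sum_(i <- s) F i) = \sum_(i <- s) inner z (F i).
Proof.
elim: s => [|i s IH]; first by rewrite !big_nil inner0r.
by rewrite !big_cons innerDr IH.
Qed.

(** The underlying real inner product, to which real arithmetic applies. *)
Definition rinner H (x y : H) : R := complex.Re (inner x y).

Lemma cReC (z : R[i]) : complex.Re (z^*)%R = complex.Re z.
Proof.
by apply: complexI; rewrite !complexRe Re_conj.
Qed.

Lemma cReD (z t : R[i]) : complex.Re (z + t) = complex.Re z + complex.Re t.
Proof. by case: z => ? ?; case: t. Qed.

Lemma cReN (z : R[i]) : complex.Re (- z) = - complex.Re z.
Proof. by case: z. Qed.

Lemma cReM (r : R) (z : R[i]) : complex.Re (r%:C%C * z) = r * complex.Re z.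
Proof. by case: z => a b /=; rewrite mul0r subr0. Qed.

Lemma Re_le_modulus a : complex.Re a <= modulus a.
Proof.
by rewrite -lecR -modulusE (le_trans _ (normc_ge_Re _))// lecR ler_norm.
Qed.

Lemma rinnerC H (x y : H) : rinner x y = rinner y x.
Proof. by rewrite /rinner inner_conj cReC. Qed.

Lemma rinnerDl H (x y z : H) : rinner (x + y) z = rinner x z + rinner y z.
Proof. by rewrite /rinner innerDl cReD. Qed.

Lemma rinnerDr H (x y z : H) : rinner z (x + y) = rinner z x + rinner z y.
Proof. by rewrite rinnerC rinnerDl !(rinnerC z). Qed.

Lemma rinnerNl H (x z : H) : rinner (- x) z = - rinner x z.
Proof. by rewrite /rinner innerNl cReN. Qed.

Lemma rinnerNr H (x z : H) : rinner z (- x) = - rinner z x.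
Proof. by rewrite rinnerC rinnerNl rinnerC. Qed.

Lemma rinnerZl H (r : R) (x z : H) : rinner (r%:C%C *: x) z = r * rinner x z.
Proof. by rewrite /rinner innerZl cReM. Qed.

Lemma rinnerZr H (r : R) (x z : H) : rinner z (r%:C%C *: x) = r * rinner z x.
Proof. by rewrite rinnerC rinnerZl rinnerC. Qed.

Lemma inner_hnorm H (x : H) : inner x x = (hnorm x ^+ 2)%:C%C.
Proof. by rewrite inner_norm hnormE -rmorphXn. Qed.

Lemma hnorm2 H (x : H) : hnorm x ^+ 2 = rinner x x.
Proof. by rewrite /rinner inner_hnorm. Qed.

Lemma modulus_inner_le H (x y : H) : modulus (inner x y) <= hnorm x * hnorm y.
Proof. by rewrite -lecR -modulusE rmorphM/= -!hnormE cauchy_schwarz. Qed.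

Lemma rinner_le H (x y : H) : rinner x y <= hnorm x * hnorm y.
Proof. exact: le_trans (Re_le_modulus _) (modulus_inner_le _ _). Qed.

Lemma hnorm2D H (x y : H) :
  hnorm (x + y) ^+ 2 = hnorm x ^+ 2 + 2 * rinner x y + hnorm y ^+ 2.
Proof.
by rewrite !hnorm2 !(rinnerDl, rinnerDr) (rinnerC y x); ring.
Qed.

Lemma rinner_inner_eq0 H (x y : H) :
  (forall a : R[i], rinner (a *: x) y = 0) -> inner x y = 0.
Proof.
move=> h; have := h (inner x y)^*%R.
rewrite /rinner innerZl mulrC -normCK modulusE -rmorphXn/=.
by move=> /eqP; rewrite sqrf_eq0 modulus_eq0 => /eqP.
Qed.

Lemma inner_ext H (x y : H) : (forall z, inner z x = inner z y) -> x = y.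
Proof.
move=> h; apply/eqP; rewrite -subr_eq0 -hnorm_eq0 -sqrf_eq0 hnorm2 /rinner.
by rewrite innerBr h subrr.
Qed.

Lemma inner_extl H (x y : H) : (forall z, inner x z = inner y z) -> x = y.
Proof. by move=> h; apply: inner_ext => z; rewrite inner_conj h -inner_conj. Qed.

Lemma hcvgP H (T : Type) (F : set_system T) {FF : Filter F} (u : T -> H) (l : H) :
  (u x @[x --> F] --> l) <->
  (forall eps : R, 0 < eps -> \forall x \near F, hnorm (u x - l) < eps).
Proof.
split.
  move=> /cvgrPdist_lt h eps e0.
  have := h eps%:C%C; rewrite ltcR => /(_ e0).
  by apply: filterS => x; rewrite hnormE ltcR hdistC.
move=> h; apply/cvgrPdist_lt => e e0.
have er : e = (complex.Re e)%:C%C by rewrite RRe_real// gtr0_real.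
rewrite er; apply: filterS (h (complex.Re e) _).
  by move=> x; rewrite hnormE ltcR hdistC.
by rewrite -ltcR -er.
Qed.

Lemma hcvg_hnorm H (T : Type) (F : set_system T) {FF : Filter F} (u : T -> H) (l : H) :
  (u x @[x --> F] --> l) <-> (hnorm (u x - l) @[x --> F] --> (0 : R)).
Proof.
rewrite hcvgP; split.
  move=> h; apply/cvgrPdist_lt => e e0; apply: filterS (h _ e0) => x.
  by rewrite sub0r normrN ger0_norm// hnorm_ge0.
move=> /cvgrPdist_lt h e e0; apply: filterS (h _ e0) => x.
by rewrite sub0r normrN ger0_norm// hnorm_ge0.
Qed.

Lemma ler_dist_hnorm H (x y : H) : `|hnorm x - hnorm y| <= hnorm (x - y).
Proof.
rewrite ler_norml; apply/andP; split.
  rewrite lerNl opprB lerBlDr.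
  by rewrite -{1}(subrK x y) (le_trans (hnormD _ _))// hdistC.
by rewrite lerBlDr -{1}(subrK y x) hnormD.
Qed.

Lemma hnorm_cvg H (T : Type) (F : set_system T) {FF : Filter F} (u : T -> H) (l : H) :
  (u x @[x --> F] --> l) -> hnorm (u x) @[x --> F] --> hnorm l.
Proof.
move=> /hcvgP ul; apply/cvgrPdist_lt => e e0; apply: filterS (ul _ e0) => x.
by apply: le_lt_trans; rewrite distrC ler_dist_hnorm.
Qed.

Lemma cvg_sumR (T I : Type) (F : set_system T) {FF : Filter F} (s : seq I)
  (f : I -> T -> R) (l : I -> R) : (forall i, f i x @[x --> F] --> l i) ->
  \sum_(i <- s) f i x @[x --> F] --> \sum_(i <- s) l i.
Proof.
move=> fl; elim: s => [|i s IH].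
  by under eq_fun do rewrite big_nil; rewrite big_nil; exact: cvg_cst.
by under eq_fun do rewrite big_cons; rewrite big_cons; exact: cvgD.
Qed.

Lemma hcvg_unique H (T : Type) (F : set_system T) {FF : ProperFilter F}
  (u : T -> H) (l l' : H) :
  (u x @[x --> F] --> l) -> (u x @[x --> F] --> l') -> l = l'.
Proof. by move=> h h'; exact: (@cvg_unique _ (@norm_hausdorff _ H) _ _ _ _ h h'). Qed.

Lemma hcvg_lim H (T : Type) (F : set_system T) {FF : ProperFilter F}
  (u : T -> H) (l : H) :
  (u x @[x --> F] --> l) -> lim (u x @[x --> F]) = l.
Proof. by move=> h; apply: cvg_lim => //; exact: norm_hausdorff. Qed.

Lemma hcauchy_cvg H (u : nat -> H) :
  (forall eps : R, 0 < eps -> exists N, forall m n, (N <= m)%N -> (N <= n)%N ->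
     hnorm (u m - u n) < eps) ->
  exists l : H, u m @[m --> \oo] --> l.
Proof.
move=> h; suff /cauchy_cvg/cvg_ex : cauchy (u m @[m --> \oo]) by [].
apply/cauchy_ballP => e e0.
have er : e = (complex.Re e)%:C%C by rewrite RRe_real// gtr0_real.
have [|N hN] := h (complex.Re e); first by rewrite -ltcR -er.
exists ([set u m | m in [set m | (N <= m)%N]], [set u m | m in [set m | (N <= m)%N]]).
  by split; (exists N => //= m /= Nm; exists m).
move=> [_ _] /= [[m Nm <-] [k Nk <-]].
by rewrite -ball_normE /ball_ /= hnormE er ltcR hN.
Qed.

(** Linearity is kept as a property of bare functions, as in [bounded_linear]. *)
Definition is_lin (U V : lmodType R[i]) (A : U -> V) : Prop :=
  forall a x y, A (a *: x + y) = a *: A x + A y.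

Section IsLin.
Context (U V : lmodType R[i]) (A : U -> V) (linA : is_lin A).

Lemma lin0 : A 0 = 0.
Proof.
have := linA 1 0 0; rewrite !scale1r addr0 => /eqP.
by rewrite -subr_eq subrr eq_sym => /eqP.
Qed.

Lemma linD x y : A (x + y) = A x + A y.
Proof. by have := linA 1 x y; rewrite !scale1r. Qed.

Lemma linZ a x : A (a *: x) = a *: A x.
Proof. by have := linA a x 0; rewrite lin0 !addr0. Qed.

Lemma linN x : A (- x) = - A x.
Proof. by rewrite -scaleN1r linZ scaleN1r. Qed.

Lemma linB x y : A (x - y) = A x - A y.
Proof. by rewrite linD linN. Qed.

Lemma lin_sum (I : Type) (s : seq I) (P : pred I) (F : I -> U) :
  A (\sum_(i <- s | P i) F i) = \sum_(i <- s | P i) A (F i).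
Proof. by apply: (big_morph A) => [x y|]; [exact: linD|exact: lin0]. Qed.

End IsLin.

Lemma lin_comp (U V W : lmodType R[i]) (A : V -> W) (B : U -> V) :
  is_lin A -> is_lin B -> is_lin (A \o B).
Proof. by move=> hA hB a x y /=; rewrite hB hA. Qed.

Definition hbound H K (M : R) (A : H -> K) : Prop :=
  is_lin A /\ forall x, hnorm (A x) <= M * hnorm x.

Lemma bounded_linearP H K (A : H -> K) :
  bounded_linear A <-> exists2 M, 0 <= M & hbound M A.
Proof.
split.
  move=> [linA [M hM]]; exists (modulus M); first exact: modulus_ge0.
  split=> // x; rewrite -lecR -hnormE rmorphM/= -hnormE -modulusE.
  have M0 : M * `|x| \is Num.real by rewrite ger0_real// (le_trans _ (hM x)).
  apply: le_trans (hM x) _; rewrite (le_trans (real_ler_norm M0))//.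
  by rewrite normrM normr_id.
move=> [M M0 [linA hM]]; split => //; exists M%:C%C => x.
by rewrite !hnormE -rmorphM/= lecR.
Qed.

Lemma hbound_bounded H K M (A : H -> K) : hbound M A -> bounded_linear A.
Proof.
move=> [linA hA]; apply/bounded_linearP; exists `|M| => //.
split => // x; rewrite (le_trans (hA x))// ler_wpM2r ?hnorm_ge0//.
exact: ler_norm.
Qed.

Lemma bounded_lin H K (A : H -> K) : bounded_linear A -> is_lin A.
Proof. by case. Qed.

Lemma hbound_comp H K (L : hilbertType R) (M N : R) (A : K -> L) (B : H -> K) :
  0 <= M -> hbound M A -> hbound N B -> hbound (M * N) (A \o B).
Proof.
move=> M0 [lA hA] [lB hB]; split; first exact: lin_comp.
by move=> x /=; rewrite (le_trans (hA _))// -mulrA ler_wpM2l.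
Qed.

Lemma bounded_comp H K (L : hilbertType R) (A : K -> L) (B : H -> K) :
  bounded_linear A -> bounded_linear B -> bounded_linear (A \o B).
Proof.
move=> /bounded_linearP[M M0 hA] /bounded_linearP[N N0 hB].
exact: hbound_bounded (hbound_comp M0 hA hB).
Qed.

Lemma bounded_id H : bounded_linear (@id H).
Proof. by apply: (@hbound_bounded _ _ 1); split => // x; rewrite mul1r. Qed.

Lemma bounded0 H K : bounded_linear (fun _ : H => 0 : K).
Proof.
apply: (@hbound_bounded _ _ 0); split => [a x y|x].
  by rewrite scaler0 addr0.
by rewrite hnorm0 mul0r.
Qed.

Lemma bounded_axpy H K a (A B : H -> K) :
  bounded_linear A -> bounded_linear B ->
  bounded_linear (fun x => a *: A x + B x).
Proof.
move=> /bounded_linearP[M M0 [lA hA]] /bounded_linearP[N N0 [lB hB]].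
apply: (@hbound_bounded _ _ (modulus a * M + N)); split => [b x y|x].
  by rewrite lA lB !scalerDr !scalerA addrACA [a * b]mulrC.
rewrite (le_trans (hnormD _ _))// mulrDl lerD// hnormZ -mulrA.
by rewrite ler_wpM2l ?modulus_ge0.
Qed.

Lemma bounded_sum H K (I : Type) (s : seq I) (c : I -> R[i]) (A : I -> H -> K) :
  (forall i, bounded_linear (A i)) ->
  bounded_linear (fun x => \sum_(i <- s) c i *: A i x).
Proof.
move=> hA; elim: s => [|i s IH].
  rewrite (_ : (fun _ => _) = fun=> 0); first exact: bounded0.
  by apply/funext => x; rewrite big_nil.
rewrite (_ : (fun _ => _) = fun x => c i *: A i x + \sum_(j <- s) c j *: A j x).
  exact: bounded_axpy.
by apply/funext => x; rewrite big_cons.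
Qed.

Lemma bounded_cvg H K (A : H -> K) (T : Type) (F : set_system T) {FF : Filter F}
  (u : T -> H) (l : H) : bounded_linear A ->
  (u x @[x --> F] --> l) -> A (u x) @[x --> F] --> A l.
Proof.
move=> /bounded_linearP[M M0 [lA hA]] /hcvgP ul; apply/hcvgP => e e0.
have M1 : 0 < M + 1 by rewrite ltr_wpDl.
apply: filterS (ul (e / (M + 1)) (divr_gt0 e0 M1)) => x.
rewrite ltr_pdivlMr// mulrC -linB//; apply: le_lt_trans.
by rewrite (le_trans (hA _))// ler_wpM2r ?hnorm_ge0// lerDl.
Qed.

Lemma hbound_opnorm H K (A : H -> K) : bounded_linear A -> hbound (opnorm A) A.
Proof.
move=> bA; split; first exact: bounded_lin.
move/bounded_linearP: bA => [M M0 [lA hA]] x.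
have ub : has_ubound [set hnorm (A x) | x in [set x | hnorm x <= 1]].
  exists M => _ [y /= y1 <-]; rewrite (le_trans (hA y))//.
  by rewrite -[leRHS]mulr1 ler_wpM2l.
have [->|x0] := eqVneq x 0; first by rewrite lin0// !hnorm0 mulr0.
have n0 : 0 < hnorm x by rewrite lt_def hnorm_eq0 x0 hnorm_ge0.
pose y := (hnorm x)^-1%:C%C *: x.
have xy : x = (hnorm x)%:C%C *: y.
  by rewrite scalerA -rmorphM/= mulfV ?scale1r// gt_eqF.
have y1 : hnorm y <= 1.
  by rewrite hnormZ modulus_real ?invr_ge0 ?hnorm_ge0// mulVf// gt_eqF.
rewrite {1}xy linZ// hnormZ modulus_real ?hnorm_ge0// mulrC ler_pM2r//.
by apply: ub_le_sup => //; exists y.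
Qed.

Lemma opnorm_le H K (A : H -> K) M :
  0 <= M -> (forall x, hnorm (A x) <= M * hnorm x) -> opnorm A <= M.
Proof.
move=> M0 hA; apply: ge_sup.
  by exists (hnorm (A 0)), 0 => //=; rewrite hnorm0.
move=> _ [x /= x1 <-]; rewrite (le_trans (hA x))//.
by rewrite -[leRHS]mulr1 ler_wpM2l.
Qed.

Lemma opnorm_ge0 H K (A : H -> K) : 0 <= opnorm A.
Proof.
have [ub|nub] := pselect (has_sup [set hnorm (A x) | x in [set x | hnorm x <= 1]]).
  apply: le_trans (hnorm_ge0 (A 0)) _; apply: ub_le_sup; first by case: ub.
  by exists 0 => //=; rewrite hnorm0.
by rewrite /opnorm sup_out.
Qed.

End RealNorm.

(** * Dominated extension of linear relations *)

Lemma zorn_above (T : Type) (P : set (set T)) (A0 : set T) :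
  P A0 ->
  (forall F : set (set T), F `<=` P -> F !=set0 -> total_on F subset ->
    P (\bigcup_(A in F) A)) ->
  exists A, [/\ A0 `<=` A, P A & forall B, A `<=` B -> P B -> B `<=` A].
Proof.
move=> PA0 Pchain.
have [F FP Ftot|A [PA maxA]] := @Zorn_bigcup T [set B | P (A0 `|` B)].
  have [->|/set0P[B0 FB0]] := eqVneq F set0; first by rewrite /= bigcup_set0 setU0.
  rewrite /= (_ : _ `|` _ = \bigcup_(A in [set A0 `|` B | B in F]) A).
    apply: Pchain.
    - by move=> _ [B FB <-]; exact: FP.
    - by exists (A0 `|` B0), B0.
    - move=> _ _ [B FB <-] [C FC <-].
      by have [BC|CB] := Ftot _ _ FB FC; [left|right]; exact: setUS.
  apply/seteqP; split=> x.
    move=> [A0x|[B FB Bx]]; first by exists (A0 `|` B0); [exists B0|left].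
    by exists (A0 `|` B); [exists B|right].
  by move=> [_ [B FB <-]] [A0x|Bx]; [left|right; exists B].
exists (A0 `|` A); split => // .
move=> B AB PB x Bx; have [AeB|nAB] := pselect (A = B); first by right; rewrite AeB.
exfalso; apply: (maxA B).
  split=> [y Ay|BA]; first by apply: AB; right.
  by apply: nAB; apply/seteqP; split => // y Ay; apply: AB; right.
by rewrite /= (setUidr (fun y A0y => AB y (or_introl A0y))).
Qed.

Section Extension.
Context {R : realType}.
Implicit Types (V W : lmodType R[i]) (H K : hilbertType R).

(** The first clause says that [q (u + t v)] is a polynomial of degree at most 2 in
    the real number [t], with the coefficients that [t = 1] forces. Positivity is
    not included, so that differences of squared seminorms are covered. *)
Definition quadratic_form V (q : V -> R) : Prop :=
  (forall u v (t : R), q (u + t%:C%C *: v) =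
     q u + t * (q (u + v) - q u - q v) + t ^+ 2 * q v) /\
  (forall (a : R[i]) v, q (a *: v) = modulus a ^+ 2 * q v).

Lemma quadratic_hnorm V K (A : V -> K) :
  is_lin A -> quadratic_form (fun v => hnorm (A v) ^+ 2).
Proof.
move=> lA; split => [u v t|a v]; last by rewrite linZ// hnormZ exprMn.
rewrite !linD// linZ// !hnorm2D rinnerZr hnormZ exprMn.
have -> : modulus t%:C%C ^+ 2 = t ^+ 2.
  by rewrite /modulus normc_def /= expr0n addr0 sqr_sqrtr ?sqr_ge0.
by ring.
Qed.

Lemma quadraticB V (q p : V -> R) :
  quadratic_form q -> quadratic_form p -> quadratic_form (fun v => q v - p v).
Proof.
move=> [q1 q2] [p1 p2]; split => [u v t|a v]; first by rewrite q1 p1; ring.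
by rewrite q2 p2; ring.
Qed.

Lemma quadraticZ V (q : V -> R) (c : R) :
  quadratic_form q -> quadratic_form (fun v => c * q v).
Proof.
by move=> [q1 q2]; split => [u v t|a v]; rewrite ?q1 ?q2; ring.
Qed.

Lemma quadratic_sum V (I : finType) (q : I -> V -> R) :
  (forall i, quadratic_form (q i)) -> quadratic_form (fun v => \sum_i q i v).
Proof.
move=> hq; split => [u v t|a v].
  rewrite -!sumrB !mulr_sumr -!big_split/=.
  by apply: eq_bigr => i _; rewrite (hq i).1.
by rewrite mulr_sumr; apply: eq_bigr => i _; rewrite (hq i).2.
Qed.

(** Partially defined linear maps are handled through their graphs. *)
Definition linrel V W (G : set (V * W)) : Prop :=
  G (0, 0) /\ forall (a : R[i]) x w y v, G (x, w) -> G (y, v) ->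
    G (a *: x + y, a *: w + v).

Lemma linrelB V W (G : set (V * W)) x w y v :
  linrel G -> G (x, w) -> G (y, v) -> G (x - y, w - v).
Proof.
move=> [_ lG] Gx Gy; rewrite -(scaleN1r y) -(scaleN1r v) addrC (addrC w).
exact: lG.
Qed.

(** If [m] is a lower bound of the parabola [t |-> q (u + t d)] and [q u < m + h],
    then its slope at [t = 0] is at least [- h / t - t q d]. With
    [qs = q (u + d)] this bounds [q d] by [q (u + d)] up to a small error. *)
Lemma near_minimum_bound (m qu qd qs h t Q : R) :
  0 < t -> 0 <= qu -> qu < m + h -> qd <= Q ->
  m <= qu + t * (qs - qu - qd) + t ^+ 2 * qd -> qd <= qs + h / t + t * Q.
Proof.
move=> t0 qu0 qum qdQ min_line.
rewrite -(ler_pM2l t0) !mulrDr [t * (h / t)]mulrCA mulfV ?gt_eqF// mulr1.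
have h2 : 0 <= t * qu by rewrite mulr_ge0// ltW.
have h3 : 0 <= t ^+ 2 * (Q - qd) by rewrite mulr_ge0 ?sqr_ge0// subr_ge0.
by lra.
Qed.

Section OneVector.
Context V K (q : V -> R) (G : set (V * K)).
Hypotheses (qq : quadratic_form q) (q0 : forall v, 0 <= q v).
Hypotheses (lG : linrel G) (Gq : forall p, G p -> hnorm p.2 ^+ 2 <= q p.1).

Lemma quadratic_parallelogram u v : q (u - v) = 2 * q u + 2 * q v - q (u + v).
Proof.
have := qq.1 u v (-1); rewrite rmorphN1 scaleN1r => ->; ring.
Qed.

(** Let [(p k).1] run through the domain of [G] so that [q ((p k).1 + x)] tends to
    its infimum. By the parallelogram law the [p k] form a Cauchy sequence for [q],
    so their images converge, to [l] say, and [z = - l] works: for [y] in the domain,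
    [q] of [y + x] is nearly at least [q] of [y - (p k).1], because [(p k).1 + x] is
    nearly minimal. *)
Lemma one_vector_extension (x : V) :
  exists z : K, forall y v, G (y, v) -> hnorm (v + z) ^+ 2 <= q (y + x).
Proof.
pose S := [set q (p.1 + x) | p in G].
have infS : has_inf S.
  split; first by exists (q (0 + x)), (0, 0) => //; exact: lG.1.
  by exists 0 => _ [p _ <-].
pose m := inf S.
have mS y v : G (y, v) -> m <= q (y + x).
  by move=> Gy; apply: ge_inf; [exact: infS.2|exists (y, v)].
have /choice[p hp] : forall k : nat, exists p : V * K,
    G p /\ q (p.1 + x) < m + harmonic k.
  move=> k; have [_ [p Gp <-] ?] := inf_adherent (harmonic_gt0 k : 0 < (harmonic k : R)) infS.
  by exists p.
have mid y v y' v' : G (y, v) -> G (y', v') -> 4 * m <= q (y + x + (y' + x)).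
  move=> Gy Gy'.
  have -> : y + x + (y' + x) = 2%:C%C *: ((2^-1)%:C%C *: (y + y') + x).
    rewrite scalerDr scalerA -rmorphM/= mulfV// scale1r addrACA.
    by rewrite rmorphD/= scalerDl scale1r.
  rewrite qq.2 modulus_real// (_ : 2 ^+ 2 = 4 :> R); last by ring.
  rewrite ler_pM2l//; apply: (mS _ ((2^-1)%:C%C *: (v + v'))).
  have := lG.2 (2^-1)%:C%C y v 0 0 Gy lG.1.
  have := lG.2 (2^-1)%:C%C y' v' 0 0 Gy' lG.1; rewrite !addr0 => h1 h2.
  by have := lG.2 1 _ _ _ _ h2 h1; rewrite !scale1r -!scalerDr.
have dist y v k : G (y, v) ->
    q (y - (p k).1) <= 2 * q (y + x) + 2 * (m + harmonic k) - 4 * m.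
  move=> Gy; have [] := hp k; case: (p k) => yk vk Gk /= qk.
  have -> : y - yk = (y + x) - (yk + x) by rewrite opprD addrACA subrr addr0.
  rewrite quadratic_parallelogram.
  by have := mid _ _ _ _ Gy Gk; move: qk; rewrite -[_.+1%:R^-1]/(harmonic k); set h := harmonic k; lra.
have [l pl] : exists l : K, (p k).2 @[k --> \oo] --> l.
  apply: hcauchy_cvg => e e0.
  have e4 : 0 < e ^+ 2 / 4 by rewrite divr_gt0// exprn_gt0.
  have /cvgrPdist_lt/(_ _ e4)[N _ hN] := @cvg_harmonic R.
  exists N => a b Na Nb; have [Ga qa] := hp a; have [Gb qb] := hp b.
  rewrite -(@ltr_pXn2r _ 2) ?nnegrE ?hnorm_ge0 ?(ltW e0)//.
  have Gab : G ((p a).1 - (p b).1, (p a).2 - (p b).2).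
    by apply: linrelB; rewrite -?surjective_pairing.
  apply: le_lt_trans (Gq Gab) _ => /=.
  have := dist (p a).1 (p a).2 b; rewrite -surjective_pairing => /(_ Ga) /le_lt_trans; apply.
  have := hN _ Na; have := hN _ Nb; rewrite !sub0r !normrN.
  rewrite !ger0_norm ?ltW ?harmonic_gt0//.
  by move: (harmonic a) (harmonic b) qa qb => ha hb; lra.
exists (- l) => y v Gy; pose Q := 2 * q (y + x) + 2 * (m + 1).
have m0 : 0 <= m by apply: lb_le_inf; [exact: infS.1|move=> _ [? _ <-]].
have Q0 : 0 <= Q by rewrite /Q; have := q0 (y + x); lra.
have step (k : nat) (t : R) : 0 < t ->
    hnorm (v - (p k).2) ^+ 2 <= q (y + x) + harmonic k / t + t * Q.
  move=> t0; have [Gk qk] := hp k; have h1 : harmonic k <= 1 :> R.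
    by rewrite /harmonic invf_le1// ler1n.
  have Gd : G (y - (p k).1, v - (p k).2).
    by apply: linrelB; rewrite -?surjective_pairing.
  have := Gq Gd => /= /le_trans; apply.
  have dQ : q (y - (p k).1) <= Q.
    by rewrite (le_trans (dist _ _ _ Gy))// /Q; lra.
  pose d := y - (p k).1; pose u := (p k).1 + x.
  have udE : u + d = y + x by rewrite /u /d addrC addrA subrK.
  (* minimality of [q u], up to [harmonic k], along the line through [y + x] *)
  have min_line : m <= q (u + t%:C%C *: d).
    have -> : u + t%:C%C *: d = ((t%:C%C *: d) + (p k).1) + x.
      by rewrite /u addrC addrA.
    have Gk' : G ((p k).1, (p k).2) by rewrite -surjective_pairing.
    exact: mS (lG.2 t%:C%C _ _ _ _ Gd Gk').
  move: min_line; rewrite (qq.1 u d t) udE => min_line.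
  exact: near_minimum_bound t0 (q0 u) qk dQ min_line.
have lim_le t : 0 < t -> hnorm (v - l) ^+ 2 <= q (y + x) + t * Q.
  move=> t0.
  have cl : hnorm (v - (p k).2) ^+ 2 @[k --> \oo] --> hnorm (v - l) ^+ 2.
    rewrite expr2; under eq_fun do rewrite expr2.
    have c1 : hnorm (v - (p k).2) @[k --> \oo] --> hnorm (v - l).
      by apply: hnorm_cvg; apply: cvgB pl; exact: cvg_cst.
    exact: cvgM.
  have cr : q (y + x) + harmonic k / t + t * Q @[k --> \oo] --> q (y + x) + 0 / t + t * Q.
    apply: cvgD; last exact: cvg_cst.
    apply: cvgD; first exact: cvg_cst.
    exact: cvgMr_tmp cvg_harmonic.
  rewrite mul0r addr0 in cr.
  by apply: (ler_cvg_to cl cr); apply: nearW => k; exact: step.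
apply/ler_addgt0Pr => e e0.
have Q1 : 0 < Q + 1 by lra.
have := lim_le (e / (Q + 1)) (divr_gt0 e0 Q1).
move=> /le_trans; apply; rewrite lerD2l mulrAC ler_pdivrMr// ler_pM2l//; lra.
Qed.

End OneVector.

Lemma linrel_fun V K (q : V -> R) (G : set (V * K)) :
  quadratic_form q -> linrel G ->
  (forall p, G p -> hnorm p.2 ^+ 2 <= q p.1) ->
  forall x v w, G (x, v) -> G (x, w) -> v = w.
Proof.
move=> qq lG Gq x v w Gv Gw; apply/eqP.
have := Gq _ (linrelB lG Gv Gw); rewrite /= subrr -(scale0r x) qq.2.
rewrite (_ : modulus 0 = 0) ?expr0n ?mul0r; last by apply/eqP; rewrite modulus_eq0.
by move=> h; rewrite -subr_eq0 -hnorm_eq0 -sqrf_eq0 eq_le h sqr_ge0.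
Qed.

(** A maximal dominated linear relation is everywhere defined, since
    [one_vector_extension] would enlarge it by a vector outside its domain. The
    projection theorem, the extension of bounded operators with the same bound and
    Parrott's lemma are special cases. *)
Lemma dominated_extension V K (q : V -> R) (G : set (V * K)) :
  quadratic_form q -> (forall v, 0 <= q v) -> linrel G ->
  (forall p, G p -> hnorm p.2 ^+ 2 <= q p.1) ->
  exists D : V -> K, [/\ is_lin D, forall x, hnorm (D x) ^+ 2 <= q x &
    forall x w, G (x, w) -> D x = w].
Proof.
move=> qq q0 lG Gq.
pose P (A : set (V * K)) := linrel A /\ forall p, A p -> hnorm p.2 ^+ 2 <= q p.1.
have [||M [GM [lM Mq] Mmax]] := @zorn_above _ P G; first by split.
  move=> F FP [A0 FA0] Ftot; split; last by move=> p [A /FP[_ Aq] /Aq].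
  split; first by exists A0 => //; have [[]] := FP _ FA0.
  move=> a x w y v [A FA Ax] [B FB By].
  have [AB|BA] := Ftot _ _ FA FB.
    by exists B => //; have [[_ lB] _] := FP _ FB; apply: lB => //; exact: AB.
  by exists A => //; have [[_ lA] _] := FP _ FA; apply: lA => //; exact: BA.
have total x : exists w, M (x, w).
  have [z hz] := one_vector_extension qq q0 lM Mq x.
  pose N := [set p | exists (a : R[i]) y v, [/\ M (y, v), p.1 = a *: x + y & p.2 = a *: z + v]].
  exists z; apply: (Mmax N).
  - by move=> [y v] My; exists 0, y, v; rewrite !scale0r !add0r.
  - split.
      split; first by exists 0, 0, 0; rewrite !scale0r !add0r; split => //; exact: lM.1.
      move=> a y v y' v' [b [y1 [v1 [M1 /= -> ->]]]] [c [y2 [v2 [M2 /= -> ->]]]].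
      exists (a * b + c), (a *: y1 + y2), (a *: v1 + v2); split; first exact: lM.2.
        by rewrite /= !scalerDr !scalerDl scalerA addrACA.
      by rewrite /= !scalerDr !scalerDl scalerA addrACA.
    move=> p [a [y [v [My -> ->]]]].
    have [->|a0] := eqVneq a 0; first by rewrite !scale0r !add0r; exact: (Mq (y, v)).
    have -> : a *: z + v = a *: (a^-1 *: v + z).
      by rewrite scalerDr scalerA mulfV// scale1r addrC.
    have -> : a *: x + y = a *: (a^-1 *: y + x).
      by rewrite scalerDr scalerA mulfV// scale1r addrC.
    rewrite hnormZ exprMn qq.2 ler_wpM2l ?sqr_ge0//; apply: hz.
    by have := lM.2 a^-1 _ _ _ _ My lM.1; rewrite !addr0.
  - by exists 1, 0, 0; rewrite !scale1r !addr0; split => //; exact: lM.1.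
have [D hD] := choice total.
exists D; split => [a x y|x|x w Gx]; last exact: (linrel_fun qq lM Mq (hD x) (GM _ Gx)).
  exact: (linrel_fun qq lM Mq (hD _) (lM.2 _ _ _ _ _ (hD x) (hD y))).
exact: (Mq (x, D x)).
Qed.

Lemma bounded_extension H K (M : R) (G : set (H * K)) :
  0 <= M -> linrel G -> (forall x w, G (x, w) -> hnorm w <= M * hnorm x) ->
  exists2 A : H -> K, hbound M A & forall x w, G (x, w) -> A x = w.
Proof.
move=> M0 lG GM.
have qq : quadratic_form (fun x : H => M ^+ 2 * hnorm x ^+ 2).
  by apply: quadraticZ; exact: (@quadratic_hnorm _ _ id).
have [|[x w]/= Gx|A [lA hA GA]] := @dominated_extension _ K _ G qq _ lG.
- by move=> v; rewrite mulr_ge0 ?sqr_ge0.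
- by rewrite -exprMn lerXn2r ?nnegrE ?hnorm_ge0 ?mulr_ge0 ?hnorm_ge0 ?GM.
exists A => //; split => // x; have := hA x.
by rewrite -exprMn ler_pXn2r ?nnegrE ?hnorm_ge0 ?mulr_ge0 ?hnorm_ge0.
Qed.

(** * Projections, functionals and adjoints *)

Section Projection.
Context H (E : closedSubspace H).
Local Notation U := (subspace_type E).

Lemma val_is_lin : is_lin (val : U -> H).
Proof. by move=> a x y; rewrite linearP. Qed.

Lemma hnorm_val (x : U) : hnorm (val x) = hnorm x.
Proof. by []. Qed.

Lemma inner_val (x y : U) : inner (val x) (val y) = inner x y.
Proof. by []. Qed.

Lemma subspace_val (x : U) : subspace_set E (val x).
Proof. by apply/asboolP; exact: (valP x). Qed.

Lemma subspace_valP (x : H) : subspace_set E x -> exists y : U, val y = x.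
Proof. by move=> /asboolP Ex; exists (Sub x Ex); rewrite SubK. Qed.

(** Put [w = x - z]. The hypothesis says that [hnorm u <= hnorm (w + u)] for all [u]
    in [E]; replacing [u] by its real multiples shows that the term linear in [u]
    of [hnorm (w + u) ^+ 2] vanishes. *)
Lemma contraction_orthogonal (x : H) (z : U) :
  (forall y : U, hnorm (y + z) <= hnorm (val y + x)) ->
  forall y : U, inner (x - val z) (val y) = 0.
Proof.
move=> h; suff main (y : U) : rinner (x - val z) (val y) = 0.
  move=> y; rewrite inner_conj.
  rewrite rinner_inner_eq0 ?conjC0// => a.
  by rewrite rinnerC -linearZ main.
set w := x - val z.
have key (t : R) : 0 <= hnorm w ^+ 2 + t * (2 * rinner w (val y)).
  have := h (t%:C%C *: y - z); rewrite subrK.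
  have -> : val (t%:C%C *: y - z) + x = w + val (t%:C%C *: y).
    by rewrite (linB val_is_lin) /w [RHS]addrC addrA addrAC.
  rewrite -(@ler_pXn2r _ 2) ?nnegrE ?hnorm_ge0// hnorm2D (linZ val_is_lin) rinnerZr.
  by rewrite -(linZ val_is_lin) hnorm_val; lra.
apply/eqP; apply: contraT => r0.
have := key (- (hnorm w ^+ 2 + 1) / (2 * rinner w (val y))).
by rewrite divfK ?mulf_neq0//; lra.
Qed.

Lemma projE (x : H) (z : U) :
  (forall y : U, inner (x - val z) (val y) = 0) -> proj E x = z.
Proof.
move=> hz; apply: xget_unique => // z' hz'; apply: inner_extl => y.
apply/eqP; rewrite -subr_eq0 -innerBl -!inner_val linearB/=.
have -> : val z' - val z = (x - val z) - (x - val z') :> H.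
  by rewrite opprB [RHS]addrC addrA subrK.
by rewrite innerBl hz hz' subrr.
Qed.

(** An extension to [H], of bound 1, of the identity of [E] is the orthogonal
    projection, by [contraction_orthogonal]. *)
Lemma proj_exists : exists2 D : H -> U, hbound 1 D &
  forall x, proj E x = D x /\ forall y : U, inner (x - val (D x)) (val y) = 0.
Proof.
have [||x w [y [/= -> ->]]|D [lD hD] DG] :=
    @bounded_extension H U 1 [set p | exists y : U, p.1 = val y /\ p.2 = y].
- by [].
- split; first by exists 0.
  move=> a x w y v [x' /= [-> ->]] [y' /= [-> ->]].
  by exists (a *: x' + y'); split => /=; rewrite ?val_is_lin.
- by rewrite mul1r.
exists D => // x; suff hx : forall y : U, inner (x - val (D x)) (val y) = 0.
  by split => //; exact: projE.
apply: contraction_orthogonal => y.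
have {1}<- : D (val y) = y by apply: DG; exists y.
by rewrite -linD// (le_trans (hD _))// mul1r.
Qed.

Lemma proj_hbound : hbound 1 (proj E).
Proof.
have [D hD projD] := proj_exists.
by rewrite (_ : proj E = D)//; apply/funext => x; have [] := projD x.
Qed.

Lemma proj_orthogonal x (y : U) : inner (x - val (proj E x)) (val y) = 0.
Proof. by have [D _ projD] := proj_exists; have [->] := projD x. Qed.

Lemma inner_proj x (y : U) : inner (proj E x) y = inner x (val y).
Proof.
by apply/eqP; rewrite eq_sym -subr_eq0 -inner_val -innerBl proj_orthogonal.
Qed.

Lemma proj_val (y : U) : proj E (val y) = y.
Proof. by apply: projE => z; rewrite subrr inner0l. Qed.

Lemma proj_bounded : bounded_linear (proj E).
Proof. exact: hbound_bounded proj_hbound. Qed.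

Lemma val_hbound : hbound 1 (val : U -> H).
Proof. by split; [exact: val_is_lin|move=> x; rewrite mul1r]. Qed.

Lemma val_bounded : bounded_linear (val : U -> H).
Proof. exact: hbound_bounded val_hbound. Qed.

Lemma mem_double_orthogonal x :
  (forall u, (forall y : U, inner u (val y) = 0) -> inner x u = 0) ->
  subspace_set E x.
Proof.
move=> h; suff -> : x = val (proj E x) by exact: subspace_val.
apply/eqP; rewrite -subr_eq0 -hnorm_eq0 -sqrf_eq0 hnorm2.
set u := _ - _; have hu : forall y : U, inner u (val y) = 0.
  by move=> y; exact: proj_orthogonal.
by rewrite {1}/u /rinner innerBl h// inner_conj hu conjC0 subrr.
Qed.

End Projection.

Lemma closureP H (A : set H) x :
  closure A x <-> forall e : R, 0 < e -> exists2 y, A y & hnorm (x - y) < e.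
Proof.
split.
  move=> clA e e0; have [y [Ay]] := clA _ (nbhsx_ballx x e%:C%C (etrans (ltcR _ _) e0)).
  by rewrite -ball_normE /ball_ /= hnormE ltcR => xy; exists y.
move=> h B /nbhs_ballP[e /= e0 eB].
have er : e = (complex.Re e)%:C%C by rewrite RRe_real// gtr0_real.
have [|y Ay xy] := h (complex.Re e); first by rewrite -ltcR -er.
by exists y; split => //; apply: eB; rewrite -ball_normE /ball_ /= hnormE er ltcR.
Qed.

(** The closedness of kernels, for [p = modulus \o phi]. *)
Lemma closed_zeros H (M : R) (p : H -> R) :
  (forall x, 0 <= p x) -> (forall x y, p x <= p y + M * hnorm (x - y)) ->
  closed [set x | p x = 0].
Proof.
move=> p0 pM x /closureP clx; apply/eqP; rewrite eq_le p0 andbT.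
apply/ler_addgt0Pr => e e0; rewrite add0r.
have M1 : 0 < `|M| + 1 by rewrite ltr_wpDl.
have [y py xy] := clx _ (divr_gt0 e0 M1).
rewrite (le_trans (pM x y))// py add0r.
move: xy; rewrite ltr_pdivlMr// mulrC => /ltW; apply: le_trans.
by rewrite ler_wpM2r ?hnorm_ge0// (le_trans (ler_norm _))// lerDl.
Qed.

Lemma riesz H (M : R) (phi : H -> R[i]) :
  (forall a x y, phi (a *: x + y) = a * phi x + phi y) ->
  (forall x, modulus (phi x) <= M * hnorm x) ->
  exists z, forall x, phi x = inner x z.
Proof.
move=> lphi phiM.
have phi0 : phi 0 = 0.
  by have := lphi (-1) 0 0; rewrite scaler0 addr0 mulN1r addNr.
have N0 : [set x | modulus (phi x) = 0] 0 by apply/eqP; rewrite /= modulus_eq0 phi0.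
have NP a x y : [set x | modulus (phi x) = 0] x -> [set x | modulus (phi x) = 0] y ->
    [set x | modulus (phi x) = 0] (a *: x + y).
  move=> /eqP; rewrite modulus_eq0 => /eqP hx /eqP; rewrite modulus_eq0 => /eqP hy.
  by apply/eqP; rewrite /= modulus_eq0 lphi hx hy mulr0 addr0.
have Ncl : closed [set x | modulus (phi x) = 0].
  apply: (@closed_zeros _ M) => [x|x y]; first exact: modulus_ge0.
  have {1}-> : phi x = phi y + phi (x - y).
    by have := lphi 1 (x - y) y; rewrite scale1r subrK mul1r addrC.
  by rewrite (le_trans (modulusD _ _))// lerD2l.
pose N := ClosedSubspace N0 NP Ncl.
have [all0|/existsNP[x0 hx0]] := pselect (forall x, phi x = 0).
  by exists 0 => x; rewrite inner0r.
pose u := x0 - val (proj N x0).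
have uN y : phi y = 0 -> inner y u = 0.
  move=> phiy; have [|y' <-] := @subspace_valP _ N y.
    by apply/eqP; rewrite /= modulus_eq0 phiy.
  by rewrite inner_conj proj_orthogonal conjC0.
have phiu : phi u = phi x0.
  have /eqP := subspace_val (proj N x0); rewrite /= modulus_eq0 => /eqP h.
  by have := lphi (-1) (val (proj N x0)) x0; rewrite scaleN1r addrC h mulr0 add0r.
have u0 : inner u u != 0.
  rewrite inner_norm expf_neq0// normr_eq0; apply/eqP => u0.
  by apply: hx0; rewrite -phiu u0.
exists ((phi u / inner u u)^* *: u) => x.
have := uN (phi u *: x - phi x *: u).
rewrite -scaleN1r addrC lphi -[phi u *: x]addr0 lphi phi0 addr0.
rewrite -[phi x *: u]addr0 lphi phi0 !addr0 mulN1r mulrC addNr => /(_ erefl).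
rewrite innerDl scaleN1r innerNl !innerZl addrC => /eqP; rewrite subr_eq0 => /eqP h.
by rewrite innerZr conjCK mulrAC h mulfK.
Qed.

Section Adjoint.
Context H K (A : H -> K) (bA : bounded_linear A).

Lemma adjoint_exists y : exists z, forall x, inner (A x) y = inner x z.
Proof.
have /bounded_linearP[M M0 [lA hA]] := bA.
apply: (@riesz _ (M * hnorm y)) => [a x x'|x]; first by rewrite lA inner_linear.
rewrite (le_trans (modulus_inner_le _ _))// mulrAC ler_wpM2r ?hnorm_ge0//.
Qed.

Lemma adjointP x y : inner (A x) y = inner x (adjoint A y).
Proof. by have [z hz] := adjoint_exists y; rewrite /adjoint; case: xgetP => [w _ /= ->//|/(_ z)]. Qed.

Lemma adjointPr x y : inner y (A x) = inner (adjoint A y) x.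
Proof. by rewrite inner_conj adjointP -inner_conj. Qed.

Lemma adjoint_is_lin : is_lin (adjoint A).
Proof.
move=> a x y; apply: inner_ext => z.
by rewrite -adjointP innerDr innerZr !adjointP innerDr innerZr.
Qed.

Lemma adjoint_hbound M : 0 <= M -> hbound M A -> hbound M (adjoint A).
Proof.
move=> M0 [_ hA]; split; first exact: adjoint_is_lin.
move=> y; have [->|z0] := eqVneq (adjoint A y) 0.
  by rewrite hnorm0 mulr_ge0 ?hnorm_ge0.
have n0 : 0 < hnorm (adjoint A y) by rewrite lt_def hnorm_eq0 z0 hnorm_ge0.
rewrite -(ler_pM2l n0) -expr2 hnorm2 {1}/rinner -adjointP.
rewrite (le_trans (rinner_le _ _))// mulrA ler_wpM2r ?hnorm_ge0//.
by rewrite mulrC hA.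
Qed.

Lemma adjoint_bounded : bounded_linear (adjoint A).
Proof.
have /bounded_linearP[M M0 hA] := bA.
exact: hbound_bounded (adjoint_hbound M0 hA).
Qed.

End Adjoint.

Lemma adjointE H K (A : H -> K) (B : K -> H) :
  (forall x y, inner (A x) y = inner x (B y)) -> adjoint A = B.
Proof.
move=> h; apply/funext => y; apply: xget_unique => [x|z hz]; first exact: h.
by apply: inner_ext => x; rewrite -h hz.
Qed.

End Extension.

(** * The uniform boundedness principle *)

Section UniformBoundedness.
Context {R : realType}.
Implicit Types (H K : hilbertType R).

Lemma hcvg_dist_le H (u : nat -> H) (l y : H) (c : R) (N : nat) :
  (u k @[k --> \oo] --> l) -> (forall k, (N <= k)%N -> hnorm (u k - y) <= c) ->
  hnorm (l - y) <= c.
Proof.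
move=> /hcvgP ul uc; apply/ler_addgt0Pr => e e0.
have [k [hk kN]] := filter_ex (filterI (ul e e0) (nbhs_infty_ge N)).
rewrite -(subrK (u k) l) -addrA (le_trans (hnormD _ _))// [leRHS]addrC lerD ?uc//.
by rewrite hdistC ltW.
Qed.

(** If [hnorm v = r] and [hnorm (T v)] is nearly [opnorm T * r], then one of [x + v]
    and [x - v] is a suitable point, because [2 T v = T (x + v) - T (x - v)]. *)
Lemma exists_far_point H K (T : H -> K) (x : H) (r : R) :
  bounded_linear T -> 0 < opnorm T -> 0 < r ->
  exists2 y, hnorm (y - x) <= r & 2 / 3 * opnorm T * r <= hnorm (T y).
Proof.
move=> bT T0 r0; have lT := bounded_lin bT.
have [u hu] : exists u, 2 / 3 * opnorm T * hnorm u < hnorm (T u).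
  apply/not_existsP => h.
  suff : opnorm T <= 2 / 3 * opnorm T by lra.
  by apply: opnorm_le => [|u]; [lra|rewrite leNgt; apply/negP; exact: h].
have u0 : 0 < hnorm u.
  rewrite lt_def hnorm_ge0 hnorm_eq0 andbT; apply: contraTN hu => /eqP ->.
  by rewrite lin0// !hnorm0 mulr0 ltxx.
pose v := (r / hnorm u)%:C%C *: u.
have ru0 : 0 <= r / hnorm u by rewrite divr_ge0// ltW.
have vr : hnorm v = r by rewrite hnormZ modulus_real// divfK// gt_eqF.
have Tv : 2 / 3 * opnorm T * r <= hnorm (T v).
  rewrite linZ// hnormZ modulus_real// [leRHS]mulrAC ler_pdivlMr//.
  by rewrite [leLHS]mulrAC [leRHS]mulrC ler_wpM2r ?ltW.
clearbody v; have [h|h] := leP (2 / 3 * opnorm T * r) (hnorm (T (x + v))).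
  by exists (x + v) => //; rewrite addrC addKr vr.
exists (x - v); first by rewrite addrC addKr hnormN vr.
have : 2 * hnorm (T v) <= hnorm (T (x + v)) + hnorm (T (x - v)).
  apply: le_trans (hnormB _ _); rewrite -linB// opprD addrACA subrr add0r opprK.
  have -> : v + v = 2%:C%C *: v by rewrite rmorphD/= scalerDl scale1r.
  by rewrite linZ// hnormZ modulus_real.
by lra.
Qed.

(** A gliding hump. If the norms [opnorm (A m)] were unbounded, one could choose [x k]
    and [m k] with [hnorm (x k.+1 - x k) <= r k], where [r k = 3 ^- k], and with
    [A (m k) (x k.+1)] at least [2 / 3 * opnorm (A (m k)) * r k] in norm. The limit
    [l] of [x] is at distance at most [r k / 2] from [x k.+1], which leaves at least
    [opnorm (A (m k)) * r k / 6 >= k.+1] for the norm of [A (m k) l]. *)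
Theorem uniform_boundedness H K (A : nat -> H -> K) :
  (forall m, bounded_linear (A m)) ->
  (forall x, exists C, forall m, hnorm (A m x) <= C) ->
  exists2 M, 0 <= M & forall m, hbound M (A m).
Proof.
move=> bA ptA.
have [[M hM]|nM] := pselect (exists M, forall m, opnorm (A m) <= M).
  exists M; first exact: le_trans (opnorm_ge0 (A 0)) (hM 0%N).
  move=> m; have [lA hA] := hbound_opnorm (bA m); split => // x.
  by rewrite (le_trans (hA x))// ler_wpM2r ?hnorm_ge0.
exfalso; pose r (k : nat) : R := (3 ^+ k)^-1.
have r0 k : 0 < r k by rewrite invr_gt0 exprn_gt0.
have rS k : r k = 3 * r k.+1.
  by rewrite /r exprS invfM mulrA mulfV ?mul1r.
have /choice[g hg] : forall p : nat * H, exists y : nat * H,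
    [/\ 6 * p.1.+1%:R / r p.1 <= opnorm (A y.1), hnorm (y.2 - p.2) <= r p.1 &
        2 / 3 * opnorm (A y.1) * r p.1 <= hnorm (A y.1 y.2)].
  move=> [k x]; have /existsNP[m /negP] := (forallNP _).2 nM (6 * k.+1%:R / r k).
  rewrite -ltNge => hm.
  have m0 : 0 < opnorm (A m) by apply: le_lt_trans hm; rewrite divr_ge0 ?mulr_ge0// ltW.
  have [y yx Ay] := exists_far_point x (bA m) m0 (r0 k).
  by exists (m, y); split => //; exact: ltW.
pose x := fix x k := if k is j.+1 then (g (j, x j)).2 else (0 : H).
pose m k := (g (k, x k)).1.
have xS k : hnorm (x k.+1 - x k) <= r k by have [] := hg (k, x k).
(* the tail of the geometric series [\sum_(j > k) r j] equals [r k / 2] *)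
have xD k j : hnorm (x (k.+1 + j)%N - x k.+1) <= r k / 2 - r (k + j)%N / 2.
  elim: j => [|j IH]; first by rewrite !addn0 !subrr hnorm0.
  rewrite addnS -(subrK (x (k.+1 + j)%N) (x (k.+1 + j).+1)) -addrA.
  rewrite (le_trans (hnormD _ _))//.
  have h1 := xS (k.+1 + j)%N; have h2 := rS (k + j)%N.
  by rewrite addSn in h1 IH *; rewrite addnS; lra.
have xle k j : (k < j)%N -> hnorm (x j - x k.+1) <= r k / 2.
  move=> kj; rewrite -(subnKC kj) (le_trans (xD _ _))// gerBl.
  by rewrite divr_ge0// ltW.
have [l xl] : exists l : H, x k @[k --> \oo] --> l.
  apply: hcauchy_cvg => e e0.
  have cr : r k @[k --> \oo] --> (0 : R).
    by under eq_fun do rewrite /r -exprVn; apply: cvg_expr; rewrite ger0_norm// invf_lt1// ltr1n.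
  have /cvgrPdist_lt/(_ _ e0)[N _ /(_ N (leqnn N))] := cr.
  rewrite /= sub0r normrN gtr0_norm// => rN.
  exists N.+1 => a b Na Nb; apply: le_lt_trans rN.
  rewrite -(subrK (x N.+1) (x a)) -addrA (le_trans (hnormD _ _))//.
  rewrite (splitr (r N)) lerD ?xle// hdistC xle//.
have far k : k.+1%:R <= hnorm (A (m k) l).
  have [op _ Ax] := hg (k, x k); move: op Ax; rewrite -/(m k) -[(g _).2]/(x k.+1) /=.
  rewrite ler_pdivrMr// => op Ax.
  have lx : hnorm (l - x k.+1) <= r k / 2.
    by apply: (@hcvg_dist_le _ _ _ _ _ k.+1 xl) => j; exact: xle.
  have [lA hA] := hbound_opnorm (bA (m k)).
  have Alx : hnorm (A (m k) (l - x k.+1)) <= opnorm (A (m k)) * (r k / 2).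
    by rewrite (le_trans (hA _))// ler_wpM2l ?opnorm_ge0.
  have : hnorm (A (m k) (x k.+1)) <= hnorm (A (m k) l) + hnorm (A (m k) (l - x k.+1)).
    have -> : A (m k) (x k.+1) = A (m k) l - A (m k) (l - x k.+1).
      by rewrite -linB// opprB addrC subrK.
    exact: hnormB.
  by move: (opnorm _) (hnorm _) (hnorm _) (hnorm _) (r k) op Ax Alx => o a b c d; lra.
have [C hC] := ptA l.
have := le_trans (far (Num.truncn `|C|)) (le_trans (hC _) (ler_norm C)).
by rewrite leNgt truncnS_gt.
Qed.

End UniformBoundedness.

(** * Total sets and Hilbert tensor products *)

Section TotalSets.
Context {R : realType}.
Implicit Types (H K L T : hilbertType R).

Definition total_set H (S : set H) : Prop := closure (linear_span S) = setT.

Lemma span_closure_sub H (S : set H) (E : closedSubspace H) :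
  S `<=` subspace_set E -> closure (linear_span S) `<=` subspace_set E.
Proof.
move=> SE; have /closure_id -> := @subspace_closed _ _ E.
apply: closureS => _ [m [c [v [hv ->]]]].
apply: (@big_ind _ (subspace_set E)) => [|x y Ex Ey|i _].
- exact: subspace0.
- by rewrite -[x]scale1r; exact: subspaceP.
- by rewrite -[_ *: _]addr0; apply: subspaceP; [exact/SE/hv|exact: subspace0].
Qed.

Lemma total_orthogonal H (S : set H) y :
  total_set S -> (forall x, S x -> inner x y = 0) -> y = 0.
Proof.
move=> tS Sy; apply/eqP; rewrite -hnorm_eq0 -sqrf_eq0 hnorm2 /rinner.
have SE : S `<=` subspace_set (orthocomplement [set y]) by move=> x Sx _ ->; exact: Sy.
have := span_closure_sub SE; rewrite tS => /(_ y Logic.I y erefl) ->.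
by [].
Qed.

Lemma total_ext H K (S : set H) (A B : H -> K) : total_set S ->
  bounded_linear A -> bounded_linear B -> (forall x, S x -> A x = B x) -> A = B.
Proof.
move=> tS bA bB AB; apply/funext => x; apply: inner_extl => z.
rewrite !adjointP//; congr inner; apply/eqP; rewrite -subr_eq0; apply/eqP.
by apply: (total_orthogonal tS) => y Sy; rewrite innerBr -!adjointP// AB// subrr.
Qed.

Lemma total_approx H (S : set H) x (e : R) : total_set S -> 0 < e ->
  exists2 y, linear_span S y & hnorm (x - y) < e.
Proof.
move=> tS e0; have /closureP : closure (linear_span S) x by rewrite tS.
exact.
Qed.

Lemma linear_span_seq H (S : set H) x : linear_span S x ->
  exists2 s : seq (R[i] * H), (forall p, p \in s -> S p.2) & x = \sum_(p <- s) p.1 *: p.2.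
Proof.
move=> [m [c [v [hv ->]]]]; exists [seq (c i, v i) | i <- enum 'I_m].
  by move=> p /mapP[i _ ->]; exact: hv.
by rewrite big_map big_enum.
Qed.

End TotalSets.

Section Tensor.
Context {R : realType}.
Implicit Types (H K L T : hilbertType R).

Section TensorTheory.
Context H K T (t : H -> K -> T) (ht : hilbert_tensor t).

Lemma tensor_linl k : is_lin (t ^~ k).
Proof. by case: ht => h _ _ _ a x y; exact: h. Qed.

Lemma tensor_linr x : is_lin (t x).
Proof. by case: ht => _ h _ _ a k l; exact: h. Qed.

Lemma inner_tensor x y k l : inner (t x k) (t y l) = inner x y * inner k l.
Proof. by case: ht. Qed.

Lemma tensor_total : total_set [set t x k | x in setT & k in setT].
Proof. by case: ht. Qed.

Lemma hnorm_tensor x k : hnorm (t x k) = hnorm x * hnorm k.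
Proof.
apply/eqP; rewrite -(@eqrXn2 _ 2) ?mulr_ge0 ?hnorm_ge0// exprMn hnorm2 /rinner.
by rewrite inner_tensor !inner_hnorm -rmorphM.
Qed.

Lemma tensor_bounded k : bounded_linear (t ^~ k).
Proof.
apply: (@hbound_bounded _ _ _ (hnorm k)); split; first exact: tensor_linl.
by move=> x; rewrite hnorm_tensor mulrC.
Qed.

Lemma tensor_ext L (A B : T -> L) : bounded_linear A -> bounded_linear B ->
  (forall x k, A (t x k) = B (t x k)) -> A = B.
Proof.
by move=> bA bB AB; apply: (total_ext tensor_total) => // _ [x _ [k _ <-]].
Qed.

Lemma linear_span_tensor u :
  linear_span [set t x k | x in setT & k in setT] u ->
  exists s : seq (H * K), u = \sum_(p <- s) t p.1 p.2.
Proof.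
move=> /linear_span_seq[s]; elim: s u => [|[a v] s IH] u hs ->.
  by exists [::]; rewrite !big_nil.
have [|s' hs'] := IH (\sum_(p <- s) p.1 *: p.2) _ erefl.
  by move=> p ps; apply: hs; rewrite inE ps orbT.
have [x _ [k _ /= xkv]] := hs (a, v) (mem_head _ _).
exists ((a *: x, k) :: s'); rewrite !big_cons hs' /= -xkv.
by rewrite (linZ (tensor_linl k)).
Qed.

End TensorTheory.

(** The operator [A (x) I] between two tensor products with the same second factor;
    for [t = t'] this is [ampliation]. *)
Definition amp H L K T T' (t : H -> K -> T) (t' : L -> K -> T') (A : H -> L) : T -> T' :=
  xget (fun=> 0) [set S | bounded_linear S /\ forall x k, S (t x k) = t' (A x) k].

Lemma hcvg_sum H (I U : Type) (F : set_system U) {FF : Filter F} (s : seq I)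
  (f : I -> U -> H) (l : I -> H) : (forall i, f i x @[x --> F] --> l i) ->
  \sum_(i <- s) f i x @[x --> F] --> \sum_(i <- s) l i.
Proof.
move=> fl; elim: s => [|i s IH].
  by under eq_fun do rewrite big_nil; rewrite big_nil; exact: cvg_cst.
by under eq_fun do rewrite big_cons; rewrite big_cons; exact: cvgD.
Qed.

Section Amplification.
Context H L K T T' (t : H -> K -> T) (t' : L -> K -> T').
Hypotheses (ht : hilbert_tensor t) (ht' : hilbert_tensor t').

(** Splitting off the components of the other second factors along [k] rewrites the
    sum as [t y k] plus a shorter sum orthogonal to it, and [A] applied to the first
    factors respects this splitting; so the bound follows by Pythagoras and
    induction. *)
Lemma tensor_sum_bound (M : R) (A : H -> L) (s : seq (H * K)) :
  0 <= M -> hbound M A ->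
  hnorm (\sum_(p <- s) t' (A p.1) p.2) <= M * hnorm (\sum_(p <- s) t p.1 p.2).
Proof.
move=> M0 [lA hA]; elim: (size s) {-2}s (erefl (size s)) => [|m IH] {}s.
  by move=> /size0nil ->; rewrite !big_nil !hnorm0 mulr0.
case: s => [//|[x k] s] /= [sm].
have [k0|k0] := eqVneq k 0.
  rewrite !big_cons k0 /= (lin0 (tensor_linr ht x)) (lin0 (tensor_linr ht' _)).
  by rewrite !add0r; exact: IH.
pose c (p : H * K) := inner p.2 k / inner k k.
pose s' := [seq (p.1, p.2 - c p *: k) | p <- s].
pose y := x + \sum_(p <- s) c p *: p.1.
have kk : inner k k != 0 by rewrite inner_norm expf_neq0// normr_eq0.
have orth p : inner (p.2 - c p *: k) k = 0.
  by rewrite innerBl innerZl divfK// subrr.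
have split1 : \sum_(p <- (x, k) :: s) t p.1 p.2 = t y k + \sum_(p <- s') t p.1 p.2.
  rewrite big_cons /= (linD (tensor_linl ht k)) -addrA; congr (_ + _).
  rewrite (lin_sum (tensor_linl ht k)) big_map -big_split/=; apply: eq_bigr => p _.
  rewrite (linZ (tensor_linl ht k)) (linB (tensor_linr ht _)) (linZ (tensor_linr ht _)).
  by rewrite addrC subrK.
have split2 : \sum_(p <- (x, k) :: s) t' (A p.1) p.2 = t' (A y) k + \sum_(p <- s') t' (A p.1) p.2.
  rewrite big_cons /= (linD lA) (linD (tensor_linl ht' k)) -addrA; congr (_ + _).
  rewrite (lin_sum lA) (lin_sum (tensor_linl ht' k)) big_map -big_split/=; apply: eq_bigr => p _.
  rewrite (linZ lA) (linZ (tensor_linl ht' k)) (linB (tensor_linr ht' _)) (linZ (tensor_linr ht' _)).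
  by rewrite addrC subrK.
rewrite split1 split2 -(@ler_pXn2r _ 2) ?nnegrE ?hnorm_ge0 ?mulr_ge0 ?hnorm_ge0// exprMn.
have o1 : rinner (t y k) (\sum_(p <- s') t p.1 p.2) = 0.
  rewrite rinnerC /rinner inner_suml big_map big1_seq// => p _ /=.
  by rewrite (inner_tensor ht) orth mulr0.
have o2 : rinner (t' (A y) k) (\sum_(p <- s') t' (A p.1) p.2) = 0.
  rewrite rinnerC /rinner inner_suml big_map big1_seq// => p _ /=.
  by rewrite (inner_tensor ht') orth mulr0.
rewrite !hnorm2D o1 o2 mulr0 !addr0 mulrDr -!exprMn; apply: lerD.
  rewrite lerXn2r ?nnegrE ?hnorm_ge0 ?mulr_ge0 ?hnorm_ge0//.
  by rewrite (hnorm_tensor ht) (hnorm_tensor ht') mulrA ler_wpM2r ?hnorm_ge0.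
rewrite lerXn2r ?nnegrE ?hnorm_ge0 ?mulr_ge0 ?hnorm_ge0//.
by apply: IH; rewrite size_map.
Qed.

Lemma amp_exists (M : R) (A : H -> L) : 0 <= M -> hbound M A ->
  exists2 S : T -> T', hbound M S & forall x k, S (t x k) = t' (A x) k.
Proof.
move=> M0 hA; have [lA _] := hA.
have [|_ _ [s [-> ->]]|S hS SG] := @bounded_extension _ T T' M [set p | exists s : seq (H * K),
  p = (\sum_(q <- s) t q.1 q.2, \sum_(q <- s) t' (A q.1) q.2)] M0.
- split; first by exists [::]; rewrite !big_nil.
  move=> a _ _ _ _ [s [-> ->]] [s' [-> ->]].
  exists ([seq (a *: q.1, q.2) | q <- s] ++ s'); rewrite !big_cat !big_map /=.
  rewrite !scaler_sumr; congr (_ + _, _ + _); apply: eq_bigr => q _.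
    by rewrite (linZ (tensor_linl ht _)).
  by rewrite (linZ lA) (linZ (tensor_linl ht' _)).
- exact: tensor_sum_bound.
exists S => // x k; apply: SG; exists [:: (x, k)].
by rewrite !big_seq1.
Qed.

Lemma amp_spec (A : H -> L) : bounded_linear A ->
  bounded_linear (amp t t' A) /\ forall x k, amp t t' A (t x k) = t' (A x) k.
Proof.
move=> /bounded_linearP[M M0 hA]; have [S hS SE] := amp_exists M0 hA.
rewrite /amp; case: xgetP => [_ _ //|/(_ S)]; case.
by split => //; exact: hbound_bounded hS.
Qed.

Lemma amp_bounded (A : H -> L) : bounded_linear A -> bounded_linear (amp t t' A).
Proof. by move=> /amp_spec[]. Qed.

Lemma ampE (A : H -> L) x k : bounded_linear A -> amp t t' A (t x k) = t' (A x) k.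
Proof. by move=> /amp_spec[]. Qed.

Lemma amp_unique (A : H -> L) (S : T -> T') : bounded_linear A -> bounded_linear S ->
  (forall x k, S (t x k) = t' (A x) k) -> amp t t' A = S.
Proof.
move=> bA bS SE; apply: (tensor_ext ht) => //; first exact: amp_bounded.
by move=> x k; rewrite ampE.
Qed.

Lemma amp_hbound (M : R) (A : H -> L) : 0 <= M -> hbound M A -> hbound M (amp t t' A).
Proof.
move=> M0 hA; have [S hS SE] := amp_exists M0 hA.
rewrite (@amp_unique A S)//; [exact: hbound_bounded hA|exact: hbound_bounded hS].
Qed.

Lemma amp_axpy (a : R[i]) (A B : H -> L) : bounded_linear A -> bounded_linear B ->
  amp t t' (fun x => a *: A x + B x) = fun u => a *: amp t t' A u + amp t t' B u.
Proof.
move=> bA bB; apply: amp_unique; [exact: bounded_axpy|exact: bounded_axpy (amp_bounded _) (amp_bounded _)|].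
by move=> x k; rewrite !ampE// (tensor_linl ht').
Qed.

(** Strong convergence gives convergence on the span of the elementary tensors, and
    the uniform bound on the [A m] extends it to the closure. *)
Lemma amp_sot (A : nat -> H -> L) (B : H -> L) :
  (forall m, bounded_linear (A m)) -> bounded_linear B ->
  (forall x, A m x @[m --> \oo] --> B x) ->
  forall u, amp t t' (A m) u @[m --> \oo] --> amp t t' B u.
Proof.
move=> bA bB AB u.
have [M M0 hM] : exists2 M, 0 <= M & forall m, hbound M (A m).
  apply: uniform_boundedness => // x.
  have /hcvgP/(_ 1 ltr01)[N _ hN] := AB x.
  exists (hnorm (B x) + 1 + \sum_(i < N) hnorm (A i x)) => m.
  have s0 : 0 <= \sum_(i < N) hnorm (A i x) by apply: sumr_ge0 => i _; exact: hnorm_ge0.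
  have [Nm|mN] := leqP N m.
    rewrite -(subrK (B x) (A m x)) (le_trans (hnormD _ _))//.
    by have := hN m Nm; move: (hnorm_ge0 (B x)) => /=; lra.
  rewrite (bigD1 (Ordinal mN))//= addrCA lerDl.
  rewrite addr_ge0 ?addr_ge0 ?hnorm_ge0 ?sumr_ge0// => i _; exact: hnorm_ge0.
have /bounded_linearP[M' M'0 hM'] := bB.
apply/hcvgP => e e0; have D0 : 0 < M + M' + 1 by lra.
have [v /(linear_span_tensor ht)[s vE] uv] :=
  total_approx u (tensor_total ht) (divr_gt0 e0 (addr_gt0 D0 D0)).
have /hcvgP/(_ _ (divr_gt0 e0 (ltr0Sn _ 1))) :
    amp t t' (A m) v @[m --> \oo] --> amp t t' B v.
  have ampvE C : bounded_linear C -> amp t t' C v = \sum_(p <- s) t' (C p.1) p.2.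
    move=> bC; rewrite vE (lin_sum (bounded_lin (amp_bounded bC))).
    by apply: eq_bigr => p _; rewrite ampE.
  rewrite ampvE//; under eq_fun do rewrite ampvE//.
  apply: hcvg_sum => p.
  exact: (bounded_cvg (tensor_bounded ht' p.2) (AB p.1)).
apply: filterS => m hv.
have [lAm hAm] := amp_hbound M0 (hM m); have [lBm hBm] := amp_hbound M'0 hM'.
have -> : amp t t' (A m) u - amp t t' B u =
    amp t t' (A m) (u - v) + (amp t t' (A m) v - amp t t' B v) - amp t t' B (u - v).
  by rewrite (linB lAm) (linB lBm) addrA subrK opprB addrA subrK.
rewrite (le_lt_trans (hnormB _ _))//.
have h1 := hAm (u - v); have h2 := hBm (u - v).
have h3 := hnormD (amp t t' (A m) (u - v)) (amp t t' (A m) v - amp t t' B v).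
move: uv; rewrite ltr_pdivlMr; last exact: (addr_gt0 D0 D0).
move=> uv.
have h4 := hnorm_ge0 (u - v); move: hv => /= hv.
by lra.
Qed.

End Amplification.
End Tensor.

Section AmplificationAlgebra.
Context {R : realType}.
Implicit Types (H K L T : hilbertType R).

Lemma amp_comp H L L' K (T T' T'' : hilbertType R) (t : H -> K -> T) (t' : L -> K -> T')
  (t'' : L' -> K -> T'') (A : H -> L) (B : L -> L') :
  hilbert_tensor t -> hilbert_tensor t' -> hilbert_tensor t'' ->
  bounded_linear A -> bounded_linear B ->
  amp t' t'' B \o amp t t' A = amp t t'' (B \o A).
Proof.
move=> ht ht' ht'' bA bB; symmetry; apply: amp_unique => //.
- exact: bounded_comp.
- by apply: bounded_comp; exact: amp_bounded.
- by move=> x k /=; rewrite !ampE.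
Qed.

Lemma amp_id H K T (t : H -> K -> T) : hilbert_tensor t -> amp t t id = id.
Proof. by move=> ht; apply: amp_unique => //; exact: bounded_id. Qed.

Lemma amp_adjoint H L K (T T' : hilbertType R) (t : H -> K -> T) (t' : L -> K -> T')
  (A : H -> L) : hilbert_tensor t -> hilbert_tensor t' -> bounded_linear A ->
  adjoint (amp t t' A) = amp t' t (adjoint A).
Proof.
move=> ht ht' bA; symmetry; apply: amp_unique => //.
- exact: adjoint_bounded.
- exact/adjoint_bounded/amp_bounded.
- move=> y l; apply/eqP; rewrite -subr_eq0; apply/eqP.
  apply: (total_orthogonal (tensor_total ht)) => _ [x _ [k _ <-]].
  rewrite innerBr -adjointP; last exact: amp_bounded.
  by rewrite ampE// (inner_tensor ht) (inner_tensor ht') adjointP// subrr.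
Qed.

(** The adjoint of [x |-> t x l] is the slice map [x (x) k |-> <k, l> x]. *)
Lemma slice_intertwine H L K (T T' : hilbertType R) (t : H -> K -> T) (t' : L -> K -> T')
  (A : H -> L) (l : K) u : hilbert_tensor t -> hilbert_tensor t' -> bounded_linear A ->
  adjoint (t' ^~ l) (amp t t' A u) = A (adjoint (t ^~ l) u).
Proof.
move=> ht ht' bA; apply: inner_ext => y.
rewrite -(adjointP (tensor_bounded ht' l)) (adjointPr bA).
rewrite -(adjointP (tensor_bounded ht l)) (adjointPr (amp_bounded ht ht' bA)).
by rewrite amp_adjoint// ampE//; exact: adjoint_bounded.
Qed.

End AmplificationAlgebra.

(** * Square summable families indexed by words *)

Section Words.
Context {n : nat}.

(** Listed by recursion on the first letter, as suits products of series and the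
    backward shifts. *)
Fixpoint words (m : nat) : seq (word n) :=
  if m is m'.+1 then [::] :: [seq i :: w | i <- enum 'I_n, w <- words m'] else [::].

Lemma mem_words m (w : word n) : (w \in words m) = (size w < m)%N.
Proof.
elim: m w => [//|m IH] [|i w] //=; rewrite inE /= ltnS -IH.
apply/allpairsP/idP => [[[j v] /= [_ vm [_ ->]]] //|wm].
by exists (i, w); rewrite mem_enum.
Qed.

Lemma words_uniq m : uniq (words m).
Proof.
elim: m => [//|m IH] /=; apply/andP; split.
  by apply/allpairsP => -[[j v] /= []].
by apply: allpairs_uniq => //; [exact: enum_uniq|move=> [i w] [j v] _ _ [-> ->]].
Qed.

Lemma perm_words_rcons m : perm_eq (words m.+1)
  ([::] :: [seq rcons w i | i <- enum 'I_n, w <- words m]).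
Proof.
apply: uniq_perm; first exact: words_uniq.
  rewrite cons_uniq; apply/andP; split; first by apply/allpairsP => -[[j [|? ?]] /= []].
  apply: allpairs_uniq; [exact: enum_uniq|exact: words_uniq|].
  by move=> [i w] [j v] _ _ /= /rcons_inj[-> ->].
move=> w; rewrite mem_words inE; case/lastP: w => [//|w i].
rewrite size_rcons ltnS -mem_words.
have -> : (rcons w i == [::]) = false by case: w.
apply/idP/allpairsP => [wm|[[j v] /= [_ vm /rcons_inj[-> _]]]//].
by exists (i, w); rewrite mem_enum.
Qed.

Lemma big_words_cons (V : nmodType) m (F : word n -> V) :
  \sum_(w <- words m.+1) F w = F [::] + \sum_i \sum_(w <- words m) F (i :: w).
Proof. by rewrite big_cons big_allpairs_dep /= big_enum. Qed.

Lemma big_words_rcons (V : nmodType) m (F : word n -> V) :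
  \sum_(w <- words m.+1) F w = F [::] + \sum_i \sum_(w <- words m) F (rcons w i).
Proof. by rewrite (perm_big _ (perm_words_rcons m)) big_cons big_allpairs_dep /= big_enum. Qed.

Lemma words_tuples m : perm_eq (words m)
  [seq tval w | k <- iota 0 m, w <- enum {: k.-tuple 'I_n}].
Proof.
apply: uniq_perm; first exact: words_uniq.
  apply: allpairs_uniq_dep => [|k _|]; [exact: iota_uniq|exact: enum_uniq|].
  move=> [k w] [l v] _ _ /= wv.
  have kl : k = l by rewrite -(size_tuple w) -(size_tuple v) wv.
  by subst l; rewrite (val_inj wv).
move=> w; rewrite mem_words; apply/idP/allpairsPdep => [wm|[k [v [km _ ->]]]].
  by exists (size w), (in_tuple w); rewrite mem_iota mem_enum.
by rewrite size_tuple; move: km; rewrite mem_iota.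
Qed.

Lemma big_words (V : nmodType) m (F : word n -> V) :
  \sum_(k < m) \sum_(w : k.-tuple 'I_n) F (tval w) = \sum_(w <- words m) F w.
Proof.
rewrite (perm_big _ (words_tuples m)) big_allpairs_dep /=.
by rewrite -[X in iota 0 X]subn0 -/(index_iota 0 m) big_mkord; apply: eq_bigr => k _; rewrite big_enum.
Qed.

Lemma big_words_le (R : numDomainType) m (F : word n -> R) w :
  (forall v, 0 <= F v) -> (size w < m)%N -> F w <= \sum_(v <- words m) F v.
Proof.
move=> F0 wm; rewrite (bigD1_seq w) ?mem_words ?words_uniq//= lerDl.
exact: sumr_ge0.
Qed.

Lemma big_words_homo (R : numDomainType) (F : word n -> R) :
  (forall v, 0 <= F v) -> {homo (fun m => \sum_(v <- words m) F v) : m m' / (m <= m')%N >-> m <= m'}.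
Proof.
move=> F0 m m' mm'; rewrite -!big_words.
rewrite -(subnKC mm') big_split_ord /= lerDl.
by apply: sumr_ge0 => k _; exact: sumr_ge0.
Qed.

End Words.

Section ComplexLimits.
Context {R : realType}.

(** Convergence in [R[i]], reduced to convergence in [R]. *)
Definition ccvg (u : nat -> R[i]) (l : R[i]) : Prop :=
  (complex.Re (u m) @[m --> \oo] --> complex.Re l) /\
  (complex.Im (u m) @[m --> \oo] --> complex.Im l).

Lemma ccvg_unique u l l' : ccvg u l -> ccvg u l' -> l = l'.
Proof.
case: l l' => [a b] [c d] [/= h1 h2] [/= h3 h4].
congr Complex; [apply: cvg_unique h1 h3|apply: cvg_unique h2 h4]; exact: norm_hausdorff.
Qed.

Lemma ccvg_axpy a u v l l' : ccvg u l -> ccvg v l' ->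
  ccvg (fun m => a * u m + v m) (a * l + l').
Proof.
move=> [u1 u2] [v1 v2].
have ReE (z w : R[i]) : complex.Re (a * z + w) =
    complex.Re a * complex.Re z - complex.Im a * complex.Im z + complex.Re w.
  by case: (a) z w => [? ?] [? ?] [? ?].
have ImE (z w : R[i]) : complex.Im (a * z + w) =
    complex.Re a * complex.Im z + complex.Im a * complex.Re z + complex.Im w.
  by case: (a) z w => [? ?] [? ?] [? ?].
split; rewrite ?ReE ?ImE.
  under eq_fun do rewrite ReE; apply: cvgD => //.
  by apply: cvgB; exact: cvgMl_tmp.
under eq_fun do rewrite ImE; apply: cvgD => //.
by apply: cvgD; exact: cvgMl_tmp.
Qed.

Lemma ccvg_conj u l : ccvg u l -> ccvg (fun m => (u m)^*%R) l^*%R.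
Proof.
move=> [u1 u2]; have ReE (z : R[i]) : complex.Re z^*%R = complex.Re z by case: z.
have ImE (z : R[i]) : complex.Im z^*%R = - complex.Im z by case: z.
split; rewrite ?ReE ?ImE; first by under eq_fun do rewrite ReE.
by under eq_fun do rewrite ImE; exact: cvgN.
Qed.

End ComplexLimits.

Section WordL2.
Context {R : realType} (n : nat) (K : hilbertType R).
Implicit Types (x y z : word n -> K).

Definition sqsum x (m : nat) : R := \sum_(w <- words m) hnorm (x w) ^+ 2.

Lemma sqsum_homo x : {homo sqsum x : m m' / (m <= m')%N >-> m <= m'}.
Proof. by apply: big_words_homo => w; exact: sqr_ge0. Qed.

Lemma sqsum_ge0 x m : 0 <= sqsum x m.
Proof. by apply: sumr_ge0 => w _; exact: sqr_ge0. Qed.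

Definition square_summable x : Prop := exists M, forall m, sqsum x m <= M.

Definition wordL2_pred : pred (word n -> K) := fun x => `[< square_summable x >].

Lemma sqsumD x y m : sqsum (x + y) m <= 2 * sqsum x m + 2 * sqsum y m.
Proof.
rewrite /sqsum !mulr_sumr -big_split /=; apply: ler_sum => w _.
have : hnorm (x w + y w) ^+ 2 <= (hnorm (x w) + hnorm (y w)) ^+ 2.
  by rewrite lerXn2r ?nnegrE ?addr_ge0 ?hnorm_ge0 ?hnormD.
move=> /le_trans; apply.
by have := sqr_ge0 (hnorm (x w) - hnorm (y w)); lra.
Qed.

Lemma sqsumZ (a : R[i]) x m : sqsum (a *: x) m = modulus a ^+ 2 * sqsum x m.
Proof.
by rewrite /sqsum mulr_sumr; apply: eq_bigr => w _; rewrite hnormZ exprMn.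
Qed.

Fact wordL2_submod : submod_closed wordL2_pred.
Proof.
split.
  apply/asboolP; exists 0 => m; rewrite /sqsum big1// => w _.
  by rewrite (_ : (0 : word n -> K) w = 0)// hnorm0 expr0n.
move=> a x y /asboolP[M hM] /asboolP[N hN]; apply/asboolP.
exists (2 * (modulus a ^+ 2 * M) + 2 * N) => m.
rewrite (le_trans (sqsumD _ _ _))// sqsumZ.
by apply: lerD; rewrite ler_pM2l// ler_wpM2l ?sqr_ge0.
Qed.

Definition wordL2 : Type := {x : word n -> K | wordL2_pred x}.

HB.instance Definition _ :=
  GRing.isSubmodClosed.Build R[i] (word n -> K) wordL2_pred wordL2_submod.
HB.instance Definition _ := SubType.copy wordL2 {x : word n -> K | wordL2_pred x}.
HB.instance Definition _ := [Choice of wordL2 by <:].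
HB.instance Definition _ := [SubChoice_isSubLmodule of wordL2 by <:].

Implicit Types (u v : wordL2).

Definition wcoef u : word n -> K := val u.

Lemma wcoefP (a : R[i]) u v w : wcoef (a *: u + v) w = a *: wcoef u w + wcoef v w.
Proof. by []. Qed.

Lemma wcoef_inj u v : (forall w, wcoef u w = wcoef v w) -> u = v.
Proof. by move=> h; apply: val_inj; apply/funext. Qed.

Definition l2sq u : R := limn (sqsum (wcoef u)).

Lemma sqsum_cvg u : sqsum (wcoef u) m @[m --> \oo] --> l2sq u.
Proof.
apply: nondecreasing_is_cvgn; first exact: sqsum_homo.
by have /asboolP[M hM] := valP u; exists M => _ [m _ <-].
Qed.

Lemma sqsum_le u m : sqsum (wcoef u) m <= l2sq u.
Proof.
apply: nondecreasing_cvgn_le; first exact: sqsum_homo.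
by apply/cvg_ex; exists (l2sq u); exact: sqsum_cvg.
Qed.

Lemma l2sq_le u (M : R) : (forall m, sqsum (wcoef u) m <= M) -> l2sq u <= M.
Proof.
move=> h; have cM : (fun=> M) m @[m --> \oo] --> M by exact: cvg_cst.
by apply: (ler_cvg_to (@sqsum_cvg u) cM); apply: nearW.
Qed.

Lemma l2sq_ge0 u : 0 <= l2sq u.
Proof. exact: le_trans (sqsum_ge0 _ 0) (sqsum_le u 0). Qed.

Definition wdot_sum u v (m : nat) : R[i] :=
  \sum_(w <- words m) inner (wcoef u w) (wcoef v w).

(** The real inner product is defined by polarisation, so that the partial sums of
    [rinner] converge to it because those of the squared norms do. *)
Definition rdot u v : R := (l2sq (u + v) - l2sq u - l2sq v) / 2.

Lemma rdot_cvg u v :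
  \sum_(w <- words m) rinner (wcoef u w) (wcoef v w) @[m --> \oo] --> rdot u v.
Proof.
have -> : (fun m => \sum_(w <- words m) rinner (wcoef u w) (wcoef v w)) =
    (fun m => (sqsum (wcoef (u + v)) m - sqsum (wcoef u) m - sqsum (wcoef v) m) / 2).
  apply/funext => m; rewrite /sqsum -!sumrB mulr_suml; apply: eq_bigr => w _.
  have -> : wcoef (u + v) w = wcoef u w + wcoef v w by [].
  by rewrite hnorm2D; lra.
apply: cvgMr_tmp; apply: cvgB; last exact: sqsum_cvg.
by apply: cvgB; exact: sqsum_cvg.
Qed.

(** The inner product is conjugate linear in its second argument, whence
    [Im <u, v> = Re <u, 'i v>]. *)
Definition l2dot u v : R[i] := Complex (rdot u v) (rdot u ('i%C *: v)).

Lemma inner_rinner (x y : K) : inner x y = Complex (rinner x y) (rinner x ('i%C *: y)).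
Proof.
rewrite /rinner innerZr; case: (inner x y) => a b.
by congr Complex => /=; ring.
Qed.

Lemma Re_sum (I : Type) (s : seq I) (F : I -> R[i]) :
  complex.Re (\sum_(i <- s) F i) = \sum_(i <- s) complex.Re (F i).
Proof.
by elim: s => [|i s IH]; rewrite ?big_nil// !big_cons cReD IH.
Qed.

Lemma Im_sum (I : Type) (s : seq I) (F : I -> R[i]) :
  complex.Im (\sum_(i <- s) F i) = \sum_(i <- s) complex.Im (F i).
Proof.
elim: s => [|i s IH]; rewrite ?big_nil// !big_cons -IH.
by case: (F i) => a b; case: (bigop _ _ _).
Qed.

Lemma l2dot_cvg u v : ccvg (wdot_sum u v) (l2dot u v).
Proof.
split.
  under eq_fun do rewrite /wdot_sum Re_sum; exact: rdot_cvg.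
under eq_fun do rewrite /wdot_sum Im_sum.
under eq_fun do under eq_bigr do rewrite inner_rinner.
exact: rdot_cvg.
Qed.

Fact l2dot_linear (a : R[i]) u v (z : wordL2) : l2dot (a *: u + v) z = a * l2dot u z + l2dot v z.
Proof.
apply: ccvg_unique (l2dot_cvg _ _) _.
have -> : wdot_sum (a *: u + v) z = fun m => a * wdot_sum u z m + wdot_sum v z m.
  apply/funext => m; rewrite /wdot_sum mulr_sumr -big_split/=.
  by apply: eq_bigr => w _; rewrite -inner_linear.
exact: ccvg_axpy (l2dot_cvg _ _) (l2dot_cvg _ _).
Qed.

Fact l2dot_conj u v : l2dot v u = (l2dot u v)^*%R.
Proof.
apply: ccvg_unique (l2dot_cvg _ _) _.
have -> : wdot_sum v u = fun m => (wdot_sum u v m)^*%R.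
  apply/funext => m; rewrite /wdot_sum rmorph_sum/=.
  by apply: eq_bigr => w _; rewrite -inner_conj.
exact: ccvg_conj (l2dot_cvg _ _).
Qed.

Lemma l2dot_sq u : l2dot u u = (l2sq u)%:C%C.
Proof.
apply: ccvg_unique (l2dot_cvg _ _) _.
have -> : wdot_sum u u = fun m => (sqsum (wcoef u) m)%:C%C.
  apply/funext => m; rewrite /wdot_sum /sqsum rmorph_sum/=.
  by apply: eq_bigr => w _; rewrite inner_hnorm.
by split => /=; [exact: sqsum_cvg|exact: cvg_cst].
Qed.

Lemma l2sqZ (a : R[i]) u : l2sq (a *: u) = modulus a ^+ 2 * l2sq u.
Proof.
apply: (@cvg_unique _ (@norm_hausdorff _ R) _ _ _ _ (@sqsum_cvg (a *: u))).
rewrite (_ : sqsum (wcoef (a *: u)) = fun m => modulus a ^+ 2 * sqsum (wcoef u) m).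
  exact: cvgMl_tmp (@sqsum_cvg u).
by apply/funext => m; exact: sqsumZ.
Qed.

Lemma l2sqD u v : l2sq (u + v) = l2sq u + 2 * rdot u v + l2sq v.
Proof. by rewrite /rdot; lra. Qed.

Lemma hnorm_wcoef_le u w : hnorm (wcoef u w) ^+ 2 <= l2sq u.
Proof.
apply: le_trans (sqsum_le u (size w).+1).
by apply: (@big_words_le _ _ _ (fun w => hnorm (wcoef u w) ^+ 2)) => // v; exact: sqr_ge0.
Qed.

Lemma l2sq_eq0 u : l2sq u = 0 -> u = 0.
Proof.
move=> u0; apply: wcoef_inj => w; rewrite (_ : wcoef 0 w = 0)//.
apply/eqP; rewrite -hnorm_eq0 -sqrf_eq0 eq_le sqr_ge0 andbT -u0.
exact: hnorm_wcoef_le.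
Qed.

Lemma rdotC u v : rdot u v = rdot v u.
Proof. by rewrite /rdot [u + v]addrC addrAC. Qed.

Lemma rdotZr (t : R) u v : rdot u (t%:C%C *: v) = t * rdot u v.
Proof.
rewrite rdotC [in RHS]rdotC.
have l0 : l2dot 0 u = 0.
  have := l2dot_linear 1 0 0 u; rewrite scale1r mul1r addr0 => /eqP.
  by rewrite -subr_eq subrr eq_sym => /eqP.
have /(congr1 (@complex.Re R)) := l2dot_linear t%:C%C v 0 u.
rewrite addr0 l0 addr0. by rewrite cReM.
Qed.

(** The Cauchy-Schwarz inequality, which the triangle inequality requires before
    [wordL2] is known to be a Hilbert space. *)
Lemma rdot_le u v : rdot u v <= Num.sqrt (l2sq u) * Num.sqrt (l2sq v).
Proof.
set p := Num.sqrt (l2sq u); set q := Num.sqrt (l2sq v).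
have p2 : p ^+ 2 = l2sq u by rewrite sqr_sqrtr ?l2sq_ge0.
have q2 : q ^+ 2 = l2sq v by rewrite sqr_sqrtr ?l2sq_ge0.
have p0 : 0 <= p by exact: sqrtr_ge0.
have q0 : 0 <= q by exact: sqrtr_ge0.
have sq_lin (a b : R) : 0 <= a ^+ 2 * p ^+ 2 + 2 * (a * (b * rdot u v)) + b ^+ 2 * q ^+ 2.
  have := l2sq_ge0 (a%:C%C *: u + b%:C%C *: v).
  rewrite l2sqD rdotZr rdotC rdotZr rdotC !l2sqZ -p2 -q2.
  have mod2 (c : R) : modulus c%:C%C ^+ 2 = c ^+ 2.
    by rewrite /modulus normc_def /= expr0n addr0 sqr_sqrtr ?sqr_ge0.
  by rewrite !mod2 [b * (a * _)]mulrCA.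
have [pq0|pq0] := eqVneq (p * q) 0.
  rewrite pq0; have [p00|q00] : p = 0 \/ q = 0.
    by move/eqP: pq0; rewrite mulf_eq0 => /orP[] /eqP; [left|right].
    have -> : u = 0 by apply: l2sq_eq0; rewrite -p2 p00 expr0n.
    have := rdotZr 0 v 0; rewrite rmorph0 scale0r mul0r rdotC => ->//.
  have -> : v = 0 by apply: l2sq_eq0; rewrite -q2 q00 expr0n.
  by have := rdotZr 0 u 0; rewrite rmorph0 scale0r mul0r => ->.
have pq : 0 < p * q by rewrite lt_def pq0 mulr_ge0.
have := sq_lin q (- p); rewrite -(ler_pM2l pq) => h.
by rewrite -subr_ge0 -(pmulr_rge0 _ pq); nra.
Qed.

Definition l2norm u : R[i] := (Num.sqrt (l2sq u))%:C%C.

Fact l2normD u v : l2norm (u + v) <= l2norm u + l2norm v.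
Proof.
rewrite /l2norm -rmorphD/= lecR -(@ler_pXn2r _ 2) ?nnegrE ?addr_ge0 ?sqrtr_ge0//.
rewrite sqrrD !sqr_sqrtr ?l2sq_ge0// l2sqD lerD2r lerD2l.
by rewrite -[leRHS]mulr_natl ler_pM2l// rdot_le.
Qed.

Fact l2normZ (a : R[i]) u : l2norm (a *: u) = `|a| * l2norm u.
Proof.
rewrite /l2norm l2sqZ modulusE -rmorphM/= sqrtrM ?sqr_ge0// sqrtr_sqr.
by rewrite ger0_norm ?modulus_ge0.
Qed.

Fact l2norm_eq0 u : l2norm u = 0 -> u = 0.
Proof.
move=> /complexI/eqP; rewrite sqrtr_eq0 => h; apply: l2sq_eq0.
by apply/eqP; rewrite eq_le h l2sq_ge0.
Qed.

HB.instance Definition _ := Lmodule_isNormed.Build R[i] wordL2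
  l2normD l2normZ l2norm_eq0.

Lemma l2normE u : `|u| = l2norm u.
Proof. by []. Qed.

Lemma wcoef_norm_le u w : `|wcoef u w| <= `|u|.
Proof.
rewrite l2normE hnormE lecR -(@ler_pXn2r _ 2) ?nnegrE ?sqrtr_ge0 ?hnorm_ge0//.
by rewrite sqr_sqrtr ?l2sq_ge0// hnorm_wcoef_le.
Qed.

(** A Cauchy filter converges coefficientwise to some [l], and its estimates on finite
    sums of squares pass to the limit. *)
Fact wordL2_complete (F : set_system wordL2) : ProperFilter F -> cauchy F -> cvg F.
Proof.
move=> FF /cauchy_ballP Fc.
have ex_l w : exists l : K, (fun u => wcoef u w) @ F --> l.
  have G_proper : ProperFilter ((fun u => wcoef u w) @ F) by exact: fmap_proper_filter.
  suff /cauchy_cvg/cvg_ex[l Fl] : cauchy ((fun u => wcoef u w) @ F : set_system K) by exists l.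
  apply/cauchy_ballP => e e0; have [[P Q] /= [FP FQ] PQ] := Fc e e0.
  exists ((fun u => wcoef u w) @` P, (fun u => wcoef u w) @` Q) => /=.
    by split; [apply: filterS FP|apply: filterS FQ] => x ?; exists x.
  move=> [_ _] /= [[x Px <-] [y Qy <-]]; have /= := PQ (x, y) (conj Px Qy).
  rewrite -!ball_normE /ball_/=; apply: le_lt_trans.
  by rewrite -[_ - _]/(wcoef (x - y) w) wcoef_norm_le.
have [l Fl] := choice ex_l.
have near_l (e : R) : 0 < e -> exists2 P, F P & forall u, P u ->
    forall m, sqsum (wcoef u - l) m <= e ^+ 2.
  move=> e0; have [|[P Q] /= [FP FQ] PQ] := Fc e%:C%C; first by rewrite ltcR.
  exists P => // u Pu m.
  have cl : sqsum (wcoef u - wcoef v) m @[v --> F] --> sqsum (wcoef u - l) m.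
    apply: cvg_sumR => w; rewrite expr2; under eq_fun do rewrite expr2.
    have cw : hnorm ((wcoef u - wcoef v) w) @[v --> F] --> hnorm ((wcoef u - l) w).
      by apply: hnorm_cvg; apply: cvgB; [exact: cvg_cst|exact: Fl].
    exact: cvgM.
  have ce : (fun=> e ^+ 2) v @[v --> F] --> e ^+ 2 by exact: cvg_cst.
  apply: (ler_cvg_to cl ce); apply: filterS FQ => v Qv.
  have /= := PQ (u, v) (conj Pu Qv); rewrite -ball_normE /ball_/= l2normE ltcR => /ltW uv.
  rewrite -[_ - _]/(wcoef (u - v)) (le_trans (sqsum_le _ _))//.
  by rewrite -[leLHS]sqr_sqrtr ?l2sq_ge0// lerXn2r ?nnegrE ?sqrtr_ge0 ?(ltW e0).
have sqsumN x m : sqsum (- x) m = sqsum x m.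
  by apply: eq_bigr => w _; rewrite -[(- x) w]/(- x w) hnormN.
have sl : square_summable l.
  have [P FP hP] := near_l 1 ltr01; have [u Pu] := filter_ex FP.
  exists (2 * l2sq u + 2 * 1 ^+ 2) => m.
  have -> : l = wcoef u + - (wcoef u - l) by rewrite opprB addrC subrK.
  rewrite (le_trans (sqsumD _ _ _))// sqsumN lerD ?ler_pM2l ?hP//.
  exact: sqsum_le.
apply/cvg_ex; exists (Sub l (introT (asboolP _) sl) : wordL2).
apply/cvgrPdist_lt => e e0.
have er : e = (complex.Re e)%:C%C by rewrite RRe_real// gtr0_real.
have r0 : 0 < complex.Re e by rewrite -ltcR -er.
have [P FP hP] := near_l _ (divr_gt0 r0 (ltr0Sn R 1)).
apply: filterS FP => u Pu; rewrite l2normE er ltcR.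
apply: (@le_lt_trans _ _ (complex.Re e / 2)); last by rewrite ltr_pdivrMr// mulr_natr mulr2n ltrDl.
rewrite -(@ler_pXn2r _ 2) ?nnegrE ?sqrtr_ge0 ?divr_ge0 ?(ltW r0)//.
rewrite sqr_sqrtr ?l2sq_ge0//; apply: l2sq_le => m.
rewrite -sqsumN (_ : - wcoef _ = wcoef u - l) ?hP//.
by apply/funext => w; rewrite -[LHS]/(- (l w - wcoef u w)) opprB.
Qed.

HB.instance Definition _ := Uniform_isComplete.Build wordL2 wordL2_complete.

Fact l2dot_norm u : l2dot u u = `|u| ^+ 2.
Proof. by rewrite l2dot_sq l2normE /l2norm -rmorphXn/= sqr_sqrtr ?l2sq_ge0. Qed.

HB.instance Definition _ := NormedModule_isHilbert.Build R wordL2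
  l2dot_linear l2dot_conj l2dot_norm.

End WordL2.

Section ClosedSpan.
Context {R : realType} {H : hilbertType R} (S : set H).

Fact closed_span0 : closure (linear_span S) 0.
Proof.
apply: subset_closure; exists 0%N, (fun=> 0), (fun=> 0); split; first by case.
by rewrite big_ord0.
Qed.

Lemma linear_span_axpy (a : R[i]) x y :
  linear_span S x -> linear_span S y -> linear_span S (a *: x + y).
Proof.
move=> [m [c [v [hv ->]]]] [m' [c' [v' [hv' ->]]]].
exists (m + m')%N, (fun i : 'I_(m + m') => match fintype.split i with inl j => a * c j | inr j => c' j end),
  (fun i : 'I_(m + m') => match fintype.split i with inl j => v j | inr j => v' j end); split.
  by move=> i; case: (fintype.split i).
rewrite big_split_ord /= scaler_sumr; congr (_ + _); apply: eq_bigr => i _.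
  by rewrite (unsplitK (inl i)) scalerA.
by rewrite (unsplitK (inr i)).
Qed.

Fact closed_spanP (a : R[i]) x y : closure (linear_span S) x ->
  closure (linear_span S) y -> closure (linear_span S) (a *: x + y).
Proof.
move=> /closureP clx /closureP cly; apply/closureP => e e0.
have a1 : 0 < modulus a + 1 by rewrite ltr_wpDl ?modulus_ge0.
have e2 : 0 < e / 2 by rewrite divr_gt0.
have [x' Sx' xx'] := clx _ (divr_gt0 e2 a1); have [y' Sy' yy'] := cly _ e2.
exists (a *: x' + y'); first exact: linear_span_axpy.
rewrite opprD addrACA -scalerBr (le_lt_trans (hnormD _ _))// hnormZ (splitr e).
rewrite ltr_leD// ?(ltW yy')//; move: xx'; rewrite ltr_pdivlMr// => xx'.
by apply: le_lt_trans xx'; rewrite mulrC ler_wpM2l ?hnorm_ge0// lerDl.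
Qed.

Definition closed_span : closedSubspace H :=
  ClosedSubspace closed_span0 closed_spanP (@closed_closure _ (linear_span S)).

Lemma sub_closed_span : S `<=` subspace_set closed_span.
Proof.
move=> x Sx; apply: subset_closure; exists 1%N, (fun=> 1), (fun=> x); split => //.
by rewrite big_ord1 scale1r.
Qed.

(** Converse of [total_orthogonal]. *)
Lemma total_of_orthogonal :
  (forall y, (forall x, S x -> inner x y = 0) -> y = 0) -> total_set S.
Proof.
move=> h; apply/seteqP; split => // x _.
apply: (@mem_double_orthogonal _ _ closed_span) => u hu.
rewrite (_ : u = 0) ?inner0r//; apply: h => y /sub_closed_span /subspace_valP[y' <-].
by rewrite inner_conj hu conjC0.
Qed.

End ClosedSpan.

Section WordL2Theory.
Context {R : realType} {n : nat} {K : hilbertType R}.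
Implicit Types (u v : wordL2 n K) (k l : K) (w : word n).

Lemma hnorm_wordL2 u : hnorm u ^+ 2 = l2sq u.
Proof.
by rewrite hnorm2 /rinner -[inner u u]/(l2dot u u) l2dot_sq.
Qed.

Fact word_unit_summable w k : square_summable (fun w' : word n => if w' == w then k else 0).
Proof.
exists (hnorm k ^+ 2) => m; rewrite /sqsum (bigID (pred1 w))/= [X in _ + X]big1 ?addr0.
  rewrite -big_filter; have [wm|wm] := boolP (w \in words m).
    by rewrite filter_pred1_uniq ?words_uniq// big_seq1 eqxx.
  rewrite big_seq_cond big1 ?sqr_ge0// => v; rewrite mem_filter.
  by move=> /andP[/andP[/eqP -> wm']]; rewrite wm' in wm.
by move=> v /negbTE ->; rewrite hnorm0 expr0n.
Qed.

Definition word_unit w k : wordL2 n K :=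
  Sub (fun w' : word n => if w' == w then k else 0) (introT (asboolP _) (word_unit_summable w k)).

Lemma wcoef_unit w k w' : wcoef (word_unit w k) w' = if w' == w then k else 0.
Proof. by rewrite /wcoef SubK. Qed.

Lemma inner_word_unit u w k : inner u (word_unit w k) = inner (wcoef u w) k.
Proof.
apply: ccvg_unique (@l2dot_cvg _ _ _ u (word_unit w k)) _.
have const m : (size w < m)%N -> wdot_sum u (word_unit w k) m = inner (wcoef u w) k.
  move=> wm; rewrite /wdot_sum (bigD1_seq w) ?mem_words ?words_uniq//=.
  rewrite wcoef_unit eqxx big1 ?addr0// => v /negbTE vw.
  by rewrite wcoef_unit vw inner0r.
split; apply: cvg_near_cst; exists (size w).+1 => // m /= wm; rewrite const//.
Qed.

Lemma word_units_total : total_set [set word_unit w k | w in setT & k in setT].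
Proof.
apply: total_of_orthogonal => y h; apply: wcoef_inj => w.
apply: inner_extl => k; rewrite inner0l -inner_word_unit inner_conj h ?conjC0//.
by exists w => //; exists k.
Qed.

Lemma word_units_ext (L : hilbertType R) (A B : wordL2 n K -> L) :
  bounded_linear A -> bounded_linear B ->
  (forall w k, A (word_unit w k) = B (word_unit w k)) -> A = B.
Proof.
by move=> bA bB AB; apply: (total_ext word_units_total) => // _ [w _ [k _ <-]].
Qed.

Lemma sqsum_cons (x : word n -> K) m :
  sqsum x m.+1 = hnorm (x [::]) ^+ 2 + \sum_i sqsum (fun w => x (i :: w)) m.
Proof. by rewrite /sqsum big_words_cons. Qed.

Fact back_shift_summable (i : 'I_n) u : square_summable (fun w => wcoef u (i :: w)).
Proof.
exists (l2sq u) => m; apply: le_trans (sqsum_le u m.+1); rewrite sqsum_cons.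
rewrite (bigD1 i)//= addrCA lerDl addr_ge0 ?sqr_ge0// sumr_ge0// => j _.
exact: sqsum_ge0.
Qed.

Definition back_shift (i : 'I_n) u : wordL2 n K :=
  Sub (fun w => wcoef u (i :: w)) (introT (asboolP _) (back_shift_summable i u)).

Lemma wcoef_back_shift i u w : wcoef (back_shift i u) w = wcoef u (i :: w).
Proof. by rewrite /wcoef SubK. Qed.

Fact graft_summable k (v : 'I_n -> wordL2 n K) :
  square_summable (fun w => if w is i :: w' then wcoef (v i) w' else k).
Proof.
exists (hnorm k ^+ 2 + \sum_i l2sq (v i)) => m.
apply: le_trans (sqsum_homo _ (leqnSn m)) _; rewrite sqsum_cons lerD2l.
by apply: ler_sum => i _; exact: sqsum_le.
Qed.

(** The inverse of the decomposition of a family into its coefficient at the empty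
    word and its backward shifts. *)
Definition graft k (v : 'I_n -> wordL2 n K) : wordL2 n K :=
  Sub (fun w => if w is i :: w' then wcoef (v i) w' else k)
    (introT (asboolP _) (graft_summable k v)).

Lemma wcoef_graft k (v : 'I_n -> wordL2 n K) w :
  wcoef (graft k v) w = if w is i :: w' then wcoef (v i) w' else k.
Proof. by rewrite /wcoef SubK. Qed.

Lemma back_shift_graft i k (v : 'I_n -> wordL2 n K) : back_shift i (graft k v) = v i.
Proof. by apply: wcoef_inj => w; rewrite wcoef_back_shift wcoef_graft. Qed.

Lemma graft_back_shift u : graft (wcoef u [::]) (fun i => back_shift i u) = u.
Proof.
by apply: wcoef_inj => -[|i w]; rewrite wcoef_graft// wcoef_back_shift.
Qed.

Lemma hnorm_back_shift u :
  hnorm u ^+ 2 = hnorm (wcoef u [::]) ^+ 2 + \sum_i hnorm (back_shift i u) ^+ 2.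
Proof.
rewrite hnorm_wordL2; under eq_bigr do rewrite hnorm_wordL2.
suff h : sqsum (wcoef u) m @[m --> \oo] -->
    hnorm (wcoef u [::]) ^+ 2 + \sum_i l2sq (back_shift i u).
  exact: (@cvg_unique _ (@norm_hausdorff _ R) _ _ _ _ (@sqsum_cvg _ _ _ u) h).
rewrite -cvg_shiftS.
under eq_fun do rewrite sqsum_cons.
apply: cvgD; first exact: cvg_cst.
apply: cvg_sumR => i; rewrite (_ : (fun w => wcoef u (i :: w)) = wcoef (back_shift i u)).
  exact: sqsum_cvg.
by apply/funext => w; rewrite wcoef_back_shift.
Qed.

Lemma hnorm_graft k (v : 'I_n -> wordL2 n K) :
  hnorm (graft k v) ^+ 2 = hnorm k ^+ 2 + \sum_i hnorm (v i) ^+ 2.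
Proof.
rewrite hnorm_back_shift wcoef_graft.
by under eq_bigr do rewrite back_shift_graft.
Qed.

Lemma back_shift_hbound i : hbound 1 (back_shift i).
Proof.
split.
  by move=> a u v; apply: wcoef_inj => w; rewrite wcoefP !wcoef_back_shift wcoefP.
move=> u; rewrite mul1r -(@ler_pXn2r _ 2) ?nnegrE ?hnorm_ge0//.
rewrite (hnorm_back_shift u) (bigD1 i)//= addrCA lerDl addr_ge0 ?sqr_ge0//.
by apply: sumr_ge0 => j _; exact: sqr_ge0.
Qed.

Lemma back_shift_bounded i : bounded_linear (back_shift i).
Proof. exact: hbound_bounded (back_shift_hbound i). Qed.

Lemma back_shift_unit_nil i k : back_shift i (word_unit [::] k) = 0.
Proof. by apply: wcoef_inj => w; rewrite wcoef_back_shift wcoef_unit. Qed.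

Lemma back_shift_unit_cons i j w k :
  back_shift i (word_unit (j :: w) k) = if i == j then word_unit w k else 0.
Proof.
apply: wcoef_inj => v; rewrite wcoef_back_shift wcoef_unit eqseq_cons.
by case: (i == j); rewrite ?wcoef_unit.
Qed.

Lemma adjoint_back_shift_unit i w k :
  adjoint (back_shift i) (word_unit w k) = word_unit (i :: w) k.
Proof.
apply: inner_ext => u; rewrite -adjointP; last exact: back_shift_bounded.
by rewrite !inner_word_unit wcoef_back_shift.
Qed.

End WordL2Theory.

(** * Lifting of maps that commute with the backward shifts *)

Section Lifting.
Context {R : realType} {n : nat} {K1 K2 : hilbertType R}.
Local Notation L1 := (wordL2 n K1).
Local Notation L2 := (wordL2 n K2).

Definition shift_relation (M : R) (G : set (L2 * L1)) : Prop :=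
  [/\ linrel G, forall x w, G (x, w) -> hnorm w <= M * hnorm x &
    forall i x w, G (x, w) -> G (back_shift i x, back_shift i w)].

(** The backward shifts of [W1 x] are prescribed to be [W (back_shift i x)], so that
    [hnorm (W1 x) <= M * hnorm x] amounts to [hnorm k ^+ 2 <= q x] for the
    coefficient [k] of [W1 x] at the empty word, where [q x] is what
    [(M * hnorm x) ^+ 2] leaves once the shifts are accounted for. On the domain of
    [G] that coefficient is given and satisfies the bound, so [dominated_extension]
    applies. *)
Lemma shift_relation_one_step (M : R) (G : set (L2 * L1)) (W : L2 -> L1) :
  0 <= M -> shift_relation M G -> hbound M W -> (forall x w, G (x, w) -> W x = w) ->
  exists W1 : L2 -> L1, [/\ hbound M W1, forall x w, G (x, w) -> W1 x = w &
    forall i x, back_shift i (W1 x) = W (back_shift i x)].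
Proof.
move=> M0 [lG GM Gshift] [lW hW] GW.
have bs_lin (K : hilbertType R) i := (@back_shift_hbound R n K i).1.
pose q (x : L2) : R :=
  M ^+ 2 * hnorm x ^+ 2 - \sum_i hnorm (W (back_shift i x)) ^+ 2.
have qq : quadratic_form q.
  apply: quadraticB; first by apply: quadraticZ; exact: (@quadratic_hnorm _ _ _ id).
  by apply: quadratic_sum => i; apply: quadratic_hnorm; exact: (lin_comp lW (bs_lin _ i)).
have sum_le x : \sum_i hnorm (W (back_shift i x)) ^+ 2 <=
    M ^+ 2 * \sum_i hnorm (back_shift i x) ^+ 2.
  rewrite mulr_sumr; apply: ler_sum => i _; rewrite -exprMn.
  by rewrite lerXn2r ?nnegrE ?hnorm_ge0 ?mulr_ge0 ?hnorm_ge0.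
have q0 x : 0 <= q x.
  rewrite subr_ge0 (le_trans (sum_le x))// ler_wpM2l ?sqr_ge0//.
  by rewrite (hnorm_back_shift x) lerDr sqr_ge0.
pose G0 : set (L2 * K1) := [set p | exists2 w, G (p.1, w) & p.2 = wcoef w [::]].
have lG0 : linrel G0.
  split; first by exists 0 => //; exact: lG.1.
  move=> a x k y l [w Gw /= ->] [v Gv /= ->]; exists (a *: w + v) => //.
  exact: lG.2.
have G0q p : G0 p -> hnorm p.2 ^+ 2 <= q p.1.
  case: p => x k [w /= Gw ->]; rewrite lerBrDr.
  under eq_bigr => i _ do rewrite (GW _ _ (Gshift i _ _ Gw)).
  rewrite -hnorm_back_shift -exprMn.
  by rewrite lerXn2r ?nnegrE ?hnorm_ge0 ?mulr_ge0 ?hnorm_ge0 ?GM.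
have [D [lD hD GD]] := dominated_extension qq q0 lG0 G0q.
exists (fun x => graft (D x) (fun i => W (back_shift i x))); split.
- split.
    move=> a x y; apply: wcoef_inj => -[|i w]; rewrite wcoefP !wcoef_graft ?lD//.
    by rewrite bs_lin lW wcoefP.
  move=> x; rewrite -(@ler_pXn2r _ 2) ?nnegrE ?hnorm_ge0 ?mulr_ge0 ?hnorm_ge0//.
  by rewrite hnorm_graft exprMn -lerBrDr hD.
- move=> x w Gw; rewrite -(graft_back_shift w).
  have -> : D x = wcoef w [::] by apply: GD; exists w.
  congr graft; apply/funext => i; exact: GW (Gshift i _ _ Gw).
- by move=> i x; rewrite back_shift_graft.
Qed.

(** For a maximal [A] containing [G], [shift_relation_one_step] produces an operator
    whose restriction to the vectors with all backward shifts in the domain of [A]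
    is again a [shift_relation]; by maximality these vectors are in the domain. By
    induction on words the domain contains all [word_unit w k], and the commutation
    relation extends by density. *)
Theorem shift_lifting (M : R) (G : set (L2 * L1)) : 0 <= M -> shift_relation M G ->
  exists W : L2 -> L1, [/\ hbound M W, forall x w, G (x, w) -> W x = w &
    forall i x, W (back_shift i x) = back_shift i (W x)].
Proof.
move=> M0 shG.
have bs_lin (K : hilbertType R) i := (@back_shift_hbound R n K i).1.
have [|A [GA shA maxA]] := @zorn_above _ (shift_relation M) G shG.
  move=> F FP [A0 FA0] Ftot; split; last 2 first.
  - by move=> x w [A /FP[_ AM _] Ax]; exact: AM.
  - by move=> i x w [A FA Ax]; exists A => //; have [_ _] := FP _ FA; apply.
  split; first by exists A0 => //; have [[]] := FP _ FA0.
  move=> a x w y v [A FA Ax] [B FB By].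
  have [AB|BA] := Ftot _ _ FA FB.
    by exists B => //; have [[_ lB] _ _] := FP _ FB; apply: lB => //; exact: AB.
  by exists A => //; have [[_ lA] _ _] := FP _ FA; apply: lA => //; exact: BA.
have [lA AM Ashift] := shA.
have [W hW WA] := bounded_extension M0 lA AM.
have [W1 [hW1 W1A W1shift]] := shift_relation_one_step M0 shA hW WA.
(* the pairs [(x, W1 x)] such that [A] is defined at all [back_shift i x] *)
pose B : set (L2 * L1) := [set p | p.2 = W1 p.1 /\
  forall i, A (back_shift i p.1, W (back_shift i p.1))].
have AB : A `<=` B.
  move=> [x w] Ax; split => /= [|i]; first by rewrite (W1A _ _ Ax).
  by rewrite (WA _ _ (Ashift i _ _ Ax)); exact: Ashift.
have BA : B `<=` A.
  apply: maxA => //; split.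
  - split; first exact: AB lA.1.
    move=> a x w y v [/= -> hx] [/= -> hy]; split => [|i] /=; first by rewrite hW1.1.
    by rewrite bs_lin hW.1; exact: lA.2.
  - by move=> x w [/= -> _]; exact: hW1.2.
  - move=> i x w [/= -> hx]; apply: AB => /=.
    by rewrite W1shift; exact: hx.
have dom_unit w k : A (word_unit w k, W (word_unit w k)).
  suff [v Av] : exists v, A (word_unit w k, v) by rewrite (WA _ _ Av).
  elim: w => [|j w [v Av]].
    exists (W1 (word_unit [::] k)); apply: BA; split => // i /=.
    by rewrite back_shift_unit_nil (lin0 hW.1); exact: lA.1.
  exists (W1 (word_unit (j :: w) k)); apply: BA; split => // i /=.
  rewrite back_shift_unit_cons; case: eqP => _; first by rewrite (WA _ _ Av).
  by rewrite (lin0 hW.1); exact: lA.1.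
exists W; split => //; first by move=> x w /GA; exact: WA.
move=> i x.
suff : W \o back_shift i = back_shift i \o W by move/(congr1 (@^~ x)).
have bW := hbound_bounded hW.
apply: word_units_ext => [||w k /=].
- by apply: bounded_comp => //; exact: back_shift_bounded.
- by apply: bounded_comp => //; exact: back_shift_bounded.
- exact: WA (Ashift i _ _ (dom_unit w k)).
Qed.

End Lifting.

(** * The tensor product with a space that has a basis indexed by words *)

Section WordTensor.
Context {R : realType} {n : nat} {H : hilbertType R} (e : word n -> H).
Hypothesis e_basis : orthonormal_basis e.

Lemma inner_basis w v : inner (e w) (e v) = (w == v)%:R.
Proof. exact: e_basis.1. Qed.

Lemma basis_total : total_set (range e).
Proof. exact: e_basis.2. Qed.

Lemma basis_ext (K : hilbertType R) (A B : H -> K) : bounded_linear A ->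
  bounded_linear B -> (forall w, A (e w) = B (e w)) -> A = B.
Proof. by move=> bA bB AB; apply: (total_ext basis_total) => // _ [w _ <-]. Qed.

Lemma coef_inj x y : coef e x = coef e y -> x = y.
Proof.
move=> xy; apply/eqP; rewrite -subr_eq0; apply/eqP.
apply: (total_orthogonal basis_total) => _ [w _ <-].
rewrite innerBr (inner_conj x) (inner_conj y).
by have /(congr1 (@^~ w)) := xy; rewrite /coef => ->; rewrite subrr.
Qed.

Lemma coef_axpy (a : R[i]) x y w : coef e (a *: x + y) w = a * coef e x w + coef e y w.
Proof. exact: inner_linear. Qed.

Lemma bessel x (s : seq (word n)) : uniq s ->
  \sum_(w <- s) modulus (coef e x w) ^+ 2 <= hnorm x ^+ 2.
Proof.
move=> us; set y := \sum_(w <- s) coef e x w *: e w.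
have yx : rinner y x = \sum_(w <- s) modulus (coef e x w) ^+ 2.
  rewrite /rinner inner_suml -[RHS]/(complex.Re (\sum_(w <- s) modulus (coef e x w) ^+ 2)%:C%C).
  congr complex.Re; rewrite rmorph_sum; apply: eq_bigr => w _ /=.
  by rewrite innerZl rmorphXn/= -modulusE normCK (inner_conj x (e w)).
have yy : rinner y y = \sum_(w <- s) modulus (coef e x w) ^+ 2.
  rewrite /rinner inner_suml -[RHS]/(complex.Re (\sum_(w <- s) modulus (coef e x w) ^+ 2)%:C%C).
  congr complex.Re; rewrite rmorph_sum !big_seq; apply: eq_bigr => w ws /=.
  rewrite innerZl rmorphXn/= -modulusE normCK; congr (_ * _).
  rewrite inner_conj; congr (_^*)%R.
  rewrite inner_suml (bigD1_seq w)//= innerZl inner_basis eqxx mulr1 big1 ?addr0//.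
  by move=> v vw; rewrite innerZl inner_basis (negbTE vw) mulr0.
have := sqr_ge0 (hnorm (x - y)).
by rewrite hnorm2D hnormN (hnorm2 y) rinnerNr (rinnerC x) yx yy; lra.
Qed.

Context (K : hilbertType R).

Fact word_tensor_summable x (k : K) : square_summable (fun w => coef e x w *: k).
Proof.
exists (hnorm x ^+ 2 * hnorm k ^+ 2) => m; rewrite /sqsum.
under eq_bigr do rewrite hnormZ exprMn.
by rewrite -mulr_suml ler_wpM2r ?sqr_ge0// bessel// words_uniq.
Qed.

(** The coefficient of [x (x) k] at the basis vector [e w] is [<x, e w> k]. *)
Definition word_tensor (x : H) (k : K) : wordL2 n K :=
  Sub (fun w => coef e x w *: k) (introT (asboolP _) (word_tensor_summable x k)).

Lemma wcoef_tensor x k w : wcoef (word_tensor x k) w = coef e x w *: k.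
Proof. by rewrite /wcoef SubK. Qed.

Lemma word_tensor_basis w k : word_tensor (e w) k = word_unit w k.
Proof.
apply: wcoef_inj => v; rewrite wcoef_tensor wcoef_unit /coef inner_basis eq_sym.
by case: eqP; rewrite ?scale1r ?scale0r.
Qed.

Lemma word_tensor_linl k : is_lin (word_tensor ^~ k).
Proof.
move=> a x y; apply: wcoef_inj => w; rewrite wcoefP !wcoef_tensor coef_axpy.
by rewrite scalerDl scalerA.
Qed.

Lemma word_tensor_bounded k : bounded_linear (word_tensor ^~ k).
Proof.
apply: (@hbound_bounded _ _ _ (hnorm k)); split; first exact: word_tensor_linl.
move=> x; rewrite -(@ler_pXn2r _ 2) ?nnegrE ?hnorm_ge0 ?mulr_ge0 ?hnorm_ge0//.
rewrite hnorm_wordL2 exprMn mulrC; apply: l2sq_le => m.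
rewrite (_ : wcoef _ = fun w => coef e x w *: k); last by apply/funext => w; exact: wcoef_tensor.
rewrite /sqsum; under eq_bigr do rewrite hnormZ exprMn.
by rewrite -mulr_suml ler_wpM2r ?sqr_ge0// bessel// words_uniq.
Qed.

(** Instead of summing Parseval's series, the formula for inner products is read off
    from the identity of operators [T_l^* T_k = <k, l> I] with
    [T_k x = word_tensor x k], which need only be checked on basis vectors. *)
Theorem word_tensor_hilbert : hilbert_tensor word_tensor.
Proof.
split.
- by move=> a x y k; exact: word_tensor_linl.
- move=> a x k l; apply: wcoef_inj => w; rewrite wcoefP !wcoef_tensor.
  by rewrite scalerDr !scalerA mulrC.
- move=> x y k l.
  suff : adjoint (word_tensor ^~ l) \o word_tensor ^~ k = fun z => inner k l *: z.
    move/(congr1 (@^~ x)) => /= h.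
    by rewrite (adjointPr (word_tensor_bounded l)) h innerZl mulrC.
  apply: basis_ext.
  - apply: bounded_comp; last exact: word_tensor_bounded.
    exact/adjoint_bounded/word_tensor_bounded.
  - have := bounded_axpy (inner k l) (bounded_id H) (bounded0 H H).
    by under eq_fun do rewrite addr0.
  - move=> w /=; apply: inner_extl => z.
    rewrite -(adjointPr (word_tensor_bounded l)) word_tensor_basis inner_conj.
    rewrite inner_word_unit wcoef_tensor innerZl innerZl rmorphM/= -inner_conj mulrC.
    by rewrite -inner_conj.
- apply: total_of_orthogonal => y h.
  apply: (total_orthogonal word_units_total) => _ [w _ [k _ <-]].
  by apply: h; exists (e w) => //; exists k => //; exact: word_tensor_basis.
Qed.

End WordTensor.

(** * Creation operators and their commutants *)

Section FormalProducts.
Context {R : realType} {n : nat}.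
Implicit Types (p q r : fps R n) (w : word n).

Lemma fmul_nil p q : fmul p q [::] = p [::] * q [::].
Proof. by rewrite /fmul big_ord1. Qed.

Lemma fmul_cons p q i w :
  fmul p q (i :: w) = p [::] * q (i :: w) + fmul (fun v => p (i :: v)) q w.
Proof. by rewrite /fmul big_ord_recl take0 drop0. Qed.

Lemma fmul_rcons p q w i :
  fmul p q (rcons w i) = p (rcons w i) * q [::] + fmul p (fun v => q (rcons v i)) w.
Proof.
elim: w p => [|j w IH] p /=.
  by rewrite fmul_cons !fmul_nil addrC.
by rewrite !fmul_cons IH addrCA.
Qed.

Lemma fmul_axpyl (a : R[i]) p p' q w :
  fmul (fun v => a * p v + p' v) q w = a * fmul p q w + fmul p' q w.
Proof.
rewrite /fmul mulr_sumr -big_split/=; apply: eq_bigr => k _.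
by rewrite mulrDl mulrA.
Qed.

Lemma fmul_axpyr (a : R[i]) p q q' w :
  fmul p (fun v => a * q v + q' v) w = a * fmul p q w + fmul p q' w.
Proof.
rewrite /fmul mulr_sumr -big_split/=; apply: eq_bigr => k _.
by rewrite mulrDr mulrCA.
Qed.

Lemma fmul0l q : fmul (fun=> 0) q = fun=> 0.
Proof. by apply/funext => w; rewrite /fmul big1// => k _; rewrite mul0r. Qed.

Lemma fmul0r p : fmul p (fun=> 0) = fun=> 0.
Proof. by apply/funext => w; rewrite /fmul big1// => k _; rewrite mulr0. Qed.

Lemma fmul_suml (I : Type) (s : seq I) (F : I -> fps R n) q w :
  fmul (fun v => \sum_(i <- s) F i v) q w = \sum_(i <- s) fmul (F i) q w.
Proof.
rewrite /fmul exchange_big /=; apply: eq_bigr => k _; exact: mulr_suml.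
Qed.

Lemma fmulA p q r : fmul p (fmul q r) = fmul (fmul p q) r.
Proof.
apply/funext => w; elim: w p => [|i w IH] p; first by rewrite !fmul_nil mulrA.
rewrite !fmul_cons fmul_nil IH.
rewrite (_ : (fun v => fmul p q (i :: v)) =
    fun v => p [::] * q (i :: v) + fmul (fun v => p (i :: v)) q v); last first.
  by apply/funext => v; rewrite fmul_cons.
by rewrite fmul_axpyl mulrDr addrA mulrA.
Qed.

Lemma fmul1l q : fmul (fone (R := R)) q = q.
Proof.
apply/funext => -[|i w]; first by rewrite fmul_nil /fone eqxx mul1r.
by rewrite fmul_cons /fone eqxx mul1r -[X in fmul X]/(fun=> 0) fmul0l addr0.
Qed.

Lemma fmul1r p : fmul p (fone (R := R)) = p.
Proof.
apply/funext => w; case/lastP: w => [|w i]; first by rewrite fmul_nil /fone eqxx mulr1.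
rewrite fmul_rcons /fone eqxx mulr1.
rewrite (_ : (fun v => _) = fun=> 0) ?fmul0r ?addr0//.
by apply/funext => v; case: v.
Qed.

End FormalProducts.

Section Creation.
Context {R : realType} {n : nat} {H : hilbertType R} (e : word n -> H).
Hypothesis e_basis : orthonormal_basis e.
Let inner_e := inner_basis e_basis.

Lemma inner_total_ext u v : (forall w, inner (e w) u = inner (e w) v) -> u = v.
Proof.
move=> uv; apply/eqP; rewrite -subr_eq0; apply/eqP.
by apply: (total_orthogonal (basis_total e_basis)) => _ [w _ <-]; rewrite innerBr uv subrr.
Qed.

Definition reindex_op (s : word n -> word n) : H -> H :=
  xget (fun=> 0) [set S | hbound 1 S /\ forall w, S (e w) = e (s w)].

Lemma reindex_spec s : injective s ->
  hbound 1 (reindex_op s) /\ forall w, reindex_op s (e w) = e (s w).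
Proof.
move=> sI; suff [S hS Se] : exists2 S, hbound 1 S & forall w, S (e w) = e (s w).
  by rewrite /reindex_op; case: xgetP => [T _ //|/(_ S)[]].
pose F (l : seq (R[i] * word n)) f : H := \sum_(p <- l) p.1 *: f p.2.
have [||_ _ [l [-> ->]]|S hS SG] := @bounded_extension _ H H 1
  [set p | exists l, p = (F l e, F l (e \o s))].
- by [].
- split; first by exists [::]; rewrite /F !big_nil.
  move=> a _ _ _ _ [l [-> ->]] [l' [-> ->]].
  exists ([seq (a * p.1, p.2) | p <- l] ++ l').
  rewrite /F !big_cat !big_map !scaler_sumr /=.
  by congr (_ + _, _ + _); apply: eq_bigr => p _; rewrite scalerA.
- rewrite mul1r -(@ler_pXn2r _ 2) ?nnegrE ?hnorm_ge0// !hnorm2 /rinner.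
  rewrite !inner_suml le_eqVlt; apply/orP; left; apply/eqP; congr complex.Re.
  apply: eq_bigr => p _; rewrite !inner_sumr; apply: eq_bigr => p' _.
  by rewrite !innerZl !innerZr /= !inner_e (inj_eq sI).
exists S => // w; apply: SG; exists [:: (1, w)].
by rewrite /F !big_seq1 !scale1r.
Qed.

Definition left_creation (j : 'I_n) : H -> H := reindex_op (cons j).
Definition right_creation (j : 'I_n) : H -> H := reindex_op (rcons^~ j).

Lemma left_creation_bounded j : bounded_linear (left_creation j).
Proof. by have [|h _] := @reindex_spec (cons j); [move=> ? ? []|exact: hbound_bounded h]. Qed.

Lemma left_creationE j w : left_creation j (e w) = e (j :: w).
Proof. by have [|_] := @reindex_spec (cons j); [move=> ? ? []|exact]. Qed.

Lemma right_creation_bounded j : bounded_linear (right_creation j).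
Proof.
by have [|h _] := @reindex_spec (rcons^~ j); [move=> ? ? /rcons_inj[]|exact: hbound_bounded h].
Qed.

Lemma right_creationE j w : right_creation j (e w) = e (rcons w j).
Proof. by have [|_] := @reindex_spec (rcons^~ j); [move=> ? ? /rcons_inj[]|exact]. Qed.

Lemma adjoint_left_creation_nil j : adjoint (left_creation j) (e [::]) = 0.
Proof.
apply: inner_total_ext => w; rewrite -adjointP; last exact: left_creation_bounded.
by rewrite left_creationE inner_e inner0r.
Qed.

Lemma adjoint_left_creation_cons j i w :
  adjoint (left_creation j) (e (i :: w)) = (i == j)%:R *: e w.
Proof.
apply: inner_total_ext => v; rewrite -adjointP; last exact: left_creation_bounded.
rewrite left_creationE innerZr !inner_e eqseq_cons (eq_sym j).
by rewrite conjC_nat -natrM mulnb.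
Qed.

Lemma adjoint_right_creation_nil j : adjoint (right_creation j) (e [::]) = 0.
Proof.
apply: inner_total_ext => w; rewrite -adjointP; last exact: right_creation_bounded.
by rewrite right_creationE inner_e inner0r; case: w.
Qed.

Lemma adjoint_right_creation_rcons j i w :
  adjoint (right_creation j) (e (rcons w i)) = (i == j)%:R *: e w.
Proof.
apply: inner_total_ext => v; rewrite -adjointP; last exact: right_creation_bounded.
rewrite right_creationE innerZr !inner_e eqseq_rcons andbC (eq_sym j).
by rewrite conjC_nat -natrM mulnb.
Qed.

Lemma coef_left_creation j x w :
  coef e (left_creation j x) w =
  if w is i :: w' then (i == j)%:R * coef e x w' else 0.
Proof.
rewrite /coef adjointP; last exact: left_creation_bounded.
case: w => [|i w]; first by rewrite adjoint_left_creation_nil inner0r.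
by rewrite adjoint_left_creation_cons innerZr conjC_nat.
Qed.

Lemma coef_right_creation_nil j x : coef e (right_creation j x) [::] = 0.
Proof.
rewrite /coef adjointP; last exact: right_creation_bounded.
by rewrite adjoint_right_creation_nil inner0r.
Qed.

Lemma coef_right_creation_rcons j x w i :
  coef e (right_creation j x) (rcons w i) = (i == j)%:R * coef e x w.
Proof.
rewrite /coef adjointP; last exact: right_creation_bounded.
by rewrite adjoint_right_creation_rcons innerZr conjC_nat.
Qed.

Lemma coef_basis v w : coef e (e v) w = (v == w)%:R.
Proof. exact: inner_e. Qed.

(** Both sides are continuous in [x]; on [e v] the identity follows by induction on
    [v], as right creation operators build [e v] from [e [::]]. *)
Lemma right_commutant_fmul (A : H -> H) : bounded_linear A ->
  (forall j x, A (right_creation j x) = right_creation j (A x)) ->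
  forall x, coef e (A x) = fmul (coef e (A (e [::]))) (coef e x).
Proof.
move=> bA Acomm x; apply/funext => w; set a := coef e (A (e [::])).
pose u := \sum_(k < (size w).+1) (a (take k w))^* *: e (drop k w).
have uE y : fmul a (coef e y) w = inner y u.
  rewrite inner_sumr; apply: eq_bigr => k _.
  by rewrite innerZr conjCK.
rewrite uE /coef adjointP//; congr inner; apply: inner_total_ext => v.
rewrite -uE -adjointP// -/(coef e _ w).
elim/last_ind: v w {u uE} => [|v j IH] w.
  rewrite -/a (_ : coef e (e [::]) = fone (R := R)) ?fmul1r//.
  by apply/funext => v; rewrite coef_basis eq_sym.
rewrite -right_creationE Acomm; case/lastP: w => [|w i].
  by rewrite coef_right_creation_nil fmul_nil coef_right_creation_nil mulr0.
rewrite coef_right_creation_rcons fmul_rcons coef_right_creation_nil mulr0 add0r.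
rewrite IH (_ : (fun _ => _) = fun w => (i == j)%:R * coef e (e v) w + 0).
  by rewrite (fmul_axpyr _ _ _ (fun=> 0)) fmul0r addr0.
by apply/funext => ?; rewrite coef_right_creation_rcons addr0.
Qed.

Lemma left_commutant_fmul (A : H -> H) : bounded_linear A ->
  (forall j x, A (left_creation j x) = left_creation j (A x)) ->
  forall x, coef e (A x) = fmul (coef e x) (coef e (A (e [::]))).
Proof.
move=> bA Acomm x; apply/funext => w; set a := coef e (A (e [::])).
pose u := \sum_(k < (size w).+1) (a (drop k w))^* *: e (take k w).
have uE y : fmul (coef e y) a w = inner y u.
  rewrite inner_sumr; apply: eq_bigr => k _.
  by rewrite innerZr conjCK mulrC.
rewrite uE /coef adjointP//; congr inner; apply: inner_total_ext => v.
rewrite -uE -adjointP// -/(coef e _ w).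
elim: v w {u uE} => [|j v IH] w.
  rewrite -/a (_ : coef e (e [::]) = fone (R := R)) ?fmul1l//.
  by apply/funext => v; rewrite coef_basis eq_sym.
rewrite -left_creationE Acomm; case: w => [|i w].
  by rewrite fmul_nil !coef_left_creation mul0r.
rewrite fmul_cons !coef_left_creation mul0r add0r.
rewrite IH (_ : (fun _ => _) = fun w => (i == j)%:R * coef e (e v) w + 0).
  by rewrite (fmul_axpyl _ _ (fun=> 0)) fmul0l addr0.
by apply/funext => ?; rewrite coef_left_creation addr0.
Qed.

(** In terms of coefficients [A] multiplies by a series on the left and [B] on the
    right. *)
Theorem commutants_commute (A B : H -> H) : bounded_linear A -> bounded_linear B ->
  (forall j x, A (right_creation j x) = right_creation j (A x)) ->
  (forall j x, B (left_creation j x) = left_creation j (B x)) ->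
  forall x, A (B x) = B (A x).
Proof.
move=> bA bB Acomm Bcomm x; apply: (coef_inj e_basis).
rewrite (right_commutant_fmul bA Acomm) (left_commutant_fmul bB Bcomm x).
by rewrite (left_commutant_fmul bB Bcomm (A x)) (right_commutant_fmul bA Acomm x) fmulA.
Qed.

(** For fixed [k] and [l] the operator [g x = (t2 ^~ l)^* (G (t1 x k))] on [H] is a
    matrix entry of [G]; it commutes with the left creation operators, hence with
    [A], and the matrix entries determine [G]. *)
Theorem slice_commutant (K1 K2 : hilbertType R) (T1 T2 : hilbertType R)
  (t1 : H -> K1 -> T1) (t2 : H -> K2 -> T2) (G : T1 -> T2) (A : H -> H) :
  hilbert_tensor t1 -> hilbert_tensor t2 -> bounded_linear G -> bounded_linear A ->
  (forall j u, G (amp t1 t1 (left_creation j) u) = amp t2 t2 (left_creation j) (G u)) ->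
  (forall j x, A (right_creation j x) = right_creation j (A x)) ->
  forall u, G (amp t1 t1 A u) = amp t2 t2 A (G u).
Proof.
move=> ht1 ht2 bG bA Gcomm Acomm u.
suff : G \o amp t1 t1 A = amp t2 t2 A \o G by move/(congr1 (@^~ u)).
apply: (tensor_ext ht1).
- by apply: bounded_comp => //; exact: amp_bounded.
- by apply: bounded_comp => //; exact: amp_bounded.
move=> x k /=.
suff slices l : adjoint (t2 ^~ l) (G (amp t1 t1 A (t1 x k))) =
                adjoint (t2 ^~ l) (amp t2 t2 A (G (t1 x k))).
  apply/eqP; rewrite -subr_eq0; apply/eqP.
  apply: (total_orthogonal (tensor_total ht2)) => _ [y _ [l _ <-]].
  rewrite innerBr !(inner_conj _ (t2 y l)) -!inner_conj.
  rewrite (adjointP (tensor_bounded ht2 l)) (adjointP (tensor_bounded ht2 l)) slices.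
  by rewrite subrr.
rewrite ampE// slice_intertwine//.
pose g x := adjoint (t2 ^~ l) (G (t1 x k)).
have bg : bounded_linear g.
  apply: (bounded_comp (adjoint_bounded (tensor_bounded ht2 l))).
  exact: (bounded_comp bG (tensor_bounded ht1 k)).
rewrite -[LHS]/(g (A x)) -[RHS]/(A (g x)).
symmetry; apply: commutants_commute => // j y.
rewrite /g -(ampE ht1 ht1)// ?Gcomm ?slice_intertwine//; exact: left_creation_bounded.
Qed.

End Creation.

(** * Composition of formal power series *)

Section Composition.
Context {R : realType} {n : nat}.
Implicit Types (p q r c : fps R n) (f : 'I_n -> fps R n) (v w : word n).

(** The monomial [Z_w]. *)
Definition fdelta w : fps R n := fun v => (w == v)%:R.

Definition degree_lt m p : Prop := forall w, (m <= size w)%N -> p w = 0.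

Lemma polynomialP p : polynomial p <-> exists m, degree_lt m p.
Proof.
split=> [/finite_seqP[s ps]|[m pm]].
  exists (\max_(w <- s) size w).+1 => w; rewrite ltnNge => /negP hw.
  apply/eqP; apply: contra_notT hw => pw.
  have ws : w \in s by have : [set` s] w by rewrite -ps.
  by rewrite (@leq_bigmax_seq _ _ xpredT size).
apply: (@sub_finite_set _ _ [set` words m]); last exact: finite_seq.
move=> w /= pw; rewrite mem_words ltnNge; apply: contra pw => /pm ->.
exact: eqxx.
Qed.

(** Every coefficient of [fsubst c f] is then a finite sum over short words. This
    holds when [c] is a polynomial and when the constant terms of [f] vanish. *)
Definition composable c f : Prop :=
  forall v, exists m, forall w, (m <= size w)%N -> c w * fword f w v = 0.

Lemma degree_composable m c f : degree_lt m c -> composable c f.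
Proof. by move=> cm v; exists m => w /cm ->; rewrite mul0r. Qed.

Lemma polynomial_composable c f : polynomial c -> composable c f.
Proof. by move=> /polynomialP[m]; exact: degree_composable. Qed.

Lemma fword_low_degree f : (forall i, f i [::] = 0) ->
  forall w v, (size v < size w)%N -> fword f w v = 0.
Proof.
move=> f0; elim=> [//|i w IH] v /= vw; rewrite /fmul big1// => k _.
case: (posnP k) => [->|k0]; first by rewrite take0 f0 mul0r.
have v0 : (0 < size v)%N by rewrite (leq_trans k0)// -ltnS ltn_ord.
by rewrite IH ?mulr0// size_drop (leq_trans _ (vw : (size v <= size w)%N))// ltn_subrL k0.
Qed.

Lemma zero_composable f c : (forall i, f i [::] = 0) -> composable c f.
Proof.
by move=> f0 v; exists (size v).+1 => w vw; rewrite fword_low_degree ?mulr0.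
Qed.

Lemma fsubstE c f v m : (forall w, (m <= size w)%N -> c w * fword f w v = 0) ->
  fsubst c f v = \sum_(w <- words m) c w * fword f w v.
Proof.
move=> h; rewrite /fsubst (fsbigE (words m)) ?words_uniq//.
  by rewrite big_mkcond; apply: eq_bigr => w _; rewrite in_setT.
by move=> w _; rewrite mem_words -leqNgt; exact: h.
Qed.

Lemma fsubst_degree c f m v : degree_lt m c ->
  fsubst c f v = \sum_(w <- words m) c w * fword f w v.
Proof. by move=> cm; apply: fsubstE => w /cm ->; rewrite mul0r. Qed.

Lemma fsubst_zeroE f c v m : (forall i, f i [::] = 0) -> (size v < m)%N ->
  fsubst c f v = \sum_(w <- words m) c w * fword f w v.
Proof.
move=> f0 vm; apply: fsubstE => w mw.
by rewrite fword_low_degree ?mulr0// (leq_trans vm).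
Qed.

Lemma fsubst_axpy (a : R[i]) c c' f v : composable c f -> composable c' f ->
  fsubst (fun w => a * c w + c' w) f v = a * fsubst c f v + fsubst c' f v.
Proof.
move=> /(_ v)[m hm] /(_ v)[m' hm'].
have hM w : (maxn m m' <= size w)%N -> c w * fword f w v = 0.
  by rewrite geq_max => /andP[/hm].
have hM' w : (maxn m m' <= size w)%N -> c' w * fword f w v = 0.
  by rewrite geq_max => /andP[_ /hm'].
rewrite (fsubstE hM) (fsubstE hM') (@fsubstE _ _ _ (maxn m m')); last first.
  by move=> w hw; rewrite mulrDl -mulrA hM// hM'// mulr0 addr0.
rewrite mulr_sumr -big_split/=; apply: eq_bigr => w _.
by rewrite mulrDl mulrA.
Qed.

Lemma fsubst0 f : fsubst (fun=> 0) f = fun=> 0.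
Proof.
apply/funext => v; rewrite (@fsubst_degree _ _ 0)//.
by rewrite /= big_nil.
Qed.

Lemma composable_common c f (s : seq (word n)) : composable c f ->
  exists m, forall v w, v \in s -> (m <= size w)%N -> c w * fword f w v = 0.
Proof.
move=> cf; elim: s => [|v s [m hm]]; first by exists 0%N.
have [m' hm'] := cf v; exists (maxn m m') => u w; rewrite inE geq_max.
by move=> /orP[/eqP -> /andP[_ /hm']|us /andP[mw _]]//; exact: hm mw.
Qed.

(** The series [Z_j c]. *)
Definition fcons (j : 'I_n) c : fps R n :=
  fun w => if w is i :: w' then (i == j)%:R * c w' else 0.

Lemma fsubst_cons f j c : composable c f -> composable (fcons j c) f ->
  fsubst (fcons j c) f = fmul (f j) (fsubst c f).
Proof.
move=> cf c'f; apply/funext => v.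
have [m hm] := composable_common [seq drop k v | k <- iota 0 (size v).+1] cf.
have [m' hm'] := c'f v; pose M := maxn m m'.
have hM (k : 'I_(size v).+1) w : (M <= size w)%N -> c w * fword f w (drop k v) = 0.
  rewrite geq_max => /andP[mw _]; apply: hm mw.
  by apply: (map_f (drop^~ v)); rewrite mem_iota leq0n add0n ltn_ord.
rewrite (@fsubstE _ _ _ M.+1); last first.
  by move=> w hw; apply: hm'; rewrite (leq_trans (leq_maxr m m'))// ltnW.
rewrite big_words_cons /= mul0r add0r (bigD1 j)//= [X in _ + X]big1 ?addr0; last first.
  by move=> i /negbTE ij; rewrite big1// => w _; rewrite ij !mul0r.
rewrite [RHS]/fmul; under [RHS]eq_bigr do rewrite (fsubstE (hM _)) mulr_sumr.
rewrite exchange_big /=; apply: eq_bigr => w _.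
rewrite eqxx mul1r /fmul mulr_sumr; apply: eq_bigr => k _.
by rewrite mulrCA.
Qed.

Lemma fword_rcons f w j : fword f (rcons w j) = fmul (fword f w) (f j).
Proof.
elim: w => [|i w IH] /=; first by rewrite fmul1r fmul1l.
by rewrite IH fmulA.
Qed.

Lemma fsubst_rcons f j c c' : c' [::] = 0 ->
  (forall w i, c' (rcons w i) = (i == j)%:R * c w) ->
  composable c f -> composable c' f -> fsubst c' f = fmul (fsubst c f) (f j).
Proof.
move=> c'0 c'r cf c'f; apply/funext => v.
have [m hm] := composable_common [seq take k v | k <- iota 0 (size v).+1] cf.
have [m' hm'] := c'f v; pose M := maxn m m'.
have hM (k : 'I_(size v).+1) w : (M <= size w)%N -> c w * fword f w (take k v) = 0.
  rewrite geq_max => /andP[mw _]; apply: hm mw.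
  by apply: (map_f (take^~ v)); rewrite mem_iota leq0n add0n ltn_ord.
rewrite (@fsubstE _ _ _ M.+1); last first.
  by move=> w hw; apply: hm'; rewrite (leq_trans (leq_maxr m m'))// ltnW.
rewrite big_words_rcons /= c'0 mul0r add0r (bigD1 j)//= [X in _ + X]big1 ?addr0; last first.
  by move=> i /negbTE ij; rewrite big1// => w _; rewrite c'r ij !mul0r.
rewrite [RHS]/fmul; under [RHS]eq_bigr do rewrite (fsubstE (hM _)) mulr_suml.
rewrite exchange_big /=; apply: eq_bigr => w _.
rewrite c'r eqxx mul1r fword_rcons /fmul mulr_sumr; apply: eq_bigr => k _.
by rewrite mulrA.
Qed.

Lemma fsubst_delta f w : fsubst (fdelta w) f = fword f w.
Proof.
apply/funext => v; rewrite (@fsubst_degree _ _ (size w).+1); last first.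
  by move=> u uw; rewrite /fdelta; case: eqP => // wu; rewrite wu ltnn in uw.
rewrite (bigD1_seq w) ?mem_words ?words_uniq//= /fdelta eqxx mul1r big1 ?addr0// => u uw.
by rewrite eq_sym (negbTE uw) mul0r.
Qed.

(** Write [c = c_0 + \sum_i Z_i c_i], so that
    [c o f = c_0 + \sum_i f_i (c_i o f)] with [c_0] the constant term. If this is 0,
    then [c_0 = 0], and [c_i o f = 0] for all [i]: the coefficient at [j :: v] of
    [\sum_i f_i g_i] is [\sum_i f_i [:: j] g_i v] plus terms with coefficients of [g_i]
    at shorter words, and the matrix of the [f_i [:: j]] is invertible. So all
    coefficients of [c] vanish, by induction on words. *)
Lemma fsubst_inj0 f c : (forall i, f i [::] = 0) ->
  \det (\matrix_(i, j) f i [:: j]) != 0 ->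
  fsubst c f = (fun=> 0) -> c = fun=> 0.
Proof.
move=> f0 detf.
pose A := \matrix_(i, j) f i [:: j].
have Ainv (x : 'I_n -> R[i]) : (forall j, \sum_i x i * f i [:: j] = 0) -> forall i, x i = 0.
  move=> h i; have unitA : A \in unitmx by rewrite unitmxE unitfE.
  have : (\row_k x k) *m A = 0.
    by apply/rowP => j; rewrite !mxE -[RHS](h j); apply: eq_bigr => k _; rewrite !mxE.
  move/(congr1 (mulmx^~ (invmx A))); rewrite mulmxK// mul0mx.
  by move=> /rowP/(_ i); rewrite !mxE.
have comp c' : composable c' f by exact: zero_composable.
have rec c' : fsubst c' f = (fun=> 0) -> c' [::] = 0 /\
    forall i, fsubst (fun w => c' (i :: w)) f = fun=> 0.
  move=> h.
  have c'0 : c' [::] = 0.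
    have := congr1 (@^~ [::]) h; rewrite (@fsubst_zeroE _ _ _ 1)//.
    rewrite big_words_cons /= {1}/fone eqxx mulr1 big1 ?addr0// => i _.
    by rewrite big_nil.
  split=> //; pose g i := fsubst (fun w => c' (i :: w)) f.
  have sumE v : \sum_i fmul (f i) (g i) v = 0.
    rewrite -[RHS](congr1 (@^~ v) h) (@fsubst_zeroE _ _ _ (size v).+2)//.
    rewrite big_words_cons /= c'0 mul0r add0r; apply: eq_bigr => i _.
    have gE k : g i (drop k v) =
        \sum_(w <- words (size v).+1) c' (i :: w) * fword f w (drop k v).
      by apply: fsubst_zeroE => //; rewrite ltnS size_drop leq_subr.
    rewrite /fmul; under [LHS]eq_bigr do rewrite gE mulr_sumr.
    rewrite exchange_big /=; apply: eq_bigr => w _.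
    by rewrite mulr_sumr; apply: eq_bigr => k _; rewrite mulrCA.
  suff main s v : (size v < s)%N -> forall i, g i v = 0.
    by move=> i; apply/funext => v; exact: (main (size v).+1).
  elim: s v => [//|s IH] v vs; apply: Ainv => j.
  rewrite -[RHS](sumE (j :: v)); apply: eq_bigr => i _.
  rewrite fmul_cons (f0 i) mul0r add0r [RHS]/fmul big_ord_recl /= take0 drop0.
  rewrite [X in _ = _ + X]big1; first by rewrite addr0 mulrC.
  move=> k _; rewrite IH ?mulr0// size_drop /bump leq0n add1n.
  have v0 : (0 < size v)%N by rewrite (leq_trans _ (ltn_ord k)).
  by rewrite (leq_trans _ (vs : (size v <= s)%N))// ltn_subrL v0.
move=> h; apply/funext => w; elim: w c h => [|i w IH] c h; have [c0 ci] := rec c h => //.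
exact: (IH _ (ci i)).
Qed.

End Composition.

Section PolynomialComposition.
Context {R : realType} {n : nat}.
Implicit Types (p q r c : fps R n) (f : 'I_n -> fps R n) (v w : word n).

Lemma fmul_fvar i r : fmul (fvar i) r = fcons i r.
Proof.
apply/funext => -[|j w]; first by rewrite fmul_nil mul0r.
rewrite fmul_cons mul0r add0r /=.
rewrite (_ : (fun v => _) = fun v => (j == i)%:R * fone v + 0); last first.
  by apply/funext => v; rewrite /fvar /fone eqseq_cons -natrM mulnb addr0.
by rewrite (fmul_axpyl _ _ (fun=> 0)) fmul0l addr0 fmul1l.
Qed.

Lemma fcons_delta i w : fcons i (fdelta w) = fdelta (i :: w) :> fps R n.
Proof.
apply/funext => -[|j v] //=.
by rewrite /fdelta eqseq_cons -natrM mulnb (eq_sym i).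
Qed.

Lemma fmul_delta_cons i w r : fmul (fdelta (i :: w)) r = fcons i (fmul (fdelta w) r).
Proof. by rewrite -fcons_delta -fmul_fvar -fmulA fmul_fvar. Qed.

Lemma polynomial_axpy (a : R[i]) p q : polynomial p -> polynomial q ->
  polynomial (fun w => a * p w + q w).
Proof.
move=> /polynomialP[m pm] /polynomialP[m' qm]; apply/polynomialP.
exists (maxn m m') => w; rewrite geq_max => /andP[mw m'w].
by rewrite pm// qm// mulr0 addr0.
Qed.

Lemma polynomial0 : polynomial ((fun=> 0) : fps R n).
Proof. by apply/polynomialP; exists 0%N. Qed.

Lemma polynomial_sum (I : Type) (s : seq I) (a : I -> R[i]) (F : I -> fps R n) :
  (forall x, polynomial (F x)) -> polynomial (fun v => \sum_(x <- s) a x * F x v).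
Proof.
move=> pF; elim: s => [|x s IH].
  by under eq_fun do rewrite big_nil; exact: polynomial0.
by under eq_fun do rewrite big_cons; exact: polynomial_axpy.
Qed.

Lemma polynomial_fcons i p : polynomial p -> polynomial (fcons i p).
Proof.
move=> /polynomialP[m pm]; apply/polynomialP; exists m.+1 => -[//|j w] mw /=.
by rewrite pm ?mulr0.
Qed.

Lemma polynomial_delta w : polynomial (fdelta w : fps R n).
Proof.
apply/polynomialP; exists (size w).+1 => v; rewrite /fdelta.
by case: eqP => // ->; rewrite ltnn.
Qed.

Lemma polynomial_delta_fmul w r : polynomial r -> polynomial (fmul (fdelta w) r).
Proof.
move=> pr; elim: w => [|i w IH]; last by rewrite fmul_delta_cons; exact: polynomial_fcons.
rewrite (_ : fdelta [::] = fone (R := R)) ?fmul1l//.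
by apply/funext => v; rewrite /fdelta /fone eq_sym.
Qed.

Lemma degree_delta_sum m p : degree_lt m p ->
  p = fun v => \sum_(w <- words m) p w * fdelta w v.
Proof.
move=> pm; apply/funext => v; have [mv|vm] := leqP m (size v).
  rewrite pm// big_seq big1// => w; rewrite mem_words /fdelta.
  by case: eqP => [->|]; [rewrite ltnNge mv|rewrite mulr0].
rewrite (bigD1_seq v) ?mem_words ?words_uniq//= /fdelta eqxx mulr1 big1 ?addr0//.
by move=> w /negbTE ->; rewrite mulr0.
Qed.

Lemma fmul_delta_sum m p r : degree_lt m p ->
  fmul p r = fun v => \sum_(w <- words m) p w * fmul (fdelta w) r v.
Proof.
move=> pm; rewrite {1}(degree_delta_sum pm); apply/funext => v.
rewrite fmul_suml; apply: eq_bigr => w _.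
have := fmul_axpyl (p w) (fdelta w) (fun=> 0) r v; rewrite fmul0l addr0 => <-.
by congr fmul; apply/funext => u; rewrite addr0.
Qed.

Lemma polynomial_fmul p r : polynomial p -> polynomial r -> polynomial (fmul p r).
Proof.
move=> /polynomialP[m pm] pr; rewrite (fmul_delta_sum _ pm).
by apply: polynomial_sum => w; exact: polynomial_delta_fmul.
Qed.

Lemma polynomial_fword f w : (forall j, polynomial (f j)) -> polynomial (fword f w).
Proof.
move=> pf; elim: w => [|i w IH] /=; last exact: polynomial_fmul.
by apply/polynomialP; exists 1%N => -[].
Qed.

Lemma fsubst_sum f (I : Type) (s : seq I) (a : I -> R[i]) (F : I -> fps R n) v :
  (forall x, polynomial (F x)) ->
  fsubst (fun v => \sum_(x <- s) a x * F x v) f v = \sum_(x <- s) a x * fsubst (F x) f v.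
Proof.
move=> pF; elim: s => [|x s IH].
  by under eq_fun do rewrite big_nil; rewrite fsubst0 big_nil.
under eq_fun do rewrite big_cons; rewrite big_cons -IH fsubst_axpy//.
  exact: polynomial_composable.
by apply: polynomial_composable; exact: polynomial_sum.
Qed.

Lemma fsubst_delta_fmul f w r : polynomial r ->
  fsubst (fmul (fdelta w) r) f = fmul (fword f w) (fsubst r f).
Proof.
move=> pr; elim: w => [|i w IH] /=.
  rewrite (_ : fdelta [::] = fone (R := R)) ?fmul1l//.
  by apply/funext => v; rewrite /fdelta /fone eq_sym.
rewrite fmul_delta_cons fsubst_cons ?IH ?fmulA//; apply: polynomial_composable.
  exact: polynomial_delta_fmul.
by apply: polynomial_fcons; exact: polynomial_delta_fmul.
Qed.

Lemma fsubst_fmul f p r : polynomial p -> polynomial r ->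
  fsubst (fmul p r) f = fmul (fsubst p f) (fsubst r f).
Proof.
move=> /polynomialP[m pm] pr; apply/funext => v.
rewrite (fmul_delta_sum _ pm) fsubst_sum; last first.
  by move=> w; exact: polynomial_delta_fmul.
rewrite (_ : fsubst p f = fun v => \sum_(w <- words m) p w * fword f w v).
  rewrite fmul_suml; apply: eq_bigr => w _; rewrite fsubst_delta_fmul//.
  have := fmul_axpyl (p w) (fword f w) (fun=> 0) (fsubst r f) v.
  rewrite fmul0l addr0 => <-; congr fmul; apply/funext => u; rewrite addr0//.
by apply/funext => u; exact: fsubst_degree.
Qed.

(** Substitution of [q] is a ring morphism on polynomials, so it maps the product
    [fword f w] back to the monomial [Z_w]. *)
Lemma fsubst_inv f (q : 'I_n -> fps R n) c : (forall j, polynomial (f j)) ->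
  (forall j, fsubst (f j) q = fvar j) -> polynomial c ->
  fsubst (fsubst c f) q = c.
Proof.
move=> pf fq /polynomialP[m cm].
have wordE w : fsubst (fword f w) q = fdelta w.
  elim: w => [|i w IH] /=.
    have -> : fone (R := R) = fdelta [::] :> fps R n.
      by apply/funext => v; rewrite /fdelta /fone eq_sym.
    rewrite fsubst_delta /=; apply/funext => v.
    by rewrite /fdelta /fone eq_sym.
  by rewrite fsubst_fmul ?fq ?IH ?fmul_fvar ?fcons_delta//; exact: polynomial_fword.
rewrite (_ : fsubst c f = fun v => \sum_(w <- words m) c w * fword f w v); last first.
  by apply/funext => u; exact: fsubst_degree.
apply/funext => v; rewrite fsubst_sum; last by move=> w; exact: polynomial_fword.
under eq_bigr do rewrite wordE.
by rewrite [in RHS](degree_delta_sum cm).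
Qed.

End PolynomialComposition.

(** * Strong limits of polynomials in operators *)

Section SotAlgebra.
Context {R : realType} {n : nat} {H : hilbertType R}.
Implicit Types (A B : H -> H) (Y Z : 'I_n -> H -> H) (w : word n) (p : fps R n).

(** Limits of sequences suffice for the values [f_j(M_Z)], and unlike limits of nets
    they are uniformly bounded. *)
Inductive sot_alg Y : (H -> H) -> Prop :=
| sot_alg_id : sot_alg Y id
| sot_alg_gen i : sot_alg Y (Y i)
| sot_alg_axpy (a : R[i]) A B : sot_alg Y A -> sot_alg Y B ->
    sot_alg Y (fun x => a *: A x + B x)
| sot_alg_comp A B : sot_alg Y A -> sot_alg Y B -> sot_alg Y (A \o B)
| sot_alg_lim (A : nat -> H -> H) B : (forall m, sot_alg Y (A m)) ->
    bounded_linear B -> (forall x, A m x @[m --> \oo] --> B x) -> sot_alg Y B.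

Context (Y : 'I_n -> H -> H).

Lemma sot_alg0 : sot_alg Y (fun=> 0).
Proof.
rewrite (_ : (fun=> 0) = fun x : H => (-1) *: id x + id x).
  by apply: sot_alg_axpy; exact: sot_alg_id.
by apply/funext => x; rewrite scaleN1r addNr.
Qed.

Lemma sot_alg_scale (a : R[i]) A : sot_alg Y A -> sot_alg Y (fun x => a *: A x).
Proof.
move=> YA; rewrite (_ : (fun _ => _) = fun x => a *: A x + 0).
  by apply: sot_alg_axpy => //; exact: sot_alg0.
by apply/funext => x; rewrite addr0.
Qed.

Lemma sot_alg_sum (I : Type) (s : seq I) (a : I -> R[i]) (A : I -> H -> H) :
  (forall i, sot_alg Y (A i)) -> sot_alg Y (fun x => \sum_(i <- s) a i *: A i x).
Proof.
move=> YA; elim: s => [|i s IH].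
  by under eq_fun do rewrite big_nil; exact: sot_alg0.
by under eq_fun do rewrite big_cons; exact: sot_alg_axpy.
Qed.

Lemma sot_alg_opword Z w : (forall i, sot_alg Y (Z i)) -> sot_alg Y (opword Z w).
Proof.
by move=> YZ; elim: w => [|i w IH] /=; [exact: sot_alg_id|exact: sot_alg_comp].
Qed.

Lemma fps_psumE (p : fps R n) (Z : 'I_n -> H -> H) m x :
  fps_psum p Z m x = \sum_(w <- words m) p w *: opword Z w x.
Proof. exact: (@big_words n H m (fun w => p w *: opword Z w x)). Qed.

Lemma sot_alg_psum p Z m : (forall i, sot_alg Y (Z i)) -> sot_alg Y (fps_psum p Z m).
Proof.
move=> YZ; rewrite (_ : fps_psum p Z m = fun x => \sum_(w <- words m) p w *: opword Z w x).
  by apply: sot_alg_sum => w; exact: sot_alg_opword.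
by apply/funext => x; exact: fps_psumE.
Qed.

Lemma sot_alg_bounded A : (forall i, bounded_linear (Y i)) -> sot_alg Y A -> bounded_linear A.
Proof.
move=> bY; elim=> {A} [|i|a A B _ bA _ bB|A B _ bA _ bB|//].
- exact: bounded_id.
- exact: bY.
- exact: bounded_axpy.
- exact: bounded_comp.
Qed.

Hypothesis bY : forall i, bounded_linear (Y i).

Lemma conv_norm_sot p Z : (forall i, sot_alg Y (Z i)) -> conv_norm p Z -> conv_sot p Z.
Proof.
move=> YZ [A bA pA]; exists A => // x; apply/hcvg_hnorm.
have le m : hnorm (fps_psum p Z m x - A x) <=
    opnorm (fun x => fps_psum p Z m x - A x) * hnorm x.
  have bd : bounded_linear (fun x => fps_psum p Z m x - A x).
    rewrite (_ : (fun _ => _) = fun x => (-1) *: A x + fps_psum p Z m x).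
      by apply: bounded_axpy => //; apply: sot_alg_bounded => //; exact: sot_alg_psum.
    by apply/funext => y; rewrite scaleN1r addrC.
  exact: (hbound_opnorm bd).2.
have c0 : opnorm (fun x => fps_psum p Z m x - A x) * hnorm x @[m --> \oo] --> 0 * hnorm x.
  exact: cvgMr_tmp.
rewrite mul0r in c0.
apply: (squeeze_cvgr _ (cvg_cst 0) c0); apply: nearW => m.
by rewrite hnorm_ge0 le.
Qed.

Lemma conv_sot_alg p Z : (forall i, sot_alg Y (Z i)) -> conv_sot p Z ->
  sot_alg Y (fps_eval p Z).
Proof.
move=> YZ [A bA pA].
have -> : fps_eval p Z = A by apply/funext => x; exact: hcvg_lim (pA x).
by apply: sot_alg_lim pA => // m; exact: sot_alg_psum.
Qed.

Lemma conv_rad_alg p : conv_rad p Y -> sot_alg Y (fps_eval_rad p Y).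
Proof.
move=> [[d [/andP[d0 d1] hd]] [A bA pA]].
have -> : fps_eval_rad p Y = A by apply/funext => x; exact: hcvg_lim (pA x).
pose r (m : nat) : R := 1 - (1 - d) / m.+2%:R.
have r_lt m : d < r m < 1.
  have m2 : 1 < m.+2%:R :> R by rewrite ltr1n.
  have m0 : 0 < m.+2%:R :> R by [].
  rewrite /r ltrBrDl -ltrBrDr ltr_pdivrMr// gtrBl divr_gt0 ?subr_gt0// andbT.
  by rewrite ltr_pMr ?subr_gt0.
apply: (@sot_alg_lim _ (fun m => fps_eval p (dilate (r m) Y))) => // [m|x].
  have Yd i : sot_alg Y (dilate (r m) Y i) by apply: sot_alg_scale; exact: sot_alg_gen.
  by apply: conv_sot_alg => //; apply: conv_norm_sot => //; exact: hd.
apply/hcvgP => e e0; move/hcvgP: (pA x) => /(_ e e0).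
move=> /nbhs_ballP[/= c c0 hc].
have cr : r m @[m --> \oo] --> (1 : R).
  rewrite -[X in _ --> X]subr0; apply: cvgB; first exact: cvg_cst.
  rewrite -(mulr0 (1 - d)); apply: cvgMl_tmp.
  by have := @cvg_harmonic R; rewrite -cvg_shiftS.
move/cvgrPdist_lt: cr => /(_ c c0); apply: filterS => m hm.
by apply: hc => //; have /andP[] := r_lt m.
Qed.

End SotAlgebra.

(** * Consequences of the model property *)

Section ModelFacts.
Context {R : realType} {n : nat} {Hf : hilbertType R} (e : word n -> Hf).
Hypothesis e_basis : orthonormal_basis e.
Implicit Types (f : 'I_n -> fps R n) (MZ : 'I_n -> Hf -> Hf).

(** All that the proof of the theorem uses of the model property. *)
Definition analytic_model MZ : Prop :=
  [/\ forall i, bounded_linear (MZ i),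
      forall i j x, MZ i (right_creation e j x) = right_creation e j (MZ i x) &
      forall j, sot_alg MZ (left_creation e j)].

(** The values of the series [f_j] at [MZ] are strong limits of polynomials, and they
    are the left creation operators because [mulf] determines them. The relations
    [mulZ] are preserved by multiplication by [f_j] on the right. *)
Lemma analytic_multipliers f mulZ mulf MZ : multipliers f mulZ mulf MZ ->
  (forall j x y, mulf j x y -> y = left_creation e j x) ->
  (forall i j x y, mulZ i x y -> mulZ i (right_creation e j x) (right_creation e j y)) ->
  (forall i x y y', mulZ i x y -> mulZ i x y' -> y = y') ->
  analytic_model MZ.
Proof.
move=> [bM hZ hf] mulfE mulZr mulZ_inj; split=> // [i j x|j].
  by apply: mulZ_inj (hZ _ _) _; exact: mulZr.
case: hf => -[cf hf].
  have -> : left_creation e j = fps_eval (f j) MZ.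
    by apply/funext => x; rewrite (mulfE _ _ _ (hf j x)).
  by apply: conv_sot_alg => //; exact: sot_alg_gen.
have -> : left_creation e j = fps_eval_rad (f j) MZ.
  by apply/funext => x; rewrite (mulfE _ _ _ (hf j x)).
exact: conv_rad_alg.
Qed.

Lemma coef_left_creation_fcons j x : coef e (left_creation e j x) = fcons j (coef e x).
Proof. by apply/funext => w; rewrite coef_left_creation. Qed.

Lemma fsubst_left_creation f j x : composable (coef e x) f ->
  composable (coef e (left_creation e j x)) f ->
  fsubst (coef e (left_creation e j x)) f = fmul (f j) (fsubst (coef e x) f).
Proof. by rewrite coef_left_creation_fcons => *; exact: fsubst_cons. Qed.

Lemma fsubst_right_creation f j x : composable (coef e x) f ->
  composable (coef e (right_creation e j x)) f ->
  fsubst (coef e (right_creation e j x)) f = fmul (fsubst (coef e x) f) (f j).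
Proof.
move=> cx cRx; apply: fsubst_rcons => //; first exact: coef_right_creation_nil.
by move=> w i; exact: coef_right_creation_rcons.
Qed.

Lemma fsubst_coefB f x y : composable (coef e x) f -> composable (coef e y) f ->
  fsubst (coef e (x - y)) f = fun v => fsubst (coef e x) f v - fsubst (coef e y) f v.
Proof.
move=> cx cy; apply/funext => v.
rewrite (_ : coef e (x - y) = fun w => (-1) * coef e y w + coef e x w).
  by rewrite fsubst_axpy// mulN1r addrC.
by apply/funext => w; rewrite -coef_axpy scaleN1r addrC.
Qed.

Lemma model_S_analytic f MZ : model_S f e MZ -> analytic_model MZ.
Proof.
move=> [f0 _ detf _ mul].
have comp c : composable c f by exact: zero_composable.
have inj x y : fsubst (coef e x) f = fsubst (coef e y) f -> x = y.
  move=> xy; apply/eqP; rewrite -subr_eq0; apply/eqP; apply: (coef_inj e_basis).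
  rewrite [RHS](_ : _ = fun=> 0); last by apply/funext => w; exact: inner0l.
  apply: (fsubst_inj0 f0 detf); rewrite fsubst_coefB// xy.
  by apply/funext => v; rewrite subrr.
apply: (analytic_multipliers mul) => [j x y h|i j x y h|i x y y' h h'].
- by apply: inj; rewrite h fsubst_left_creation.
- by rewrite !fsubst_right_creation// h fmulA.
- by apply: inj; rewrite h h'.
Qed.

Lemma coef_basis_delta w : coef e (e w) = fdelta w.
Proof. by apply/funext => v; rewrite coef_basis. Qed.

Lemma polynomial_right_creation j x :
  polynomial (coef e x) -> polynomial (coef e (right_creation e j x)).
Proof.
move=> /polynomialP[m xm]; apply/polynomialP; exists m.+1 => w.
case/lastP: w => [//|w i]; rewrite size_rcons ltnS => mw.
by rewrite coef_right_creation_rcons// xm ?mulr0.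
Qed.

Lemma polynomial_left_creation j x :
  polynomial (coef e x) -> polynomial (coef e (left_creation e j x)).
Proof. by rewrite coef_left_creation_fcons; exact: polynomial_fcons. Qed.

(** The multiplication rule is only known for polynomials, which form a dense
    subspace: identities between bounded operators are checked on the [e w], where
    composition with [f] is injective because it is undone by [q]. *)
Lemma model_A_analytic f MZ : model_A f e MZ -> analytic_model MZ.
Proof.
move=> [pf [q [pq fq qf]] bM hM].
have comp c : polynomial c -> composable c f by exact: polynomial_composable.
have inj x y : polynomial (coef e x) -> polynomial (coef e y) ->
    fsubst (coef e x) f = fsubst (coef e y) f -> x = y.
  move=> px py xy; apply: (coef_inj e_basis).
  by rewrite -(fsubst_inv pf fq px) xy fsubst_inv.
have pe w : polynomial (coef e (e w)) by rewrite coef_basis_delta; exact: polynomial_delta.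
have wordM w x : polynomial (coef e x) -> polynomial (coef e (opword MZ w x)) /\
    fsubst (coef e (opword MZ w x)) f = fmul (fdelta w) (fsubst (coef e x) f).
  move=> px; elim: w => [|i w [IH1 IH2]] /=.
    split=> //; rewrite (_ : fdelta [::] = fone (R := R)) ?fmul1l//.
    by apply/funext => v; rewrite /fdelta /fone eq_sym.
  have [p1 ->] := hM i _ IH1; split => //.
  by rewrite IH2 fmul_delta_cons fmul_fvar.
have bR := right_creation_bounded e_basis; have bL := left_creation_bounded e_basis.
split => // [i j x|j].
  suff : MZ i \o right_creation e j = right_creation e j \o MZ i by move/(congr1 (@^~ x)).
  apply: (basis_ext e_basis) => [||w /=]; [exact: bounded_comp|exact: bounded_comp|].
  have [p1 h1] := hM i _ (pe w); have pR := polynomial_right_creation j (pe w).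
  have [p2 h2] := hM i _ pR.
  apply: inj => //; first exact: polynomial_right_creation.
  rewrite h2 !fsubst_right_creation ?h1 ?fmulA//; apply: comp => //.
  exact: polynomial_right_creation.
have /polynomialP[m fm] := pf j.
pose P x := \sum_(w <- words m) f j w *: opword MZ w x.
have sP : sot_alg MZ P.
  by apply: sot_alg_sum => w; apply: sot_alg_opword => i; exact: sot_alg_gen.
suff -> : left_creation e j = P by [].
apply: (basis_ext e_basis) => [//||v]; first exact: sot_alg_bounded sP.
have coefP w : coef e (P (e v)) w = \sum_(u <- words m) f j u * coef e (opword MZ u (e v)) w.
  rewrite /coef /P inner_suml; apply: eq_bigr => u _; exact: innerZl.
have coefPE := funext coefP.
apply: inj; first exact: polynomial_left_creation.
  by rewrite coefPE; apply: polynomial_sum => u; have [] := wordM u _ (pe v).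
rewrite fsubst_left_creation ?coefPE; [|exact: comp|]; last first.
  by apply: comp; exact: polynomial_left_creation.
apply/funext => u; rewrite fsubst_sum; last by move=> w; have [] := wordM w _ (pe v).
rewrite (fmul_delta_sum _ fm); apply: eq_bigr => w _.
by have [_ ->] := wordM w _ (pe v).
Qed.

End ModelFacts.

(** * Evaluation of square summable series at row contractions *)

Section RowContraction.
Context {R : realType} {n : nat} {H : hilbertType R}.
Implicit Types (Z : 'I_n -> H -> H) (c : fps R n).

(** With [u = \sum_i Z_i v_i], the inequality
    [2 <v_i, Z_i^* u> <= s |v_i|^2 + s^-1 |Z_i^* u|^2] and
    [\sum_i |Z_i^* u|^2 <= s |u|^2] give [2 |u|^2 <= s \sum_i |v_i|^2 + |u|^2]. The
    number [s] is taken strictly between the norm of [\sum_i Z_i Z_i^*] and 1 to make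
    it positive. *)
Lemma op_ball_row_bound Z : op_ball 1 Z -> exists2 s : R, 0 < s < 1 &
  forall v : 'I_n -> H, hnorm (\sum_i Z i (v i)) ^+ 2 <= s * \sum_i hnorm (v i) ^+ 2.
Proof.
move=> [bZ]; set T := (X in opnorm X) => oT.
have bT : bounded_linear T.
  rewrite (_ : T = fun x => \sum_i 1 *: (Z i \o adjoint (Z i)) x).
    by apply: bounded_sum => i; exact: (bounded_comp (bZ i) (adjoint_bounded (bZ i))).
  by apply/funext => x; apply: eq_bigr => i _; rewrite scale1r.
have o1 : opnorm T < 1.
  by rewrite -(sqr_sqrtr (opnorm_ge0 T)) expr_lt1 ?sqrtr_ge0.
have o0 := opnorm_ge0 T; pose s := (opnorm T + 1) / 2.
have s0 : 0 < s by rewrite divr_gt0// ltr_wpDl.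
have s1 : s < 1 by rewrite ltr_pdivrMr//; lra.
have Ts : opnorm T <= s by rewrite /s; lra.
exists s; first by rewrite s0.
move=> v; set u := \sum_i Z i (v i).
have sumT : \sum_i hnorm (adjoint (Z i) u) ^+ 2 <= s * hnorm u ^+ 2.
  have -> : \sum_i hnorm (adjoint (Z i) u) ^+ 2 = rinner (T u) u.
    rewrite /rinner /T inner_suml Re_sum; apply: eq_bigr => i _.
    by rewrite hnorm2 /rinner (adjointP (bZ i)).
  rewrite (le_trans (rinner_le _ _))// expr2 mulrA ler_wpM2r ?hnorm_ge0//.
  by rewrite (le_trans ((hbound_opnorm bT).2 u))// ler_wpM2r ?hnorm_ge0.
have : 2 * hnorm u ^+ 2 <= s * \sum_i hnorm (v i) ^+ 2 +
    s^-1 * \sum_i hnorm (adjoint (Z i) u) ^+ 2.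
  rewrite hnorm2 {1}/u /rinner inner_suml Re_sum !mulr_sumr -big_split /=.
  apply: ler_sum => i _; rewrite (adjointP (bZ i)).
  apply: le_trans (_ : 2 * (hnorm (v i) * hnorm (adjoint (Z i) u)) <= _).
    by rewrite ler_pM2l// rinner_le.
  move: (hnorm (v i)) (hnorm (adjoint _ _)) => a b.
  rewrite -(ler_pM2l s0) mulrDr [s * (s^-1 * _)]mulrA mulfV ?gt_eqF// mul1r.
  by have := sqr_ge0 (s * a - b); lra.
have : s^-1 * \sum_i hnorm (adjoint (Z i) u) ^+ 2 <= hnorm u ^+ 2.
  by rewrite ler_pdivrMl.
lra.
Qed.

Lemma psum_cons c Z m x :
  fps_psum c Z m.+1 x = c [::] *: x + \sum_i \sum_(w <- words m) c (i :: w) *: Z i (opword Z w x).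
Proof. by rewrite fps_psumE big_words_cons. Qed.

Lemma psum_step c Z m x : (forall i, is_lin (Z i)) ->
  fps_psum c Z m.+1 x = c [::] *: x + \sum_i Z i (fps_psum (fun w => c (i :: w)) Z m x).
Proof.
move=> lZ; rewrite psum_cons; congr (_ + _); apply: eq_bigr => i _.
rewrite fps_psumE lin_sum//; apply: eq_bigr => w _; exact/esym/linZ.
Qed.

(** The increment is the homogeneous part of degree [m]; splitting off the first
    letter writes it as [\sum_i Z_i] of homogeneous parts of degree [m - 1]. *)
Lemma psum_increment (s : R) c Z m x : (forall i, bounded_linear (Z i)) -> 0 <= s ->
  (forall v : 'I_n -> H, hnorm (\sum_i Z i (v i)) ^+ 2 <= s * \sum_i hnorm (v i) ^+ 2) ->
  hnorm (fps_psum c Z m.+1 x - fps_psum c Z m x) ^+ 2 <=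
    s ^+ m * (\sum_(w <- words m.+1) modulus (c w) ^+ 2) * hnorm x ^+ 2.
Proof.
move=> bZ s0 row; have lZ i := bounded_lin (bZ i).
elim: m c => [|m IH] c.
  rewrite psum_step// fps_psumE big_nil subr0 big_words_cons big1 => [|i _]; last first.
    by rewrite fps_psumE big_nil lin0.
  rewrite addr0 hnormZ exprMn expr0 mul1r ler_wpM2r ?sqr_ge0// lerDl.
  by apply: sumr_ge0 => i _; apply: sumr_ge0 => w _; exact: sqr_ge0.
rewrite (psum_step c m.+1)// (psum_step c m)// opprD addrACA subrr add0r -sumrB.
under eq_bigr => i _ do rewrite -(linB (lZ i)).
rewrite (le_trans (row _))// exprS -!mulrA ler_wpM2l//.
apply: (@le_trans _ _ (\sum_i s ^+ m *
    (\sum_(w <- words m.+1) modulus (c (i :: w)) ^+ 2) * hnorm x ^+ 2)).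
  by apply: ler_sum => i _; exact: (IH (fun w => c (i :: w))).
rewrite -mulr_suml -mulr_sumr -mulrA ler_wpM2l ?exprn_ge0// ler_wpM2r ?sqr_ge0//.
by rewrite [leRHS]big_words_cons lerDr sqr_ge0.
Qed.

Lemma geometric_cvg (u : nat -> H) (C s : R) : 0 <= C -> 0 < s < 1 ->
  (forall m, hnorm (u m.+1 - u m) <= C * s ^+ m) -> exists l : H, u m @[m --> \oo] --> l.
Proof.
move=> C0 /andP[s0 s1] hu; have t0 : 0 < 1 - s by rewrite subr_gt0.
have tail N j : (1 - s) * hnorm (u (N + j)%N - u N) <= C * s ^+ N - C * s ^+ (N + j).
  elim: j => [|j IH]; first by rewrite !addn0 !subrr hnorm0 mulr0.
  rewrite addnS -(subrK (u (N + j)%N) (u (N + j).+1)) -addrA.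
  have h1 := hnormD (u (N + j).+1 - u (N + j)%N) (u (N + j)%N - u N).
  rewrite exprS; have h2 := hu (N + j)%N.
  have h3 : (1 - s) * hnorm (u (N + j).+1 - u (N + j)%N) <= (1 - s) * (C * s ^+ (N + j)).
    by rewrite ler_pM2l.
  have h4 : (1 - s) * hnorm (u (N + j).+1 - u (N + j)%N + (u (N + j)%N - u N)) <=
     (1 - s) * (hnorm (u (N + j).+1 - u (N + j)%N) + hnorm (u (N + j)%N - u N)).
    by rewrite ler_pM2l.
  by lra.
apply: hcauchy_cvg => e e0.
have cs : C * s ^+ m @[m --> \oo] --> C * 0.
  by apply: cvgMl_tmp; apply: cvg_expr; rewrite ger0_norm// ltW.
have e2 : 0 < (1 - s) * (e / 2) by rewrite mulr_gt0// divr_gt0.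
rewrite mulr0 in cs; move/cvgrPdist_lt: cs => /(_ _ e2)[N _ /(_ N (leqnn N))].
rewrite /= sub0r normrN ger0_norm ?mulr_ge0 ?exprn_ge0 ?(ltW s0)// => hN.
have near_N j : (N <= j)%N -> hnorm (u j - u N) < e / 2.
  move=> Nj; rewrite -(ltr_pM2l t0) -(subnKC Nj) (le_lt_trans (tail _ _))//.
  by rewrite (le_lt_trans _ hN)// gerBl mulr_ge0 ?exprn_ge0 ?(ltW s0).
exists N => a b Na Nb; rewrite -(subrK (u N) (u a)) -addrA (le_lt_trans (hnormD _ _))//.
by rewrite (splitr e) ltrD ?near_N// hdistC near_N.
Qed.

Context {Hf : hilbertType R} (e : word n -> Hf).
Hypothesis e_basis : orthonormal_basis e.

Lemma eval_cvg Z (x : Hf) v : op_ball 1 Z ->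
  fps_psum (coef e x) Z m v @[m --> \oo] --> fps_eval (coef e x) Z v.
Proof.
move=> ballZ; have [bZ _] := ballZ; have [s /andP[s0 s1] row] := op_ball_row_bound ballZ.
suff [l ul] : exists l : H, fps_psum (coef e x) Z m v @[m --> \oo] --> l.
  by rewrite /fps_eval (hcvg_lim ul).
apply: (@geometric_cvg _ (hnorm x * hnorm v) (Num.sqrt s)).
- by rewrite mulr_ge0 ?hnorm_ge0.
- by rewrite sqrtr_gt0 s0 -(sqrtr1 R) ltr_sqrt.
move=> m; rewrite -(@ler_pXn2r _ 2) ?nnegrE ?hnorm_ge0//; last first.
  by rewrite !mulr_ge0 ?hnorm_ge0 ?exprn_ge0 ?sqrtr_ge0.
rewrite (le_trans (psum_increment _ _ _ bZ (ltW s0) row))//.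
have -> : (hnorm x * hnorm v * Num.sqrt s ^+ m) ^+ 2 = s ^+ m * hnorm x ^+ 2 * hnorm v ^+ 2.
  by rewrite !exprMn -exprM mulnC exprM sqr_sqrtr ?(ltW s0)//; ring.
rewrite ler_wpM2r ?sqr_ge0// ler_wpM2l ?exprn_ge0 ?(ltW s0)//.
exact: (bessel e_basis x (words_uniq _)).
Qed.

Lemma fps_evalB Z (x y : Hf) v : op_ball 1 Z ->
  fps_eval (coef e (x - y)) Z v = fps_eval (coef e x) Z v - fps_eval (coef e y) Z v.
Proof.
move=> bZ; apply: (hcvg_unique (@eval_cvg _ (x - y) v bZ)).
rewrite (_ : (fun m => _) = fun m => fps_psum (coef e x) Z m v - fps_psum (coef e y) Z m v).
  by apply: cvgB; exact: eval_cvg.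
apply/funext => m; rewrite !fps_psumE -sumrB; apply: eq_bigr => w _.
by rewrite -scalerBl /coef innerBl.
Qed.

Lemma fps_eval_left Z j (x : Hf) v : op_ball 1 Z ->
  fps_eval (coef e (left_creation e j x)) Z v = Z j (fps_eval (coef e x) Z v).
Proof.
move=> ballZ; have [bZ _] := ballZ; apply: (hcvg_unique (@eval_cvg _ _ v ballZ)).
rewrite -cvg_shiftS.
rewrite (_ : (fun m => _) = fun m => Z j (fps_psum (coef e x) Z m v)).
  exact: (bounded_cvg (bZ j) (@eval_cvg _ x v ballZ)).
apply/funext => m; rewrite psum_step; last by move=> i; exact: bounded_lin.
rewrite coef_left_creation// scale0r add0r (bigD1 j)//= [X in _ + X]big1 ?addr0.
  by congr (Z j _); rewrite !fps_psumE; apply: eq_bigr => w _; rewrite coef_left_creation// eqxx mul1r.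
move=> i /negbTE ij; rewrite fps_psumE big1 ?lin0//; first exact: bounded_lin.
by move=> w _; rewrite coef_left_creation// ij mul0r scale0r.
Qed.

Lemma opword_rcons Z w j v : opword Z (rcons w j) v = opword Z w (Z j v).
Proof. by elim: w => [//|i w IH] /=; rewrite IH. Qed.

Lemma fps_eval_right Z j (x : Hf) v : op_ball 1 Z ->
  fps_eval (coef e (right_creation e j x)) Z v = fps_eval (coef e x) Z (Z j v).
Proof.
move=> ballZ; have [bZ _] := ballZ; apply: (hcvg_unique (@eval_cvg _ _ v ballZ)).
rewrite -cvg_shiftS.
rewrite (_ : (fun m => _) = fun m => fps_psum (coef e x) Z m (Z j v)).
  exact: eval_cvg.
apply/funext => m; rewrite !fps_psumE big_words_rcons.
rewrite coef_right_creation_nil// scale0r add0r (bigD1 j)//= [X in _ + X]big1 ?addr0.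
  apply: eq_bigr => w _.
  by rewrite coef_right_creation_rcons// eqxx mul1r opword_rcons.
move=> i /negbTE ij; rewrite big1// => w _.
by rewrite coef_right_creation_rcons// ij mul0r scale0r.
Qed.

Lemma bernoulli_bound (t : R) k : 0 <= t -> 1 + k%:R * t <= (1 + t) ^+ k.
Proof.
move=> t0; elim: k => [|k IH]; first by rewrite mul0r addr0 expr0.
rewrite exprS; apply: le_trans (ler_wpM2l _ IH); last lra.
rewrite -natr1; have : 0 <= k%:R * t * t by rewrite !mulr_ge0.
by move: (k%:R) => a; lra.
Qed.

(** The sum of squares in degree [k] is at most [hnorm x ^+ 2] by Bessel's inequality,
    hence at most [(1 + eps) ^+ k.*2] for large [k] by Bernoulli's. *)
Lemma coef_radius (x : Hf) : radius_ge 1 (coef e x).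
Proof.
rewrite /radius_ge invr1; apply/lee_addgt0Pr => eps eps0.
pose B : R := hnorm x ^+ 2.
have [N hN] : exists N : nat, B <= 1 + N%:R * eps.
  exists (Num.truncn (B / eps)).+1.
  have : B / eps < (Num.truncn (B / eps)).+1%:R by exact: truncnS_gt.
  by rewrite ltr_pdivrMr//; lra.
have bound k : (N < k)%N -> (\sum_(w : k.-tuple 'I_n) complex.Re `|coef e x (tval w)| ^+ 2)
    `^ (k.*2%:R)^-1 <= 1 + eps.
  move=> Nk; have k0 : (0 < k)%N by exact: leq_trans Nk.
  have sumB : \sum_(w : k.-tuple 'I_n) modulus (coef e x (tval w)) ^+ 2 <= (1 + eps) ^+ k.*2.
    apply: le_trans (_ : B <= _).
      have := @bessel _ _ _ _ e_basis x (words k.+1) (words_uniq _).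
      apply: le_trans; rewrite -big_words big_ord_recr /= lerDr.
      by apply: sumr_ge0 => i _; apply: sumr_ge0 => w _; exact: sqr_ge0.
    apply: le_trans hN _; apply: le_trans _ (bernoulli_bound k.*2 (ltW eps0)).
    by rewrite lerD2l ler_pM2r// ler_nat -addnn (leq_trans (ltnW Nk))// leq_addr.
  have e1 : 0 <= 1 + eps by rewrite addr_ge0// ltW.
  have -> : 1 + eps = ((1 + eps) ^+ k.*2) `^ (k.*2%:R)^-1.
    rewrite -powR_mulrn// -powRrM mulfV ?powRr1//.
    by rewrite pnatr_eq0 double_eq0 -lt0n.
  apply: ge0_ler_powR => //; rewrite nnegrE ?exprn_ge0//.
  by apply: sumr_ge0 => w _; exact: sqr_ge0.
apply: (@le_trans _ _ (ereal_sup ((fun k => ((\sum_(w : k.-tuple 'I_n)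
     complex.Re `|coef e x (tval w)| ^+ 2) `^ (k.*2%:R)^-1)%:E) @` [set k | (N < k)%N]))).
  apply: ereal_inf_lbound; exists [set k | (N < k)%N] => //.
  by exists N.+1.
by apply: ge_ereal_sup => _ [k Nk <-]; rewrite -EFinD lee_fin bound.
Qed.

End RowContraction.

Section ModelF.
Context {R : realType} {n : nat} {Hf : hilbertType R} (e : word n -> Hf).
Hypothesis e_basis : orthonormal_basis e.

(** Series with square summable coefficients converge at the points [f(Y)], and they
    are determined by the values there; evaluation turns left and right creation
    operators into left and right multiplication by [f_j(Y)]. *)
Lemma model_F_analytic (f : 'I_n -> fps R n) (H : hilbertType R) (MZ : 'I_n -> Hf -> Hf) :
  model_F f e H MZ -> analytic_model e MZ.
Proof.
move=> [gamma gamma0 [[_ fball] f_indep _ mul]].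
have inj x y : (forall Y : 'I_n -> H -> H, op_ball gamma Y ->
    comp_eval f (coef e x) Y = comp_eval f (coef e y) Y) -> x = y.
  move=> xy; apply/eqP; rewrite -subr_eq0; apply/eqP; apply: (coef_inj e_basis).
  rewrite [RHS](_ : _ = fun=> 0); last by apply/funext => w; exact: inner0l.
  apply: f_indep => [|Y bY]; first exact: coef_radius.
  apply/funext => v; rewrite /comp_eval (fps_evalB e_basis _ _ _ (fball Y bY)).
  by rewrite -!/(comp_eval f _ Y v) xy// subrr.
apply: (analytic_multipliers mul) => [j x y h|i j x y h|i x y y' h h'].
- apply: inj => Y bY; rewrite h//; apply/funext => v /=.
  by rewrite /comp_eval (fps_eval_left e_basis _ _ _ (fball Y bY)).
- move=> Y bY; apply/funext => v /=.
  rewrite /comp_eval !(fps_eval_right e_basis _ _ _ (fball Y bY)).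
  exact: (congr1 (@^~ _) (h Y bY)).
- by apply: inj => Y bY; rewrite h// h'.
Qed.

Theorem universal_model_analytic (f : 'I_n -> fps R n) (H : hilbertType R)
  (MZ : 'I_n -> Hf -> Hf) : universal_model f e H MZ -> analytic_model e MZ.
Proof.
move=> [_ [|/(model_S_analytic e_basis)//|/model_F_analytic//]].
exact: model_A_analytic.
Qed.

End ModelF.

(** * Co-invariant subspaces and the lifting theorem *)

Section CoinvariantSubspaces.
Context {R : realType}.
Implicit Types (H K : hilbertType R).

Lemma adjoint_val H (E : closedSubspace H) : adjoint (val : subspace_type E -> H) = proj E.
Proof. by apply: adjointE => x y; rewrite inner_conj -inner_proj -inner_conj. Qed.

Lemma proj_coinvariant H (E : closedSubspace H) (A : H -> H) u : bounded_linear A ->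
  (forall x, subspace_set E x -> subspace_set E (adjoint A x)) ->
  proj E (A u) = compression A (proj E u).
Proof.
move=> bA EA; apply/eqP; rewrite -subr_eq0; apply/eqP; apply: inner_extl => y.
rewrite inner0l innerBl !inner_proj -innerBl -linB; last exact: bounded_lin.
rewrite adjointP//; have [y' <-] := subspace_valP (EA _ (subspace_val y)).
exact: proj_orthogonal.
Qed.

Lemma compression_bounded H (E : closedSubspace H) (A : H -> H) :
  bounded_linear A -> bounded_linear (compression (E := E) A).
Proof.
move=> bA; apply: (bounded_comp (proj_bounded E)).
exact: (bounded_comp bA (val_bounded E)).
Qed.

End CoinvariantSubspaces.

Section HardyAlgebra.
Context {R : realType} {n : nat} {H : hilbertType R} (e : word n -> H).
Hypothesis e_basis : orthonormal_basis e.
Context (MZ : 'I_n -> H -> H) (J : set (H -> H)).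
Hypothesis MZ_model : analytic_model e MZ.
Hypothesis J_ideal : wot_closed_ideal MZ J.

Lemma poly_evalE (p : fps R n) (Y : 'I_n -> H -> H) m : degree_lt m p ->
  poly_eval p Y = fun x => \sum_(w <- words m) p w *: opword Y w x.
Proof.
move=> pm; apply/funext => x; rewrite /poly_eval (fsbigE (words m)) ?words_uniq//.
  by rewrite big_mkcond; apply: eq_bigr => w _; rewrite in_setT.
by move=> w _; rewrite mem_words -leqNgt => /pm ->; rewrite scale0r.
Qed.

Lemma hardy_gen i : hardy MZ (MZ i).
Proof.
have [bM _ _] := MZ_model; split; first exact: bM.
move=> m x y eps eps0; exists (MZ i); last by move=> k; rewrite subrr inner0l normr0.
exists (fvar i).
  rewrite (_ : fvar i = fdelta [:: i]); first exact: polynomial_delta.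
  by apply/funext => w; rewrite /fvar /fdelta eq_sym.
rewrite (@poly_evalE _ _ 2); last by move=> [|j [|k w]]// _; rewrite /fvar eqseq_cons andbF.
apply/funext => x0; rewrite (bigD1_seq [:: i]) ?mem_words ?words_uniq//= /fvar eqxx scale1r.
by rewrite big1 ?addr0// => w /negbTE ->; rewrite scale0r.
Qed.

Lemma hardy_bounded A : hardy MZ A -> bounded_linear A.
Proof. by case. Qed.

Lemma opword_right_creation w j x :
  opword MZ w (right_creation e j x) = right_creation e j (opword MZ w x).
Proof. by have [_ MR _] := MZ_model; elim: w => [//|i w IH] /=; rewrite IH MR. Qed.

(** A weak operator approximation of [A] at the two pairs [(R_j x, y)] and
    [(x, R_j^* y)], by a polynomial in [MZ], controls
    [<A R_j x, y> - <R_j A x, y>], because the polynomial commutes with [R_j]. *)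
Lemma hardy_right_creation A j x : hardy MZ A ->
  A (right_creation e j x) = right_creation e j (A x).
Proof.
move=> [bA Aapprox]; have bR := right_creation_bounded e_basis j.
apply: inner_extl => y; apply/eqP; rewrite -subr_eq0 -normr_eq0; apply/eqP.
apply/le_anti; rewrite normr_ge0 andbT; apply/ler_addgt0Pr => eps eps0; rewrite add0r.
pose xs (k : 'I_2) := if k == ord0 then right_creation e j x else x.
pose ys (k : 'I_2) := if k == ord0 then y else adjoint (right_creation e j) y.
have [_ [p /polynomialP[m pm] ->] hB] := Aapprox 2%N xs ys (eps / 2) (divr_gt0 eps0 (ltr0Sn _ 1)).
set B := poly_eval p MZ in hB.
have BR : B (right_creation e j x) = right_creation e j (B x).
  rewrite /B (poly_evalE _ pm) lin_sum; last exact: bounded_lin.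
  apply: eq_bigr => w _; rewrite opword_right_creation linZ//; exact: bounded_lin.
have h0 := hB ord0; have h1 := hB (lift ord0 ord0); rewrite /xs /ys /= in h0 h1.
have -> : inner (A (right_creation e j x)) y - inner (right_creation e j (A x)) y =
    inner (A (right_creation e j x) - B (right_creation e j x)) y -
    inner (A x - B x) (adjoint (right_creation e j) y).
  rewrite BR -(adjointP bR) (linB (bounded_lin bR)) !innerBl.
  by rewrite opprB addrA subrK.
by rewrite (le_trans (ler_normB _ _))// (splitr eps) lerD// ltW.
Qed.

Lemma model_spaceP y : subspace_set (model_space J) y <->
  forall A x, J A -> inner y (A x) = 0.
Proof.
split=> [Ny A x JA|Jy z clz].
  by apply: Ny; apply: sub_closed_span; exists A => //; exists x.
have SE : [set A x | A in J & x in [set: H]] `<=` subspace_set (orthocomplement [set y]).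
  by move=> _ [A JA [x _ <-]] _ ->; rewrite inner_conj Jy// conjC0.
by rewrite inner_conj (span_closure_sub SE clz)// conjC0.
Qed.

Lemma model_space_coinvariant i y : subspace_set (model_space J) y ->
  subspace_set (model_space J) (adjoint (MZ i) y).
Proof.
have [bM _ _] := MZ_model; have [_ _ _ Jmul _] := J_ideal.
move=> /model_spaceP Ny; apply/model_spaceP => A x JA.
rewrite -(adjointPr (bM i)); apply: (Ny (MZ i \o A)).
by have [] := Jmul _ _ (hardy_gen i) JA.
Qed.

Lemma proj_ideal A x : J A -> proj (model_space J) (A x) = 0.
Proof.
move=> JA; apply: inner_extl => y; rewrite inner0l inner_proj inner_conj.
by have /model_spaceP -> := subspace_val y; rewrite ?conjC0.
Qed.

End HardyAlgebra.

Lemma amp_left_creation {R : realType} {n : nat} {H K : hilbertType R} (e : word n -> H)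
  (e_basis : orthonormal_basis e) j :
  amp (word_tensor e_basis (K := K)) (word_tensor e_basis (K := K)) (left_creation e j) =
  adjoint (@back_shift R n K j).
Proof.
have ht := word_tensor_hilbert e_basis K; have bL := left_creation_bounded e_basis j.
apply: word_units_ext; first exact: amp_bounded.
  exact/adjoint_bounded/back_shift_bounded.
move=> w k; rewrite adjoint_back_shift_unit -!(word_tensor_basis e_basis) ampE//.
by rewrite left_creationE.
Qed.

Section ModelTensor.
Context {R : realType} {n : nat} {Hf : hilbertType R} (e : word n -> Hf).
Hypothesis e_basis : orthonormal_basis e.
Context (MZ : 'I_n -> Hf -> Hf) (J : set (Hf -> Hf)).
Hypothesis MZ_model : analytic_model e MZ.
Hypothesis J_ideal : wot_closed_ideal MZ J.
Local Notation N := (model_space J).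
Context (K NK : hilbertType R) (t : subspace_type N -> K -> NK).
Hypothesis t_tensor : hilbert_tensor t.
Local Notation L := (wordL2 n K).
Local Notation tL := (word_tensor e_basis (K := K)).
Local Notation B i := (compression (E := N) (MZ i)).
Let tL_tensor : hilbert_tensor tL := word_tensor_hilbert e_basis K.
Let bM : forall i, bounded_linear (MZ i). Proof. by case: MZ_model. Qed.

(** The inclusion of [N (x) K] into [Hf (x) K], and the orthogonal projection of the
    latter onto the former. *)
Definition model_incl : NK -> L := amp t tL (val : subspace_type N -> Hf).
Definition model_proj : L -> NK := amp tL t (proj N).

Lemma model_incl_hbound : hbound 1 model_incl.
Proof. by apply: amp_hbound => //; exact: val_hbound. Qed.

Lemma model_proj_hbound : hbound 1 model_proj.
Proof. by apply: amp_hbound => //; exact: proj_hbound. Qed.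

Lemma model_inclK u : model_proj (model_incl u) = u.
Proof.
have := amp_comp t_tensor tL_tensor t_tensor (val_bounded N) (proj_bounded N).
rewrite (_ : proj N \o val = id); last by apply/funext => x; exact: proj_val.
by rewrite amp_id// => /(congr1 (@^~ u)).
Qed.

Lemma adjoint_model_incl : adjoint model_incl = model_proj.
Proof. by rewrite amp_adjoint ?adjoint_val//; exact: val_bounded. Qed.

Lemma inner_model_proj x y : inner (model_proj x) y = inner x (model_incl y).
Proof.
rewrite -adjoint_model_incl -adjointPr//.
exact: hbound_bounded model_incl_hbound.
Qed.

Lemma model_proj_amp i x :
  model_proj (amp tL tL (MZ i) x) = amp t t (B i) (model_proj x).
Proof.
have bB := compression_bounded N (bM i).
have h1 := amp_comp tL_tensor tL_tensor t_tensor (bM i) (proj_bounded N).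
have h2 := amp_comp tL_tensor t_tensor t_tensor (proj_bounded N) bB.
suff E : proj N \o MZ i = B i \o proj N.
  by have := congr1 (@^~ x) h1; rewrite E -h2.
apply/funext => z /=; apply: proj_coinvariant => // y.
exact: (model_space_coinvariant MZ_model J_ideal).
Qed.

Lemma model_proj_ideal A x : J A -> model_proj (amp tL tL A x) = 0.
Proof.
move=> JA; have [Jh _ _ _ _] := J_ideal; have bA := hardy_bounded (Jh _ JA).
have h1 := amp_comp tL_tensor tL_tensor t_tensor bA (proj_bounded N).
transitivity (amp tL t (proj N \o A) x); first exact: (congr1 (@^~ x) h1).
rewrite (@amp_unique _ _ _ _ _ _ _ _ tL_tensor t_tensor _ (fun=> 0))//.
- exact: (bounded_comp (proj_bounded N) bA).
- exact: bounded0.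
- by move=> y k /=; rewrite proj_ideal// (lin0 (tensor_linl t_tensor k)).
Qed.

Context (E : closedSubspace NK).
Hypothesis E_coinv : forall i x, subspace_set E x ->
  subspace_set E (ampliation t (adjoint (B i)) x).

Lemma proj_ampliation i u :
  proj E (ampliation t (B i) u) = compression (ampliation t (B i)) (proj E u).
Proof.
have bB := compression_bounded N (bM i).
apply: proj_coinvariant; first exact: (amp_bounded t_tensor t_tensor bB).
move=> x Ex; rewrite -[ampliation _ _]/(amp t t (B i)) amp_adjoint//.
exact: E_coinv.
Qed.

End ModelTensor.

Theorem theorem6p2 (R : realType) (n : nat) (H : hilbertType R)
  (H_inf : infinite_dimensional H)
  (f : 'I_n -> fps R n)
  (Hf : hilbertType R) (e : word n -> Hf) (MZ : 'I_n -> Hf -> Hf)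
  (f_model : universal_model f e H MZ)
  (J : set (Hf -> Hf)) (J_ideal : wot_closed_ideal MZ J)
  (J_proper : J <> hardy MZ)
  (K1 K2 NK1 NK2 : hilbertType R)
  (t1 : subspace_type (model_space J) -> K1 -> NK1)
  (t2 : subspace_type (model_space J) -> K2 -> NK2)
  (t1_tensor : hilbert_tensor t1) (t2_tensor : hilbert_tensor t2)
  (E1 : closedSubspace NK1) (E2 : closedSubspace NK2)
  (X : subspace_type E1 -> subspace_type E2) :
  let B i := compression (E := model_space J) (MZ i) in
  (forall i x, subspace_set E1 x ->
    subspace_set E1 (ampliation t1 (adjoint (B i)) x)) ->
  (forall i x, subspace_set E2 x ->
    subspace_set E2 (ampliation t2 (adjoint (B i)) x)) ->
  bounded_linear X ->
  (forall i x, X (compression (ampliation t1 (B i)) x) =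
               compression (ampliation t2 (B i)) (X x)) ->
  exists G : NK1 -> NK2,
    [/\ bounded_linear G,
        forall i x, G (ampliation t1 (B i) x) = ampliation t2 (B i) (G x),
        forall y, subspace_set E2 y -> subspace_set E1 (adjoint G y),
        forall y : subspace_type E2, adjoint G (val y) = val (adjoint X y) &
        opnorm G = opnorm X].
Proof.
move=> B E1_coinv E2_coinv bX Xcomm.
have e_basis : orthonormal_basis e by case: f_model.
have MZ_model := universal_model_analytic e_basis f_model.
have [bM MR Lalg] := MZ_model.
have bB i : bounded_linear (B i) := compression_bounded _ (bM i).
have tL1 := word_tensor_hilbert e_basis K1; have tL2 := word_tensor_hilbert e_basis K2.
set T1 := word_tensor e_basis (K := K1) in tL1; set T2 := word_tensor e_basis (K := K2) in tL2.
pose V1 := model_incl e_basis t1; pose C1 := model_proj e_basis t1.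
pose V2 := model_incl e_basis t2; pose C2 := model_proj e_basis t2.
have hV1 : hbound 1 V1 := model_incl_hbound e_basis t1_tensor.
have hV2 : hbound 1 V2 := model_incl_hbound e_basis t2_tensor.
have hC1 : hbound 1 C1 := model_proj_hbound e_basis t1_tensor.
have hC2 : hbound 1 C2 := model_proj_hbound e_basis t2_tensor.
have bV1 := hbound_bounded hV1; have bV2 := hbound_bounded hV2.
have bC1 := hbound_bounded hC1; have bC2 := hbound_bounded hC2.
have VK1 u : C1 (V1 u) = u by exact: model_inclK.
have VK2 u : C2 (V2 u) = u by exact: model_inclK.
have CA1 i x : C1 (amp T1 T1 (MZ i) x) = ampliation t1 (B i) (C1 x).
  exact: (model_proj_amp e_basis MZ_model J_ideal t1_tensor).
have CA2 i x : C2 (amp T2 T2 (MZ i) x) = ampliation t2 (B i) (C2 x).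
  exact: (model_proj_amp e_basis MZ_model J_ideal t2_tensor).
have innerC1 x y : inner (C1 x) y = inner x (V1 y) by exact: inner_model_proj.
have innerC2 x y : inner (C2 x) y = inner x (V2 y) by exact: inner_model_proj.
pose M := opnorm X; have M0 : 0 <= M := opnorm_ge0 X.
have hX : hbound M X := hbound_opnorm bX.
(* [Q2] projects onto [E2], and [XL] is [X P_{E1}], both read in [Hf (x) K1] and
   [Hf (x) K2] *)
pose Q2 (x : wordL2 n K2) := V2 (val (proj E2 (C2 x))).
pose XL (x : wordL2 n K1) := V2 (val (X (proj E1 (C1 x)))).
have bQ2 : bounded_linear Q2.
  exact: (bounded_comp bV2 (bounded_comp (val_bounded E2) (bounded_comp (proj_bounded E2) bC2))).
have bXL : bounded_linear XL.
  exact: (bounded_comp bV2 (bounded_comp (val_bounded E2) (bounded_comp bX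
    (bounded_comp (proj_bounded E1) bC1)))).
have hXL : hbound M XL.
  have h := hbound_comp ler01 hV2 (hbound_comp ler01 (val_hbound E2)
    (hbound_comp M0 hX (hbound_comp ler01 (proj_hbound E1) hC1))).
  by rewrite !mul1r !mulr1 in h; exact: h.
have Q2XL x : Q2 (XL x) = XL x by rewrite /Q2 /XL VK2 proj_val.
have Q2Q2 x : Q2 (Q2 x) = Q2 x by rewrite /Q2 VK2 proj_val.
have alg A : sot_alg MZ A ->
    (forall x, Q2 (amp T2 T2 A (Q2 x)) = Q2 (amp T2 T2 A x)) /\
    (forall x, XL (amp T1 T1 A x) = Q2 (amp T2 T2 A (XL x))).
  elim=> {A} [|i|a A A' sA [a1 a2] sA' [b1 b2]|A A' sA [a1 a2] sA' [b1 b2]|A A' sA hA bA' AA'].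
  - by rewrite !amp_id//; split => x; rewrite ?Q2Q2 ?Q2XL.
  - split => x; rewrite /Q2 ?CA2 ?VK2.
      by rewrite !(proj_ampliation MZ_model t2_tensor E2_coinv) proj_val.
    rewrite /XL CA1 ?VK2 (proj_ampliation MZ_model t1_tensor E1_coinv) Xcomm.
    by rewrite (proj_ampliation MZ_model t2_tensor E2_coinv) proj_val.
  - have bA := sot_alg_bounded bM sA; have bA' := sot_alg_bounded bM sA'.
    rewrite !amp_axpy//; split => x; first by rewrite !(bounded_lin bQ2) a1 b1.
    by rewrite (bounded_lin bXL) (bounded_lin bQ2) a2 b2.
  - have bA := sot_alg_bounded bM sA; have bA' := sot_alg_bounded bM sA'.
    rewrite -(amp_comp tL2 tL2 tL2 bA' bA) -(amp_comp tL1 tL1 tL1 bA' bA).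
    split => x /=; first by rewrite -a1 b1 a1.
    by rewrite a2 b2 a1.
  - have bA m := sot_alg_bounded bM (sA m).
    have cv1 := amp_sot tL1 tL1 bA bA' AA'; have cv2 := amp_sot tL2 tL2 bA bA' AA'.
    split => x.
      apply: (hcvg_unique (bounded_cvg bQ2 (cv2 (Q2 x)))).
      by under eq_fun do rewrite (hA _).1; exact: bounded_cvg bQ2 (cv2 x).
    apply: (hcvg_unique (bounded_cvg bXL (cv1 x))).
    by under eq_fun do rewrite (hA _).2; exact: bounded_cvg bQ2 (cv2 (XL x)).
have bs1 j := @amp_left_creation R n Hf K1 e e_basis j.
have bs2 j := @amp_left_creation R n Hf K2 e e_basis j.
have bb1 j := @back_shift_bounded R n K1 j; have bb2 j := @back_shift_bounded R n K2 j.
have innerQ2 x y : inner (Q2 x) y = inner x (Q2 y).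
  rewrite /Q2 -[RHS]innerC2 -[RHS]inner_proj [LHS]inner_conj -innerC2 -inner_proj.
  by rewrite -inner_conj.
(* the graph of [X^*]: by [alg] for the left creation operators, whose adjoints are
   the backward shifts, it is a shift relation *)
pose G0 : set (wordL2 n K2 * wordL2 n K1) :=
  [set p | Q2 p.1 = p.1 /\ p.2 = adjoint XL p.1].
have G0shift : shift_relation M G0.
  split.
  - split; first by split; rewrite /= ?(lin0 (bounded_lin bQ2)) ?(lin0 (adjoint_is_lin bXL)).
    move=> a x w y v [/= Qx ->] [/= Qy ->].
    by split; rewrite /= ?(bounded_lin bQ2) ?Qx ?Qy ?(adjoint_is_lin bXL).
  - by move=> x w [/= _ ->]; exact: (adjoint_hbound bXL M0 hXL).2.
  - move=> j x w [/= Qx ->]; have [l1 l2] := alg _ (Lalg j); rewrite bs2 in l1 l2.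
    rewrite bs1 in l2; split => /=; apply: inner_extl => z.
      by rewrite innerQ2 !(adjointP (bb2 j)) -Qx !innerQ2 l1.
    symmetry; rewrite -(adjointPr bXL) (adjointP (bb2 j)).
    transitivity (inner (Q2 x) (adjoint (back_shift j) (XL z))); first by rewrite Qx.
    by rewrite innerQ2 -l2 (adjointPr bXL) (adjointP (bb1 j)).
have [W [hW WG Wshift]] := shift_lifting M0 G0shift.
have bW := hbound_bounded hW; pose GL := adjoint W.
have bGL : bounded_linear GL := adjoint_bounded bW.
have GL_comm A : bounded_linear A ->
    (forall j x, A (right_creation e j x) = right_creation e j (A x)) ->
    forall u, GL (amp T1 T1 A u) = amp T2 T2 A (GL u).
  move=> bA AR; apply: (slice_commutant e_basis) => // j u.
  rewrite bs1 bs2; apply: inner_extl => z.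
  rewrite -(adjointPr bW) -(adjointPr (bb1 j)) -Wshift (adjointPr bW).
  by rewrite (adjointPr (bb2 j)).
have [Jhardy _ _ _ _] := J_ideal.
(* [C2 GL] kills the complement of [N (x) K1]: the slices of [GL^* (V2 y)] lie in [N],
   because [GL] commutes with [A (x) I] for [A] in [J] *)
have GL_proj x : C2 (GL x) = C2 (GL (V1 (C1 x))).
  suff : C2 \o GL = C2 \o GL \o V1 \o C1 by move/(congr1 (@^~ x)).
  have bCG := bounded_comp bC2 bGL.
  apply: (tensor_ext tL1) => // [|{}x k]; first exact: (bounded_comp bCG (bounded_comp bV1 bC1)).
  rewrite /= /C1 /model_proj (ampE tL1 t1_tensor _ _ (proj_bounded _)).
  rewrite /V1 /model_incl (ampE t1_tensor tL1 _ _ (val_bounded _)).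
  apply: inner_extl => y; rewrite !innerC2 -!(adjointPr bW).
  rewrite !(adjointP (tensor_bounded tL1 k)).
  set h := adjoint _ _; apply/eqP; rewrite -subr_eq0 -innerBl; apply/eqP.
  have /subspace_valP[h' <-] : subspace_set (model_space J) h.
    apply/model_spaceP => A x' JA; rewrite /h -(adjointPr (tensor_bounded tL1 k)).
    have bA := hardy_bounded (Jhardy _ JA).
    rewrite -(ampE tL1 tL1 _ _ bA) (adjointP bW) -/GL GL_comm//; last first.
      by move=> j z; exact: (hardy_right_creation e_basis MZ_model _ _ (Jhardy _ JA)).
    rewrite inner_conj -innerC2.
    by rewrite /C2 (model_proj_ideal e_basis J_ideal t2_tensor)// inner0l conjC0.
  exact: proj_orthogonal.
pose G := C2 \o GL \o V1.
have bG : bounded_linear G := bounded_comp (bounded_comp bC2 bGL) bV1.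
have adjG y : adjoint G y = C1 (W (V2 y)).
  suff : adjoint G = C1 \o W \o V2 by move/(congr1 (@^~ y)).
  apply: adjointE => x z /=.
  by rewrite /G /= innerC2 -(adjointPr bW) inner_conj -innerC1 -inner_conj.
have adjGE (y : subspace_type E2) : adjoint G (val y) = val (adjoint X y).
  rewrite adjG (WG (V2 (val y)) (adjoint XL (V2 (val y)))).
    apply: inner_ext => z.
    rewrite inner_conj innerC1 -(adjointPr bXL) -inner_conj.
    rewrite /XL VK1 -innerC2 VK2.
    by rewrite inner_val (adjointP bX) inner_proj.
  by split => //=; rewrite /Q2 VK2 proj_val.
exists G; split => //.
- by move=> i u; rewrite /G /= -{1}(VK1 u) -CA1 -GL_proj GL_comm.
- by move=> y /subspace_valP[y' <-]; rewrite adjGE; exact: subspace_val.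
apply/le_anti/andP; split.
  apply: opnorm_le => // u.
  have hGL := adjoint_hbound bW M0 hW.
  have h := hbound_comp ler01 hC2 (hbound_comp M0 hGL hV1).
  by have := h.2 u; rewrite mul1r mulr1.
apply: opnorm_le => [|u]; first exact: opnorm_ge0.
have [->|Xu] := eqVneq (X u) 0; first by rewrite hnorm0 mulr_ge0 ?opnorm_ge0 ?hnorm_ge0.
have Xu0 : 0 < hnorm (X u) by rewrite lt_def hnorm_eq0 Xu hnorm_ge0.
rewrite -(ler_pM2r Xu0) -expr2 hnorm2 /rinner (adjointP bX) -inner_val -adjGE -(adjointP bG).
rewrite (le_trans (rinner_le _ _))// hnorm_val ler_wpM2r ?hnorm_ge0//.
exact: (hbound_opnorm bG).2.
Qed.
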